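(* Let $f = \sum_{n \ge 1} A(n) n^{\frac{k-1}{2}} q^n$ be a weight $k$ holomorphic cuspidal Hecke eigenform on $\mathrm{SL}(2,\mathbb{Z})$, normalized so that $A(1) = 1$. For any $\epsilon > 0$ there is an $X_0 = X_0(f,\epsilon)$ such that for all $X \ge X_0$ the following hold. (i) The sequence $\{A(n) : n = c^2 + d^2,\ (c,d) \in \mathbb{N}^2\}$ has at least one sign change among the indices $n = c^2 + d^2$ with $n \in [X, X + X^{\frac{3}{4}+\epsilon}]$. (ii) This sequence has at least $X^{\frac{1}{4}-\epsilon}$ sign changes in the interval $[X, 2X]$.
   Context: Here $q = e^{2\pi i z}$; the normalized coefficients $A(n)$ are real. The sequence $\{A(n) : n = c^2+d^2\}$ is indexed, in increasing order of $n$, by the positive integers $n$ that are sums of two integer squares ($\mathbb{N}$ includes $0$ here), i.e. those with $r_2(n) > 0$, where $r_2(n) = \#\{(c,d) \in \mathbb{Z}^2 : c^2+d^2 = n\}$. A real sequence has a sign change in an interval if there are two indices in the interval at which its terms are nonzero and of opposite signs. The number of sign changes in an interval is the number of sign changes between successive nonzero terms of the sequence with indices in the interval. *)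

(* Defs.v *)
From Stdlib Require Import Reals ZArith Arith List Lia.
From Coquelicot Require Import Coquelicot.
Import ListNotations.
Local Open Scope C_scope.

(* Same convention as [powerRZ]. *)
Definition CpowZ (w : C) (k : Z) : C :=
  match k with
  | Z0 => 1
  | Zpos p => w ^ Pos.to_nat p
  | Zneg p => / (w ^ Pos.to_nat p)
  end.

Definition Cexp (w : C) : C :=
  ((exp (Re w) * cos (Im w))%R, (exp (Re w) * sin (Im w))%R).

Definition q (z : C) : C := Cexp (2 * PI * Ci * z).

Definition Csum {T : Type} (g : T -> C) (l : list T) : C :=
  fold_right Cplus 0 (map g l).

(* Functions on the upper half-plane are total functions C -> C of which only
   the values at 0 < Im z matter. *)
Definition in_H (z : C) : Prop := (0 < Im z)%R.

Definition holomorphic_on_H (f : C -> C) : Prop :=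
  forall z : C, in_H z -> ex_derive (K := C_AbsRing) (V := C_NormedModule) f z.

Definition weakly_modular (k : Z) (f : C -> C) : Prop :=
  forall a b c d : Z, (a * d - b * c = 1)%Z ->
  forall z : C, in_H z ->
  f ((IZR a * z + IZR b) / (IZR c * z + IZR d)) =
  CpowZ (IZR c * z + IZR d) k * f z.

(* f(z) = \sum_{n >= 1} a(n) q^n; the value a(0) is not used. *)
Definition cuspidal_q_expansion (f : C -> C) (a : nat -> C) : Prop :=
  forall z : C, in_H z ->
  is_series (K := C_AbsRing) (V := C_NormedModule)
    (fun n : nat => a (S n) * q z ^ S n) (f z).

Definition cusp_form (k : Z) (f : C -> C) : Prop :=
  holomorphic_on_H f /\ weakly_modular k f /\
  exists a : nat -> C, cuspidal_q_expansion f a.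

Definition divisors (m : nat) : list nat :=
  filter (fun d => (m mod d =? 0)%nat) (seq 1 m).

(* (T_m f)(z) = m^(k-1) \sum_{ad = m} d^(-k) \sum_{0 <= b < d} f((az+b)/d). *)
Definition hecke (k : Z) (m : nat) (f : C -> C) (z : C) : C :=
  RtoC (powerRZ (INR m) (k - 1)) *
  Csum (fun d : nat =>
          RtoC (powerRZ (INR d) (- k)) *
          Csum (fun b : nat => f ((INR (m / d) * z + INR b) / INR d)) (seq 0 d))
       (divisors m).

Definition hecke_eigenform (k : Z) (f : C -> C) : Prop :=
  (exists z : C, in_H z /\ f z <> 0) /\
  forall m : nat, (1 <= m)%nat ->
  exists lambda : C, forall z : C, in_H z -> hecke k m f z = lambda * f z.

Local Open Scope R_scope.

Definition two_squares (n : nat) : Prop :=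
  (1 <= n)%nat /\ exists c d : nat, n = (c ^ 2 + d ^ 2)%nat.

Definition has_sign_change (A : nat -> R) (a b : R) : Prop :=
  exists m n : nat,
    two_squares m /\ a <= INR m <= b /\
    two_squares n /\ a <= INR n <= b /\
    A m < 0 < A n.

Definition nonzero_index (A : nat -> R) (a b : R) (n : nat) : Prop :=
  two_squares n /\ a <= INR n <= b /\ A n <> 0.

Lemma two_squares_dec (n : nat) : {two_squares n} + {~ two_squares n}.
Proof.
destruct (le_dec 1 n) as [Hn | Hn]; [| right; intros [H _]; tauto].
pose (t := existsb (fun c => existsb (fun d => Nat.eqb n (c ^ 2 + d ^ 2))
             (seq 0 (S n))) (seq 0 (S n))).
destruct t eqn:E; subst t.
- left; split; [exact Hn |].
  apply existsb_exists in E; destruct E as [c [_ E]].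
  apply existsb_exists in E; destruct E as [d [_ E]].
  exists c, d; now apply Nat.eqb_eq.
- right; intros [_ [c [d H]]].
  apply Bool.not_true_iff_false in E; apply E.
  apply existsb_exists; exists c; split; [apply in_seq; simpl in H; nia |].
  apply existsb_exists; exists d; split; [apply in_seq; simpl in H; nia |].
  now apply Nat.eqb_eq.
Qed.

Lemma nonzero_index_dec (A : nat -> R) (a b : R) (n : nat) :
  {nonzero_index A a b n} + {~ nonzero_index A a b n}.
Proof.
unfold nonzero_index.
destruct (two_squares_dec n); [| right; tauto].
destruct (Rle_dec a (INR n)); [| right; tauto].
destruct (Rle_dec (INR n) b); [| right; tauto].
destruct (Req_dec_T (A n) 0); [right | left]; tauto.
Qed.

(* In increasing order; [up b > b], so no index in [a, b] is missed. *)
Definition nonzero_indices (A : nat -> R) (a b : R) : list nat :=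
  filter (fun n => if nonzero_index_dec A a b n then true else false)
         (seq 1 (Z.to_nat (up b))).

Fixpoint sign_changes (l : list R) : nat :=
  match l with
  | x :: (y :: _) as t =>
      ((if Rlt_dec (x * y) 0 then 1 else 0) + sign_changes t)%nat
  | _ => 0%nat
  end.

Definition num_sign_changes (A : nat -> R) (a b : R) : nat :=
  sign_changes (map A (nonzero_indices A a b)).

(* Main.v *)
(** Write [a(n) = A(n) n^((k-1)/2)]. Only the squares [n = m^2 = m^2 + 0^2] are
    used, and the exponent 3/4 comes from products of integers of size X^(1/4).

    If A had no sign change on the two-square numbers of [X, X + C X^(3/4)],
    then all [A(m^2)] with [m^2] in the window would have one sign s. Choosing
    nearby coprime [b1, b2, z] with [b1 z], [b2 z], [P b1 b2] all in the window
    for m, multiplicativity gives [A(b1^2) A(b2^2) > 0] and hence [s A(P^2) >= 0],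
    for any fixed P. Taking P with [A(P^2) < 0], some R coprime to P, and [P R],
    gives a contradiction.

    Two inputs are needed. First, [A(m^2) <> 0] for m coprime to some Q: since
    [A(p^(2e+2)) = A(p^(e+1))^2 - A(p^e)^2], a zero forces [sqrt p] into the
    fraction field of the ring generated by the Hecke eigenvalues, which has
    finite degree because that ring acts on the Q-span of the coefficients of the
    period polynomial of the Eichler integral of f. Second, such a P exists:
    otherwise [|A(p)| >= 2] for all p not dividing Q, hence [A(n)^2 >= d(n)] for n
    coprime to Q, against the Rankin bound [sum_(n <= N) a(n)^2 = O(N^k)]. *)
Require Import Defs.
From Stdlib Require Import Reals ZArith Arith List Lia Lra Psatz Znumtheory.
From Stdlib Require Import Classical ClassicalEpsilon Permutation.
From Coquelicot Require Import Coquelicot.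
Local Open Scope R_scope.

(** * Finite sums and limits of complex sequences *)

(** The period polynomial supplies a rational structure of explicit finite dimension: integer
    matrices act on polynomials of degree at most k - 2 by integer coefficients, and the defect of
    the Eichler integral under SL(2,Z) is generated by its value at z -> -1/z. It is nonzero, since
    otherwise the Eichler integral would be a cuspidal modular function of weight 2 - k <= 0, which
    the growth bounds exclude. The root of p appears because k is even: a(p^e) = A(p^e) p^(e(k-1)/2)
    lies in the Hecke ring, and A(p^(e+1)) = +-A(p^e), rewritten in terms of a, carries one factor
    p^((k-1)/2). Many such primes would give too many square roots, independent over Q, in one
    finite-dimensional space. Three multipliers are used at the end because s is unknown: A(P^2) < 0
    forces s < 0, then A(R^2) < 0, so A(P^2 R^2) > 0, against s A(P^2 R^2) >= 0. The bound |A(p)| >=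
    2 comes from concavity: when |A(p)| < 2, a positive sequence A(p^(2e)) would be strictly concave
    on the natural numbers and yet never decrease, so its differences would eventually become
    negative. *)

Fixpoint rsum (u : nat -> R) (n : nat) : R :=
  match n with O => 0 | S m => rsum u m + u m end.

Fixpoint csum (u : nat -> C) (n : nat) : C :=
  match n with O => 0%C | S m => (csum u m + u m)%C end.

Lemma csum_S (u : nat -> C) (n : nat) : csum u (S n) = (csum u n + u n)%C.
Proof. reflexivity. Qed.

Lemma rsum_ext (u v : nat -> R) (n : nat) :
  (forall i, (i < n)%nat -> u i = v i) -> rsum u n = rsum v n.
Proof.
induction n as [|n IH]; intros H; [reflexivity|]; simpl.
rewrite IH, (H n); auto.
Qed.

Lemma csum_ext (u v : nat -> C) (n : nat) :
  (forall i, (i < n)%nat -> u i = v i) -> csum u n = csum v n.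
Proof.
induction n as [|n IH]; intros H; [reflexivity|]; simpl.
rewrite IH, (H n); auto.
Qed.

Lemma rsum_le (u v : nat -> R) (n : nat) :
  (forall i, (i < n)%nat -> u i <= v i) -> rsum u n <= rsum v n.
Proof.
induction n as [|n IH]; intros H; [simpl; lra|]; simpl.
apply Rplus_le_compat; auto.
Qed.

Lemma rsum_nonneg (u : nat -> R) (n : nat) :
  (forall i, (i < n)%nat -> 0 <= u i) -> 0 <= rsum u n.
Proof.
induction n as [|n IH]; intros H; [simpl; lra|]; simpl.
apply Rplus_le_le_0_compat; auto.
Qed.

Lemma rsum_plus (u v : nat -> R) (n : nat) :
  rsum (fun i => u i + v i) n = rsum u n + rsum v n.
Proof. induction n as [|n IH]; simpl; [ring|]; rewrite IH; ring. Qed.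

Lemma rsum_scal (a : R) (u : nat -> R) (n : nat) :
  rsum (fun i => a * u i) n = a * rsum u n.
Proof. induction n as [|n IH]; simpl; [ring|]; rewrite IH; ring. Qed.

Lemma rsum_const (a : R) (n : nat) : rsum (fun _ => a) n = INR n * a.
Proof.
induction n as [|n IH]; [simpl; ring|].
rewrite S_INR; simpl; rewrite IH; ring.
Qed.

Lemma rsum_exchange (u : nat -> nat -> R) (n m : nat) :
  rsum (fun i => rsum (fun j => u i j) m) n =
  rsum (fun j => rsum (fun i => u i j) n) m.
Proof.
induction n as [|n IH]; simpl.
- induction m as [|m IHm]; simpl; [reflexivity|]; rewrite <- IHm; ring.
- rewrite IH, <- rsum_plus; reflexivity.
Qed.

Lemma rsum_mono (u : nat -> R) (m n : nat) :
  (forall i, 0 <= u i) -> (m <= n)%nat -> rsum u m <= rsum u n.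
Proof.
intros H Hmn; induction Hmn as [|n Hmn IH]; [lra|]; simpl.
specialize (H n); lra.
Qed.

Lemma rsum_shift (u : nat -> R) (m n : nat) :
  rsum u (m + n) = rsum u m + rsum (fun i => u (m + i)%nat) n.
Proof.
induction n as [|n IH]; [rewrite Nat.add_0_r; simpl; ring|].
rewrite Nat.add_succ_r; simpl; rewrite IH; ring.
Qed.

Lemma csum_plus (u v : nat -> C) (n : nat) :
  csum (fun i => u i + v i)%C n = (csum u n + csum v n)%C.
Proof. induction n as [|n IH]; simpl; [ring|]; rewrite IH; ring. Qed.

Lemma csum_scal (a : C) (u : nat -> C) (n : nat) :
  csum (fun i => a * u i)%C n = (a * csum u n)%C.
Proof. induction n as [|n IH]; simpl; [ring|]; rewrite IH; ring. Qed.

Lemma csum_zero (n : nat) : csum (fun _ => 0%C) n = 0%C.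
Proof. induction n as [|n IH]; simpl; [reflexivity|]; rewrite IH; ring. Qed.

Lemma csum_const (a : C) (n : nat) : csum (fun _ => a) n = (INR n * a)%C.
Proof.
induction n as [|n IH]; [simpl; ring|].
rewrite S_INR, RtoC_plus; simpl; rewrite IH; ring.
Qed.

Lemma csum_exchange (u : nat -> nat -> C) (n m : nat) :
  csum (fun i => csum (fun j => u i j) m) n =
  csum (fun j => csum (fun i => u i j) n) m.
Proof.
induction n as [|n IH]; simpl.
- rewrite csum_zero; reflexivity.
- rewrite IH, <- csum_plus; reflexivity.
Qed.

Lemma csum_S_l (u : nat -> C) (n : nat) :
  csum u (S n) = (u O + csum (fun i => u (S i)) n)%C.
Proof.
induction n as [|n IH]; [simpl; ring|].
change (csum u (S (S n))) with (csum u (S n) + u (S n))%C.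
rewrite IH; simpl; ring.
Qed.

Lemma csum_shift (u : nat -> C) (m n : nat) :
  csum u (m + n) = (csum u m + csum (fun i => u (m + i)%nat) n)%C.
Proof.
induction n as [|n IH]; [rewrite Nat.add_0_r; simpl; ring|].
rewrite Nat.add_succ_r; simpl; rewrite IH; ring.
Qed.

Lemma csum_single (u : nat -> C) (j n : nat) :
  (j < n)%nat -> (forall i, (i < n)%nat -> i <> j -> u i = 0%C) ->
  csum u n = u j.
Proof.
intros Hj H; replace n with (j + S (n - S j))%nat by lia.
rewrite csum_shift, csum_S_l.
rewrite (csum_ext _ (fun _ => 0%C) j), (csum_ext _ (fun _ => 0%C) (n - S j)).
- rewrite !csum_zero, Nat.add_0_r; ring.
- intros i Hi; apply H; lia.
- intros i Hi; apply H; lia.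
Qed.

Lemma csum_RtoC (u : nat -> R) (n : nat) :
  csum (fun i => RtoC (u i)) n = RtoC (rsum u n).
Proof.
induction n as [|n IH]; [reflexivity|]; simpl.
rewrite IH, RtoC_plus; reflexivity.
Qed.

Lemma Cmod_csum_le (u : nat -> C) (v : nat -> R) (n : nat) :
  (forall i, (i < n)%nat -> Cmod (u i) <= v i) -> Cmod (csum u n) <= rsum v n.
Proof.
induction n as [|n IH]; intros H; simpl; [rewrite Cmod_0; lra|].
eapply Rle_trans; [apply Cmod_triangle|].
apply Rplus_le_compat; auto.
Qed.

Lemma Cmod_triangle_minus (a b : C) : Cmod (a - b) <= Cmod a + Cmod b.
Proof. rewrite <- (Cmod_opp b); apply Cmod_triangle. Qed.

Lemma Cmod_RtoC_pos (x : R) : 0 <= x -> Cmod x = x.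
Proof. intros H; rewrite Cmod_R; apply Rabs_pos_eq, H. Qed.

Lemma RtoC_inj_neq (x : R) : x <> 0 -> RtoC x <> 0%C.
Proof. intros H E; apply H, RtoC_inj, E. Qed.

Definition Clim (u : nat -> C) (l : C) : Prop :=
  forall e : R, 0 < e -> exists N, forall n, (N <= n)%nat -> Cmod (u n - l) < e.

Lemma Clim_ext (u v : nat -> C) (l : C) :
  (forall n, u n = v n) -> Clim u l -> Clim v l.
Proof.
intros E H e He; destruct (H e He) as [N HN]; exists N; intros n Hn.
rewrite <- E; auto.
Qed.

Lemma Clim_const (l : C) : Clim (fun _ => l) l.
Proof.
intros e He; exists O; intros n _.
replace (l - l)%C with (RtoC 0) by ring; rewrite Cmod_0; exact He.
Qed.

Lemma Clim_plus (u v : nat -> C) (l m : C) :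
  Clim u l -> Clim v m -> Clim (fun n => u n + v n)%C (l + m)%C.
Proof.
intros Hu Hv e He.
destruct (Hu (e / 2)) as [N1 H1]; [lra|].
destruct (Hv (e / 2)) as [N2 H2]; [lra|].
exists (max N1 N2); intros n Hn.
replace (u n + v n - (l + m))%C with ((u n - l) + (v n - m))%C by ring.
eapply Rle_lt_trans; [apply Cmod_triangle|].
specialize (H1 n ltac:(lia)); specialize (H2 n ltac:(lia)); lra.
Qed.

Lemma Clim_scal (a : C) (u : nat -> C) (l : C) :
  Clim u l -> Clim (fun n => a * u n)%C (a * l)%C.
Proof.
intros Hu e He.
assert (Ha : 0 < Cmod a + 1) by (pose proof (Cmod_ge_0 a); lra).
destruct (Hu (e / (Cmod a + 1))) as [N H1]; [apply Rdiv_lt_0_compat; lra|].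
exists N; intros n Hn; specialize (H1 n Hn).
replace (a * u n - a * l)%C with (a * (u n - l))%C by ring.
rewrite Cmod_mult.
apply Rle_lt_trans with ((Cmod a + 1) * Cmod (u n - l)).
- apply Rmult_le_compat_r; [apply Cmod_ge_0|lra].
- apply Rlt_le_trans with ((Cmod a + 1) * (e / (Cmod a + 1))).
  + apply Rmult_lt_compat_l; assumption.
  + right; field; lra.
Qed.

Lemma Clim_csum (u : nat -> nat -> C) (l : nat -> C) (m : nat) :
  (forall i, (i < m)%nat -> Clim (u i) (l i)) ->
  Clim (fun n => csum (fun i => u i n) m) (csum l m).
Proof.
induction m as [|m IH]; intros H; simpl; [apply Clim_const|].
apply Clim_plus; auto.
Qed.

(** The map [s] has only to tend to infinity: it is also applied to [N / p], which is not strictly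
    increasing. *)
Lemma Clim_subseq (u : nat -> C) (l : C) (s : nat -> nat) :
  (forall M, exists N, forall n, (N <= n)%nat -> (M <= s n)%nat) ->
  Clim u l -> Clim (fun n => u (s n)) l.
Proof.
intros Hs H e He; destruct (H e He) as [M HM]; destruct (Hs M) as [N HN].
exists N; intros n Hn; apply HM, HN, Hn.
Qed.

Lemma Clim_unique (u : nat -> C) (l m : C) : Clim u l -> Clim u m -> l = m.
Proof.
intros Hl Hm; destruct (Req_dec (Cmod (l - m)) 0) as [E|E].
- apply Cmod_eq_0 in E; replace l with (l - m + m)%C by ring; rewrite E; ring.
- pose proof (Cmod_ge_0 (l - m)).
  destruct (Hl (Cmod (l - m) / 2)) as [N1 H1]; [lra|].
  destruct (Hm (Cmod (l - m) / 2)) as [N2 H2]; [lra|].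
  specialize (H1 (max N1 N2) ltac:(lia)); specialize (H2 (max N1 N2) ltac:(lia)).
  exfalso; set (n := max N1 N2) in *.
  assert (Cmod (l - m) <= Cmod (u n - m) + Cmod (u n - l)).
  { replace (l - m)%C with ((u n - m) - (u n - l))%C by ring.
    apply Cmod_triangle_minus. }
  lra.
Qed.

Lemma Clim_Cmod_le (u : nat -> C) (l : C) (B : R) :
  Clim u l -> (forall n, Cmod (u n) <= B) -> Cmod l <= B.
Proof.
intros H HB; apply Rnot_lt_le; intros Hlt.
destruct (H (Cmod l - B)) as [N HN]; [lra|].
specialize (HN N (le_n N)); specialize (HB N).
assert (Cmod l <= Cmod (u N) + Cmod (u N - l)).
{ replace l with (u N - (u N - l))%C at 1 by ring; apply Cmod_triangle_minus. }
lra.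
Qed.

Lemma Clim_of_series (a : nat -> C) (l : C) :
  is_series (K := C_AbsRing) (V := C_NormedModule) a l -> Clim (csum a) l.
Proof.
intros H e He.
unfold is_series in H.
destruct (proj1 (@filterlim_locally_ball_norm C_AbsRing nat C_NormedModule
  eventually _ (sum_n a) l) H (mkposreal e He)) as [N HN].
(* [sum_n a n] includes the term of index n, hence equals [csum a (S n)]. *)
exists (S N); intros n Hn; destruct n as [|n]; [lia|].
specialize (HN n ltac:(lia)).
unfold ball_norm in HN.
replace (csum a (S n)) with (sum_n (G := C_AbelianMonoid) a n).
- exact HN.
- clear; induction n as [|n IH].
  + rewrite sum_O; simpl; ring.
  + rewrite sum_Sn, IH; reflexivity.
Qed.

Lemma Clim_complete (u : nat -> C) :
  (forall e, 0 < e -> exists N, forall n m,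
     (N <= n)%nat -> (N <= m)%nat -> Cmod (u n - u m) < e) ->
  exists l, Clim u l.
Proof.
intros H.
destruct (Rcomplete.R_complete (fun n => fst (u n))) as [x Hx].
{ intros e He; destruct (H e He) as [N HN]; exists N; intros n m Hn Hm.
  eapply Rle_lt_trans; [|apply (HN n m Hn Hm)].
  eapply Rle_trans; [|apply Rmax_Cmod]; apply Rmax_l. }
destruct (Rcomplete.R_complete (fun n => snd (u n))) as [y Hy].
{ intros e He; destruct (H e He) as [N HN]; exists N; intros n m Hn Hm.
  eapply Rle_lt_trans; [|apply (HN n m Hn Hm)].
  eapply Rle_trans; [|apply Rmax_Cmod]; apply Rmax_r. }
exists (x, y); intros e He.
destruct (Hx (e / 2)) as [N1 H1]; [lra|].
destruct (Hy (e / 2)) as [N2 H2]; [lra|].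
exists (max N1 N2); intros n Hn.
eapply Rle_lt_trans; [apply Cmod_2Rmax|].
assert (Hm : Rmax (Rabs (fst (u n - (x, y))%C)) (Rabs (snd (u n - (x, y))%C)) < e / 2)
  by (apply Rmax_lub_lt; [apply (H1 n)|apply (H2 n)]; lia).
assert (Hs : sqrt 2 <= 2) by (rewrite <- (sqrt_square 2) at 2 by lra; apply sqrt_le_1; lra).
pose proof (sqrt_pos 2).
pose proof (Rmax_l (Rabs (fst (u n - (x, y))%C)) (Rabs (snd (u n - (x, y))%C))).
pose proof (Rabs_pos (fst (u n - (x, y))%C)); nra.
Qed.

(** * The exponential and q-expansions *)

Lemma Cexp_plus (a b : C) : Cexp (a + b) = (Cexp a * Cexp b)%C.
Proof.
unfold Cexp; destruct a as [a1 a2], b as [b1 b2]; simpl.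
rewrite exp_plus, cos_plus, sin_plus.
apply injective_projections; simpl; ring.
Qed.

Lemma Cexp_0 : Cexp 0 = 1%C.
Proof.
unfold Cexp; simpl; rewrite exp_0, cos_0, sin_0.
apply injective_projections; simpl; ring.
Qed.

Lemma Cexp_pow (w : C) (n : nat) : (Cexp w ^ n)%C = Cexp (INR n * w).
Proof.
induction n as [|n IH].
- simpl; replace (0 * w)%C with (RtoC 0) by ring; rewrite Cexp_0; reflexivity.
- rewrite Cpow_S, IH, <- Cexp_plus, S_INR, RtoC_plus; f_equal; ring.
Qed.

Lemma Cmod_Cexp (w : C) : Cmod (Cexp w) = exp (Re w).
Proof.
unfold Cexp, Cmod; simpl.
pose proof (sin2_cos2 (Im w)) as H; unfold Rsqr in H.
replace (_ + _) with (exp (Re w) * exp (Re w)).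
- apply sqrt_square; left; apply exp_pos.
- transitivity (exp (Re w) * exp (Re w) *
    (sin (Im w) * sin (Im w) + cos (Im w) * cos (Im w))); [rewrite H|]; ring.
Qed.

Lemma q_pow (z : C) (n : nat) : (q z ^ n)%C = Cexp (INR n * (2 * PI * Ci * z)).
Proof. apply Cexp_pow. Qed.

Lemma Cmod_q_pow (z : C) (n : nat) :
  Cmod (q z ^ n) = exp (- (2 * PI * INR n * Im z)).
Proof.
rewrite q_pow, Cmod_Cexp; f_equal; destruct z as [x y]; simpl; ring.
Qed.

Lemma q_pow_plus (z h : C) (n : nat) :
  (q (z + h) ^ n)%C = (q z ^ n * Cexp (INR n * (2 * PI * Ci * h)))%C.
Proof. rewrite !q_pow, <- Cexp_plus; f_equal; ring. Qed.

Lemma Cexp_2PI (t : R) :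
  Cexp (2 * PI * Ci * t) = (cos (2 * (PI * t)), sin (2 * (PI * t))).
Proof.
replace (2 * PI * Ci * t)%C with ((0, 2 * (PI * t)) : C)
  by (apply injective_projections; simpl; ring).
unfold Cexp; simpl; rewrite exp_0; apply injective_projections; simpl; ring.
Qed.

Lemma Cexp_2PI_nat (n : nat) : Cexp (2 * PI * Ci * INR n) = 1%C.
Proof.
rewrite Cexp_2PI; replace (2 * (PI * INR n)) with (0 + 2 * INR n * PI) by ring.
rewrite cos_period, sin_period, cos_0, sin_0; reflexivity.
Qed.

Lemma Cexp_neq_1 (t : R) : 0 < t < 1 -> Cexp (2 * PI * Ci * t) <> 1%C.
Proof.
intros [H0 H1] E; rewrite Cexp_2PI in E.
apply (f_equal fst) in E; simpl in E; rewrite cos_2a_sin in E.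
assert (0 < sin (PI * t)).
{ pose proof PI_RGT_0; apply sin_gt_0; nra. }
nra.
Qed.

Lemma csum_geom (x : C) (n : nat) :
  ((x - 1) * csum (fun j => x ^ j) n = x ^ n - 1)%C.
Proof.
induction n as [|n IH]; [simpl; ring|].
rewrite Cpow_S; simpl csum.
replace ((x - 1) * (csum (fun j => x ^ j) n + x ^ n))%C with
  ((x - 1) * csum (fun j => x ^ j) n + (x - 1) * x ^ n)%C by ring.
rewrite IH; ring.
Qed.

Lemma csum_root_of_unity (x : C) (n : nat) :
  x <> 1%C -> (x ^ n)%C = 1%C -> csum (fun j => x ^ j)%C n = 0%C.
Proof.
intros Hx Hn; pose proof (csum_geom x n) as H; rewrite Hn in H.
assert (Hx' : (x - 1)%C <> 0%C).
{ intros E; apply Hx; replace x with (x - 1 + 1)%C by ring; rewrite E; ring. }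
replace (csum (fun j => x ^ j)%C n) with
  (/ (x - 1) * ((x - 1) * csum (fun j => x ^ j) n))%C by (field; exact Hx').
rewrite H; ring.
Qed.

Lemma csum_additive_character (n K : nat) :
  (0 < n < K)%nat ->
  csum (fun j => Cexp (2 * PI * Ci * (INR n * INR j / INR K)))%C K = 0%C.
Proof.
intros Hn.
assert (HK : 0 < INR K) by (apply lt_0_INR; lia).
rewrite (csum_ext _ (fun j => (Cexp (2 * PI * Ci * RtoC (INR n / INR K))) ^ j)%C).
- apply csum_root_of_unity.
  + apply Cexp_neq_1; split.
    * apply Rdiv_lt_0_compat; [apply lt_0_INR; lia|assumption].
    * apply Rmult_lt_reg_r with (INR K); [assumption|].
      unfold Rdiv; rewrite Rmult_assoc, Rinv_l by lra.
      rewrite Rmult_1_r, Rmult_1_l; apply lt_INR; lia.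
  + rewrite Cexp_pow, RtoC_div by lra.
    rewrite <- (Cexp_2PI_nat n); f_equal; field; apply RtoC_inj_neq; lra.
- intros j _; rewrite Cexp_pow, RtoC_div by lra; f_equal; field.
  apply RtoC_inj_neq; lra.
Qed.

Lemma Cconj_Cexp (w : C) : Cconj (Cexp w) = Cexp (Cconj w).
Proof.
destruct w as [x y]; unfold Cexp, Cconj; simpl; rewrite cos_neg, sin_neg.
apply injective_projections; simpl; ring.
Qed.

Lemma Cconj_csum (u : nat -> C) (n : nat) :
  Cconj (csum u n) = csum (fun i => Cconj (u i)) n.
Proof.
induction n as [|n IH]; simpl.
- apply injective_projections; simpl; ring.
- rewrite Cplus_conj, IH; reflexivity.
Qed.

(** The frequencies 1, ..., K differ by less than K, so summing over the K points j/K kills every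
    cross term. *)
Lemma finite_parseval (e : nat -> C) (K : nat) :
  (0 < K)%nat ->
  rsum (fun j => Cmod (csum (fun i => e i *
     Cexp (2 * PI * Ci * (INR j / INR K * INR (S i))))%C K) ^ 2) K =
  INR K * rsum (fun i => Cmod (e i) ^ 2) K.
Proof.
intros HK; assert (HK' : RtoC (INR K) <> 0%C)
  by (apply RtoC_inj_neq, not_0_INR; lia).
apply RtoC_inj; rewrite <- csum_RtoC.
set (ch := fun j i => Cexp (2 * PI * Ci * (INR j / INR K * INR (S i)))%C).
rewrite (csum_ext _ (fun j => csum (fun i => csum (fun l =>
   (e i * Cconj (e l) * (ch j i * Cconj (ch j l)))%C) K) K)).
2:{ intros j _; cbv beta; rewrite Cmod2_conj, Cconj_csum, Cmult_comm, <- csum_scal.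
    apply csum_ext; intros i _.
    rewrite Cmult_comm, <- csum_scal; apply csum_ext; intros l _.
    rewrite Cmult_conj; unfold ch; ring. }
rewrite csum_exchange.
rewrite (csum_ext _ (fun i => INR K * (e i * Cconj (e i)))%C).
- rewrite csum_scal, RtoC_mult, <- csum_RtoC; f_equal; apply csum_ext.
  intros i _; cbv beta; rewrite Cmod2_conj; reflexivity.
- intros i Hi; rewrite csum_exchange.
  rewrite (csum_single _ i K Hi).
  + rewrite (csum_ext _ (fun _ => e i * Cconj (e i))%C).
    * rewrite csum_const; reflexivity.
    * intros j _.
      replace (ch j i * Cconj (ch j i))%C with (RtoC 1); [ring|].
      rewrite <- Cmod2_conj; unfold ch; rewrite Cmod_Cexp.
      f_equal; symmetry; rewrite <- (pow1 2), <- exp_0; f_equal; f_equal.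
      rewrite <- RtoC_div by (apply not_0_INR; lia); simpl; ring.
  + intros l Hl Hil; rewrite csum_scal.
    replace (csum _ K) with (RtoC 0); [ring|symmetry].
    unfold ch.
    (* Natural subtraction forces b <= a here; the opposite order is reached by complex
       conjugation. *)
    assert (Hd : forall a b j, (b <= a)%nat ->
       (Cexp (2 * PI * Ci * (INR j / INR K * INR (S a))) *
        Cconj (Cexp (2 * PI * Ci * (INR j / INR K * INR (S b)))))%C =
       Cexp (2 * PI * Ci * (INR (a - b) * INR j / INR K))%C).
    { intros a b j Hab; rewrite Cconj_Cexp, <- Cexp_plus; f_equal.
      rewrite minus_INR, !S_INR by lia.
      rewrite <- RtoC_div by (apply not_0_INR; lia).
      rewrite <- !RtoC_mult, <- RtoC_div by (apply not_0_INR; lia).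
      apply injective_projections; simpl; field; apply not_0_INR; lia. }
    destruct (le_lt_dec l i) as [Hli|Hli].
    * rewrite <- (csum_additive_character (i - l) K) by lia.
      apply csum_ext; intros j _; apply Hd, Hli.
    * transitivity (Cconj (csum (fun j => Cexp (2 * PI * Ci *
        (INR (l - i) * INR j / INR K)))%C K)).
      -- rewrite Cconj_csum; apply csum_ext; intros j _.
         rewrite <- (Hd l i j) by lia.
         rewrite Cmult_conj, Cconj_conj; ring.
      -- rewrite csum_additive_character by lia.
         apply injective_projections; simpl; ring.
Qed.

(** * q-series on the upper half-plane *)

Definition psum (c : nat -> C) (z : C) (N : nat) : C :=
  csum (fun i => c (S i) * q z ^ S i)%C N.

Definition qexp (c : nat -> C) (g : C -> C) : Prop :=
  forall z, in_H z -> Clim (psum c z) (g z).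

(** Equivalent to convergence of the q-series on the whole half-plane, but visibly stable under
    multiplying or dividing the coefficients by powers of the index. *)
Definition tame (c : nat -> C) : Prop :=
  forall y, 0 < y -> exists B, 0 <= B /\
    forall n, Cmod (c (S n)) <= B * exp (2 * PI * INR (S n) * y).

Lemma qexp_of_series (c : nat -> C) (g : C -> C) :
  cuspidal_q_expansion g c -> qexp c g.
Proof. intros H z Hz; apply Clim_of_series, H, Hz. Qed.

Lemma Clim_bounded (u : nat -> C) (l : C) :
  Clim u l -> exists B, 0 <= B /\ forall n, Cmod (u n) <= B.
Proof.
intros H; destruct (H 1) as [N HN]; [lra|].
exists (rsum (fun n => Cmod (u n)) N + (Cmod l + 1)).
assert (Hs : 0 <= rsum (fun n => Cmod (u n)) N)
  by (apply rsum_nonneg; intros; apply Cmod_ge_0).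
split; [pose proof (Cmod_ge_0 l); lra|].
intros n; destruct (le_lt_dec N n) as [Hn|Hn].
- specialize (HN n Hn).
  assert (Cmod (u n) <= Cmod (u n - l) + Cmod l).
  { replace (u n) with ((u n - l) + l)%C at 1 by ring; apply Cmod_triangle. }
  lra.
- pose proof (rsum_mono (fun n => Cmod (u n)) (S n) N (fun i => Cmod_ge_0 (u i)) Hn) as H'.
  simpl in H'.
  assert (0 <= rsum (fun n => Cmod (u n)) n)
    by (apply rsum_nonneg; intros; apply Cmod_ge_0).
  pose proof (Cmod_ge_0 l); lra.
Qed.

Lemma qexp_tame (c : nat -> C) (g : C -> C) : qexp c g -> tame c.
Proof.
intros H y Hy.
destruct (Clim_bounded _ _ (H ((0, y) : C) Hy)) as [B [HB0 HB]].
exists (2 * B); split; [lra|]; intros n.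
assert (E : Cmod (c (S n) * q (0, y) ^ S n) <= 2 * B).
{ replace (c (S n) * q (0, y) ^ S n)%C with
    (psum c (0, y) (S n) - psum c (0, y) n)%C by (unfold psum; simpl; ring).
  eapply Rle_trans; [apply Cmod_triangle_minus|].
  pose proof (HB n); pose proof (HB (S n)); lra. }
rewrite Cmod_mult, Cmod_q_pow in E; simpl Im in E.
apply Rmult_le_reg_r with (exp (- (2 * PI * INR (S n) * y))); [apply exp_pos|].
rewrite (Rmult_assoc (2 * B)), <- exp_plus.
rewrite Rplus_opp_r, exp_0, Rmult_1_r; exact E.
Qed.

Lemma rsum_geom_le (x : R) (n : nat) :
  0 < x < 1 -> rsum (fun i => x ^ S i) n <= x / (1 - x).
Proof.
intros Hx.
assert (E : rsum (fun i => x ^ S i) n = x / (1 - x) * (1 - x ^ n)).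
{ induction n as [|n IH]; [simpl; field; lra|].
  change (rsum (fun i => x ^ S i) (S n)) with (rsum (fun i => x ^ S i) n + x ^ S n).
  rewrite IH; simpl; field; lra. }
rewrite E; rewrite <- (Rmult_1_r (x / (1 - x))) at 2.
apply Rmult_le_compat_l; [left; apply Rdiv_lt_0_compat; lra|].
pose proof (pow_lt x n (proj1 Hx)); lra.
Qed.

Lemma exp_neg_lt_1 (x : R) : 0 < x -> 0 < exp (- x) < 1.
Proof.
intros Hx; split; [apply exp_pos|].
rewrite <- exp_0; apply exp_increasing; lra.
Qed.

Lemma exp_le (x y : R) : x <= y -> exp x <= exp y.
Proof.
intros [H|H]; [left; apply exp_increasing, H|right; f_equal; exact H].
Qed.

Lemma exp_INR (x : R) (n : nat) : exp x ^ n = exp (INR n * x).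
Proof.
induction n as [|n IH]; [simpl; rewrite Rmult_0_l, exp_0; reflexivity|].
rewrite S_INR; simpl pow; rewrite IH, <- exp_plus; f_equal; ring.
Qed.

(** Half of the decay exp(-2 pi n Im z) pays for the growth of c(n), taken at height y0/2; this is
    why the rate is pi. *)
Lemma tame_terms (c : nat -> C) (y0 : R) :
  tame c -> 0 < y0 -> exists B, 0 <= B /\ forall z n, y0 <= Im z ->
    Cmod (c (S n) * q z ^ S n) <= B * exp (- (PI * Im z)) ^ S n.
Proof.
intros Hc Hy0; destruct (Hc (y0 / 2)) as [B [HB0 HB]]; [lra|].
exists B; split; [exact HB0|]; intros z n Hz.
rewrite Cmod_mult, Cmod_q_pow, exp_INR.
eapply Rle_trans; [apply Rmult_le_compat_r; [left; apply exp_pos|apply HB]|].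
rewrite (Rmult_assoc B), <- exp_plus.
apply Rmult_le_compat_l; [exact HB0|].
assert (0 < INR (S n)) by (apply lt_0_INR; lia).
pose proof PI_RGT_0.
assert (Hp : 0 < PI * INR (S n)) by (apply Rmult_lt_0_compat; lra).
apply exp_le; nra.
Qed.

Lemma Cmod_psum_le (c : nat -> C) (y0 : R) :
  tame c -> 0 < y0 -> exists B, 0 <= B /\ forall z m n, y0 <= Im z ->
    Cmod (psum c z (m + n) - psum c z m) <= B * exp (- (PI * Im z)) ^ S m.
Proof.
intros Hc Hy0; destruct (tame_terms c y0 Hc Hy0) as [B [HB0 HB]].
pose proof PI_RGT_0.
set (r := exp (- (PI * y0))).
assert (Hr : 0 < r < 1) by (apply exp_neg_lt_1, Rmult_lt_0_compat; lra).
exists (B / (1 - r)); split.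
{ apply Rmult_le_pos; [lra|left; apply Rinv_0_lt_compat; lra]. }
intros z m n Hz; unfold psum; rewrite csum_shift.
match goal with |- Cmod (?a + ?b - ?a) <= _ =>
  replace (a + b - a)%C with b by ring end.
set (s := exp (- (PI * Im z))).
assert (Hs : 0 < s < 1) by (apply exp_neg_lt_1, Rmult_lt_0_compat; lra).
assert (Hsr : s <= r).
{ apply exp_le; nra. }
eapply Rle_trans.
- apply (Cmod_csum_le _ (fun i => B * s ^ m * s ^ S i)); intros i _.
  eapply Rle_trans; [apply HB, Hz|]; fold s.
  right; replace (S (m + i)) with (m + S i)%nat by lia.
  rewrite pow_add; ring.
- rewrite (rsum_scal (B * s ^ m) (fun i => s ^ S i)).
  pose proof (rsum_geom_le s n Hs) as Hg.
  assert (Hp : 0 <= B * s ^ m) by (apply Rmult_le_pos; [lra|left; apply pow_lt; lra]).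
  eapply Rle_trans; [apply Rmult_le_compat_l; [exact Hp|exact Hg]|].
  replace (B * s ^ m * (s / (1 - s))) with (B * s ^ S m * / (1 - s))
    by (simpl; field; lra).
  replace (B / (1 - r) * s ^ S m) with (B * s ^ S m * / (1 - r)) by (field; lra).
  apply Rmult_le_compat_l.
  + apply Rmult_le_pos; [lra|left; apply pow_lt; lra].
  + apply Rinv_le_contravar; lra.
Qed.

Lemma pow_small (x e B : R) :
  0 < x < 1 -> 0 < e -> exists N, forall n, (N <= n)%nat -> B * x ^ n < e.
Proof.
intros Hx He.
destruct (pow_lt_1_zero x) with (y := e / (Rabs B + 1)) as [N HN].
- rewrite Rabs_pos_eq; lra.
- apply Rdiv_lt_0_compat; [lra|pose proof (Rabs_pos B); lra].
- exists N; intros n Hn; specialize (HN n Hn).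
  pose proof (Rabs_pos B); pose proof (Rle_abs B).
  assert (Hp : 0 < x ^ n) by (apply pow_lt; lra).
  rewrite Rabs_pos_eq in HN by lra.
  apply Rle_lt_trans with ((Rabs B + 1) * x ^ n); [nra|].
  apply Rlt_le_trans with ((Rabs B + 1) * (e / (Rabs B + 1))).
  + apply Rmult_lt_compat_l; lra.
  + right; field; lra.
Qed.

Lemma tame_Clim_ex (c : nat -> C) (z : C) :
  tame c -> in_H z -> exists l, Clim (psum c z) l.
Proof.
intros Hc Hz; unfold in_H in Hz.
destruct (Cmod_psum_le c (Im z) Hc Hz) as [B [HB0 HB]].
pose proof PI_RGT_0.
set (r := exp (- (PI * Im z))).
assert (Hr : 0 < r < 1) by (apply exp_neg_lt_1, Rmult_lt_0_compat; lra).
apply Clim_complete; intros e He.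
destruct (pow_small r (e / 2) B Hr) as [N HN]; [lra|].
exists N; intros n m Hn Hm.
pose proof (HB z N (n - N)%nat (Rle_refl _)) as H1.
pose proof (HB z N (m - N)%nat (Rle_refl _)) as H2.
replace (N + (n - N))%nat with n in H1 by lia.
replace (N + (m - N))%nat with m in H2 by lia.
specialize (HN (S N) ltac:(lia)); fold r in H1, H2.
replace (psum c z n - psum c z m)%C with
  ((psum c z n - psum c z N) - (psum c z m - psum c z N))%C by ring.
eapply Rle_lt_trans; [apply Cmod_triangle_minus|]; lra.
Qed.

(** A value picked by [epsilon]; it is the limit whenever [c] is tame and z lies in the
    half-plane. *)
Definition qsum (c : nat -> C) (z : C) : C :=
  epsilon (inhabits (RtoC 0)) (Clim (psum c z)).

Lemma qexp_qsum (c : nat -> C) : tame c -> qexp c (qsum c).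
Proof.
intros Hc z Hz; unfold qsum; apply epsilon_spec, tame_Clim_ex; assumption.
Qed.

Lemma qexp_tail (c : nat -> C) (g : C -> C) (y0 : R) :
  qexp c g -> 0 < y0 -> exists B, 0 <= B /\ forall z m, y0 <= Im z ->
    Cmod (g z - psum c z m) <= B * exp (- (PI * Im z)) ^ S m.
Proof.
intros Hg Hy0; destruct (Cmod_psum_le c y0 (qexp_tame _ _ Hg) Hy0) as [B [HB0 HB]].
exists B; split; [exact HB0|]; intros z m Hz.
apply (Clim_Cmod_le (fun n => psum c z (m + n) - psum c z m)%C).
- replace (g z - psum c z m)%C with (g z + - psum c z m)%C by ring.
  apply Clim_plus; [|apply Clim_const].
  apply (Clim_subseq (psum c z) _ (fun n => m + n)%nat); [|apply Hg; unfold in_H; lra].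
  intros M; exists M; intros; lia.
- intros n; apply HB, Hz.
Qed.

Lemma qexp_decay (c : nat -> C) (g : C -> C) (y0 : R) :
  qexp c g -> 0 < y0 -> exists B, 0 <= B /\ forall z, y0 <= Im z ->
    Cmod (g z) <= B * exp (- (PI * Im z)).
Proof.
intros Hg Hy0; destruct (qexp_tail c g y0 Hg Hy0) as [B [HB0 HB]].
exists B; split; [exact HB0|]; intros z Hz.
specialize (HB z O Hz); simpl in HB.
replace (g z - psum c z 0)%C with (g z) in HB by (unfold psum; simpl; ring).
rewrite Rmult_1_r in HB; exact HB.
Qed.

(** Parseval without an integral: on the line Im = y a partial sum is uniformly within eta of g,
    [finite_parseval] is applied to its values at the points j/M, and eta tends to 0. *)
Lemma qexp_parseval (c : nat -> C) (g : C -> C) (y B : R) (N : nat) :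
  qexp c g -> 0 < y -> (forall x, Cmod (g (x, y)) <= B) ->
  rsum (fun i => Cmod (c (S i)) ^ 2 * exp (- (4 * PI * INR (S i) * y))) N <= B ^ 2.
Proof.
intros Hg Hy HB.
assert (HB0 : 0 <= B) by (eapply Rle_trans; [apply Cmod_ge_0|apply (HB 0)]).
pose proof PI_RGT_0.
destruct (qexp_tail c g y Hg Hy) as [T [HT0 HT]].
set (r := exp (- (PI * y))) in *.
assert (Hr : 0 < r < 1) by (apply exp_neg_lt_1, Rmult_lt_0_compat; lra).
set (S0 := rsum _ N).
assert (H1 : forall eta, 0 < eta -> S0 <= (B + eta) ^ 2).
{ intros eta Heta; destruct (pow_small r eta T Hr Heta) as [M0 HM0].
  set (M := S (max M0 N)).
  pose (e := fun i => (c (S i) * q (0, y) ^ S i)%C).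
  assert (E : forall j, csum (fun i => e i *
     Cexp (2 * PI * Ci * (INR j / INR M * INR (S i))))%C M = psum c ((INR j / INR M)%R, y) M).
  { intros j; apply csum_ext; intros i _; unfold e.
    replace (((INR j / INR M)%R, y) : C) with ((0, y) + RtoC (INR j / INR M))%C
      by (apply injective_projections; simpl; ring).
    rewrite q_pow_plus, RtoC_div by (apply not_0_INR; unfold M; lia).
    rewrite <- Cmult_assoc; do 3 f_equal; ring. }
  assert (Hle : forall j, Cmod (psum c ((INR j / INR M)%R, y) M) ^ 2 <= (B + eta) ^ 2).
  { intros j; apply pow_incr; split; [apply Cmod_ge_0|].
    specialize (HT ((INR j / INR M)%R, y) M (Rle_refl _)); simpl Im in HT; fold r in HT.
    specialize (HM0 (S M) ltac:(unfold M; lia)); specialize (HB (INR j / INR M)).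
    set (P := psum c ((INR j / INR M)%R, y) M) in *.
    assert (Cmod P <= Cmod (g ((INR j / INR M)%R, y)) + Cmod (g ((INR j / INR M)%R, y) - P)).
    { replace P with (g ((INR j / INR M)%R, y) - (g ((INR j / INR M)%R, y) - P))%C at 1 by ring.
      apply Cmod_triangle_minus. }
    lra. }
  pose proof (finite_parseval e M ltac:(unfold M; lia)) as HP.
  assert (HMp : 0 < INR M) by (apply lt_0_INR; unfold M; lia).
  assert (HP2 : INR M * rsum (fun i => Cmod (e i) ^ 2) M <= INR M * (B + eta) ^ 2).
  { rewrite <- HP, <- rsum_const; apply rsum_le; intros j _; rewrite E; apply Hle. }
  apply Rmult_le_reg_l in HP2; [|exact HMp].
  eapply Rle_trans; [|exact HP2].
  eapply Rle_trans; [|apply (rsum_mono _ N M)].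
  - right; apply rsum_ext; intros i _; unfold e.
    rewrite Cmod_mult, Cmod_q_pow, Rpow_mult_distr; f_equal.
    rewrite exp_INR; f_equal; simpl Im; simpl (INR 2); ring.
  - intros i; apply pow2_ge_0.
  - unfold M; lia. }
apply Rnot_lt_le; intros Hlt.
set (d := S0 - B ^ 2).
assert (Hd : 0 < d) by (unfold d; lra).
(* Chosen so that (B + t)^2 - B^2 = t(2B + t) <= t(2B + 1) < d. *)
set (t := Rmin 1 (d / (2 * B + 2))).
assert (Ht : 0 < t) by (apply Rmin_glb_lt; [lra|apply Rdiv_lt_0_compat; lra]).
specialize (H1 t Ht).
assert (t <= 1) by apply Rmin_l.
assert (Ht2 : t <= d / (2 * B + 2)) by apply Rmin_r.
apply Rle_div_r in Ht2; [|lra].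
unfold d in *; nra.
Qed.

(** * Growth of modular forms *)

(** Invariance under z -> z + 1 comes with a q-expansion, so the relation for z -> -1/z completes
    the modularity. *)
Definition S_modular (w : Z) (g : C -> C) : Prop :=
  forall z, in_H z -> g (-1 / z)%C = (CpowZ z w * g z)%C.

Lemma in_H_neq_0 (z : C) : in_H z -> z <> 0%C.
Proof. unfold in_H; intros H E; rewrite E in H; simpl in H; lra. Qed.

Lemma Cmod_sqr (z : C) : Cmod z ^ 2 = Re z ^ 2 + Im z ^ 2.
Proof. apply Cmod2_alt. Qed.

Lemma Im_neg_inv (z : C) : z <> 0%C -> Im (-1 / z)%C = Im z / Cmod z ^ 2.
Proof.
intros Hz; rewrite Cmod_sqr; destruct z as [x y]; simpl.
assert (x ^ 2 + y ^ 2 <> 0).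
{ intros E; apply Hz; assert (x = 0) by nra; assert (y = 0) by nra; subst; reflexivity. }
simpl in *; field; intros E; apply H; lra.
Qed.

Lemma in_H_neg_inv (z : C) : in_H z -> in_H (-1 / z)%C.
Proof.
intros Hz; pose proof (in_H_neq_0 z Hz) as Hz0; unfold in_H in *.
rewrite Im_neg_inv by exact Hz0.
apply Rdiv_lt_0_compat; [exact Hz|].
apply pow_lt, Cmod_gt_0, Hz0.
Qed.

Lemma Im_plus_real (z : C) (x : R) : Im (z + x)%C = Im z.
Proof. destruct z; simpl; ring. Qed.

Lemma weakly_modular_S (w : Z) (g : C -> C) : weakly_modular w g -> S_modular w g.
Proof.
intros H z Hz; specialize (H 0%Z (-1)%Z 1%Z 0%Z eq_refl z Hz).
replace (0 * z + -1)%C with (RtoC (-1)) in H by ring.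
replace (1 * z + 0)%C with z in H by ring.
exact H.
Qed.

Lemma Cexp_2PI_Z (m : Z) : Cexp (2 * PI * Ci * IZR m) = 1%C.
Proof.
destruct (Z_le_gt_dec 0 m) as [Hm|Hm].
- rewrite <- (Z2Nat.id m Hm), <- INR_IZR_INZ; apply Cexp_2PI_nat.
- assert (E : (Cexp (2 * PI * Ci * IZR m) * Cexp (2 * PI * Ci * INR (Z.to_nat (- m))))%C = 1%C).
  { rewrite <- Cexp_plus, INR_IZR_INZ, Z2Nat.id, opp_IZR by lia.
    rewrite RtoC_opp, <- Cexp_0; f_equal; ring. }
  rewrite Cexp_2PI_nat, Cmult_1_r in E; exact E.
Qed.

Lemma q_pow_periodic (z : C) (m : Z) (n : nat) : (q (z + IZR m) ^ n = q z ^ n)%C.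
Proof.
rewrite q_pow_plus.
replace (INR n * (2 * PI * Ci * IZR m))%C with
  (2 * PI * Ci * RtoC (IZR (Z.of_nat n * m)))%C.
- rewrite Cexp_2PI_Z; ring.
- rewrite mult_IZR, RtoC_mult, <- INR_IZR_INZ; ring.
Qed.

Lemma qexp_periodic (c : nat -> C) (g : C -> C) (z : C) (m : Z) :
  qexp c g -> in_H z -> g (z + IZR m)%C = g z.
Proof.
intros Hg Hz; apply (Clim_unique (psum c z)); [|apply Hg, Hz].
apply (Clim_ext (psum c (z + IZR m))).
- intros n; apply csum_ext; intros i _; rewrite q_pow_periodic; reflexivity.
- apply Hg; unfold in_H in *; rewrite Im_plus_real; exact Hz.
Qed.

(* If |Re z| <= 1/2 and Im z < 1/2 then z |-> -1/z at least doubles the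
   imaginary part, so finitely many steps lead to Im z >= 1/2. *)
Lemma upper_half_plane_reduction (P : C -> Prop) :
  (forall z, 1 / 2 <= Im z -> P z) ->
  (forall z m, in_H z -> P (z + IZR m)%C -> P z) ->
  (forall z, in_H z -> P (-1 / z)%C -> P z) ->
  forall z, in_H z -> P z.
Proof.
intros H0 HT HS.
assert (H : forall n z, in_H z -> (1 / 2) ^ S n <= Im z -> P z).
{ induction n as [|n IH]; intros z Hz Hn.
  - apply H0; simpl in Hn; lra.
  - destruct (Rle_lt_dec (1 / 2) (Im z)) as [Hy|Hy]; [apply H0, Hy|].
    set (u := up (Re z - 1 / 2)).
    apply (HT z (- u)%Z Hz).
    set (z' := (z + IZR (- u))%C).
    assert (Hi : Im z' = Im z) by apply Im_plus_real.
    assert (Hz' : in_H z') by (unfold in_H in *; rewrite Hi; exact Hz).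
    apply (HS z' Hz').
    assert (Hr : -1 / 2 <= Re z' <= 1 / 2).
    { assert (E : Re z' = Re z - IZR u)
        by (unfold z'; rewrite opp_IZR; destruct z; simpl; ring).
      destruct (archimed (Re z - 1 / 2)); rewrite E; unfold u; lra. }
    unfold in_H in Hz.
    assert (Hm : Cmod z' ^ 2 <= 1 / 2) by (rewrite Cmod_sqr, Hi; nra).
    assert (Hm0 : 0 < Cmod z' ^ 2) by (apply pow_lt, Cmod_gt_0, in_H_neq_0, Hz').
    assert (Hd : 2 * Im z <= Im (-1 / z')%C).
    { rewrite Im_neg_inv by (apply in_H_neq_0, Hz'); rewrite Hi.
      apply Rmult_le_reg_r with (Cmod z' ^ 2); [exact Hm0|].
      replace (Im z / Cmod z' ^ 2 * Cmod z' ^ 2) with (Im z) by (field; intros E; rewrite E in Hm0; simpl in Hm0; lra); nra. }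
    apply IH; [apply in_H_neg_inv, Hz'|].
    change ((1 / 2) ^ S (S n)) with (1 / 2 * (1 / 2) ^ S n) in Hn; lra. }
intros z Hz; unfold in_H in Hz.
destruct (pow_lt_1_zero (1 / 2)) with (y := Im z) as [N HN]; [|exact Hz|].
- rewrite Rabs_pos_eq; lra.
- specialize (HN (S N) ltac:(lia)).
  rewrite Rabs_pos_eq in HN by (apply pow_le; lra).
  apply (H N z Hz); lra.
Qed.

Lemma Cmod_CpowZ (z : C) (w : Z) :
  z <> 0%C -> Cmod (CpowZ z w) = Rpower (Cmod z) (IZR w).
Proof.
intros Hz; rewrite <- powerRZ_Rpower by (apply Cmod_gt_0, Hz).
destruct w as [|p|p]; simpl.
- apply Cmod_1.
- apply Cmod_pow.
- rewrite Cmod_inv by (apply Cpow_nz, Hz); rewrite Cmod_pow; reflexivity.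
Qed.

(** |g(z)| (Im z)^(w/2) is invariant because Im(-1/z) = Im z / |z|^2. *)
Lemma S_modular_Cmod (w : Z) (g : C -> C) (z : C) :
  S_modular w g -> in_H z ->
  Cmod (g (-1 / z)%C) * Rpower (Im (-1 / z)%C) (IZR w / 2) =
  Cmod (g z) * Rpower (Im z) (IZR w / 2).
Proof.
intros Hg Hz; pose proof (in_H_neq_0 z Hz) as Hz0.
assert (Hm : 0 < Cmod z) by (apply Cmod_gt_0, Hz0).
rewrite (Hg z Hz), Cmod_mult, Cmod_CpowZ, Im_neg_inv by exact Hz0.
unfold Rpower, Rdiv.
rewrite ln_mult, ln_Rinv, <- (Rpower_pow 2) by
  (try apply Rinv_0_lt_compat; try apply pow_lt; assumption).
unfold Rpower; rewrite ln_exp; simpl (INR 2).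
rewrite (Rmult_comm (exp _) (Cmod (g z))), Rmult_assoc, <- exp_plus.
f_equal; f_equal; field.
Qed.

Lemma Rpower_exp_bound (s : R) :
  exists K, forall y, 1 / 2 <= y -> exp (- (PI * y)) * Rpower y s <= K.
Proof.
destruct (Rle_lt_dec 0 s) as [Hs|Hs].
(* From ln(y/b) <= y/b follows s ln y <= s ln b + s y/b, and s <= pi b lets exp(-pi y) absorb the
   last term. *)
- set (b := s / PI + 1).
  pose proof PI_RGT_0.
  assert (Hb0 : 0 <= s / PI)
    by (apply Rmult_le_pos; [lra|left; apply Rinv_0_lt_compat; lra]).
  assert (Hb : 0 < b) by (unfold b; lra).
  exists (exp (s * ln b)); intros y Hy.
  unfold Rpower; rewrite <- exp_plus; apply exp_le.
  replace y with (b * (y / b)) at 2 by (field; lra).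
  assert (Hyb : 0 < y / b) by (apply Rdiv_lt_0_compat; lra).
  rewrite ln_mult by assumption.
  assert (Hl : ln (y / b) <= y / b).
  { pose proof (exp_ineq1_le (ln (y / b))) as H1.
    rewrite exp_ln in H1 by assumption; lra. }
  assert (s * (y / b) <= PI * y).
  { apply Rmult_le_reg_r with b; [exact Hb|].
    replace (s * (y / b) * b) with (s * y) by (field; lra).
    replace (PI * y * b) with (s * y + PI * y) by (unfold b; field; lra).
    nra. }
  nra.
- exists (exp (- s)); intros y Hy.
  unfold Rpower; rewrite <- exp_plus; apply exp_le.
  assert (Hl : -1 <= ln y).
  { pose proof (exp_ineq1_le (ln (/ y))) as H1.
    assert (0 < / y) by (apply Rinv_0_lt_compat; lra).
    rewrite exp_ln, ln_Rinv in H1 by lra.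
    assert (/ y <= 2).
    { replace 2 with (/ (1 / 2)) by field; apply Rinv_le_contravar; lra. }
    lra. }
  pose proof PI_RGT_0; nra.
Qed.

(** Exponential decay bounds the invariant |g| (Im z)^(w/2) on Im z >= 1/2, and translations
    together with z -> -1/z carry every point there. *)
Lemma modular_growth (c : nat -> C) (g : C -> C) (w : Z) :
  qexp c g -> S_modular w g ->
  exists K, 0 <= K /\ forall z, in_H z -> Cmod (g z) <= K * Rpower (Im z) (- (IZR w / 2)).
Proof.
intros Hg Hm.
destruct (qexp_decay c g (1 / 2) Hg) as [B [HB0 HB]]; [lra|].
destruct (Rpower_exp_bound (IZR w / 2)) as [K0 HK0].
exists (B * Rmax K0 0); split.
{ apply Rmult_le_pos; [exact HB0|apply Rmax_r]. }
assert (H : forall z, in_H z ->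
  Cmod (g z) * Rpower (Im z) (IZR w / 2) <= B * Rmax K0 0).
{ apply upper_half_plane_reduction.
  - intros z Hz; specialize (HB z Hz); specialize (HK0 (Im z) Hz).
    apply Rle_trans with (B * exp (- (PI * Im z)) * Rpower (Im z) (IZR w / 2)).
    + apply Rmult_le_compat_r; [left; apply exp_pos|exact HB].
    + rewrite Rmult_assoc; apply Rmult_le_compat_l; [exact HB0|].
      eapply Rle_trans; [exact HK0|apply Rmax_l].
  - intros z m Hz; rewrite Im_plus_real, (qexp_periodic c g z m Hg Hz); auto.
  - intros z Hz; rewrite (S_modular_Cmod w g z Hm Hz); auto. }
intros z Hz; specialize (H z Hz).
rewrite Rpower_Ropp.
apply Rmult_le_reg_r with (Rpower (Im z) (IZR w / 2)); [apply exp_pos|].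
rewrite Rmult_assoc, Rinv_l, Rmult_1_r by (apply Rgt_not_eq, exp_pos).
exact H.
Qed.

(** One term of the Parseval sum; y remains free and is optimized by each use. *)
Lemma qexp_coeff_le (c : nat -> C) (g : C -> C) (y B : R) (n : nat) :
  qexp c g -> 0 < y -> (forall x, Cmod (g (x, y)) <= B) ->
  Cmod (c (S n)) ^ 2 <= B ^ 2 * exp (4 * PI * INR (S n) * y).
Proof.
intros Hg Hy HB.
pose proof (qexp_parseval c g y B (S n) Hg Hy HB) as H.
simpl rsum in H.
assert (0 <= rsum (fun i => Cmod (c (S i)) ^ 2 * exp (- (4 * PI * INR (S i) * y))) n).
{ apply rsum_nonneg; intros i _; apply Rmult_le_pos;
    [apply pow2_ge_0|left; apply exp_pos]. }
apply Rmult_le_reg_r with (exp (- (4 * PI * INR (S n) * y))); [apply exp_pos|].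
rewrite (Rmult_assoc (B ^ 2)), <- exp_plus, Rplus_opp_r, exp_0, Rmult_1_r.
simpl in *; lra.
Qed.

Lemma qexp_zero (c : nat -> C) (g : C -> C) :
  qexp c g -> (forall z, in_H z -> g z = 0%C) -> forall n, c (S n) = 0%C.
Proof.
intros Hg H0 n; apply Cmod_eq_0.
assert (H : Cmod (c (S n)) ^ 2 <= 0 ^ 2 * exp (4 * PI * INR (S n) * 1)).
{ apply (qexp_coeff_le c g); [exact Hg|lra|].
  intros x; rewrite H0 by (unfold in_H; simpl; lra); rewrite Cmod_0; lra. }
pose proof (Cmod_ge_0 (c (S n))); nra.
Qed.

Lemma qexp_unique (c d : nat -> C) (g : C -> C) :
  qexp c g -> qexp d g -> forall n, c (S n) = d (S n).
Proof.
intros Hc Hd n.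
assert (H : qexp (fun m => c m + - (1) * d m)%C (fun z => g z + - (1) * g z)%C).
{ intros z Hz; apply (Clim_ext (fun N => psum c z N + - (1) * psum d z N)%C).
  - intros N; unfold psum; rewrite <- csum_scal, <- csum_plus.
    apply csum_ext; intros i _; ring.
  - apply Clim_plus; [|apply Clim_scal]; auto. }
pose proof (qexp_zero _ _ H ltac:(intros; cbv beta; ring) n) as E; simpl in E.
replace (c (S n)) with (c (S n) + - (1) * d (S n) + d (S n))%C by ring.
rewrite E; ring.
Qed.

(** For w < 0 the growth bound y^(-w/2) tends to 0 with y, and so does the resulting bound on each
    fixed coefficient. *)
Lemma modular_weight_neg_zero (c : nat -> C) (g : C -> C) (w : Z) :
  qexp c g -> S_modular w g -> (w < 0)%Z -> forall n, c (S n) = 0%C.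
Proof.
intros Hg Hm Hw n; apply Cmod_eq_0.
destruct (modular_growth c g w Hg Hm) as [K [HK0 HK]].
set (E := exp (4 * PI * INR (S n))).
assert (HE : 0 < E) by apply exp_pos.
assert (H : forall y, 0 < y <= 1 -> Cmod (c (S n)) ^ 2 <= K ^ 2 * E * y).
{ intros y Hy.
  assert (H1 : Cmod (c (S n)) ^ 2 <=
    (K * Rpower y (- (IZR w / 2))) ^ 2 * exp (4 * PI * INR (S n) * y)).
  { apply (qexp_coeff_le c g); [exact Hg|lra|].
    intros x; apply (HK (x, y)); unfold in_H; simpl; lra. }
  eapply Rle_trans; [exact H1|].
  rewrite Rpow_mult_distr, !Rmult_assoc.
  apply Rmult_le_compat_l; [apply pow2_ge_0|].
  rewrite Rmult_comm; apply Rmult_le_compat.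
  - left; apply exp_pos.
  - apply pow2_ge_0.
  - apply exp_le.
    assert (0 < PI * INR (S n))
      by (apply Rmult_lt_0_compat; [apply PI_RGT_0|apply lt_0_INR; lia]).
    nra.
  - rewrite <- Rpower_pow by apply exp_pos; rewrite Rpower_mult.
    rewrite <- (Rpower_1 y) at 2 by lra.
    unfold Rpower; apply exp_le.
    assert (ln y <= 0) by (rewrite <- ln_1; apply ln_le; lra).
    assert (IZR w <= -1) by (apply IZR_le; lia).
    simpl (INR 2); nra. }
pose proof (Cmod_ge_0 (c (S n))) as Hc.
apply Rle_antisym; [|exact Hc]; apply Rnot_lt_le; intros Hlt.
assert (Hk : 0 <= K ^ 2 * E) by (apply Rmult_le_pos; [apply pow2_ge_0|lra]).
set (a := Cmod (c (S n)) ^ 2) in *.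
assert (Ha : 0 < a) by (apply pow_lt, Hlt).
set (B := K ^ 2 * E) in *.
(* At y = a/(B + a) one has B y = a - a y < a, contradicting a <= B y. *)
assert (Hy : 0 < a / (B + a)) by (apply Rdiv_lt_0_compat; lra).
assert (Ey : a / (B + a) * (B + a) = a) by (field; lra).
specialize (H (a / (B + a)) ltac:(split; [exact Hy|]; apply Rle_div_l; lra)).
nra.
Qed.

(* A bound for |g| bounds the coefficients, hence |g| on [Im z >= 1/2], hence
   |g| everywhere; each round gains a factor 3/5. *)
Lemma modular_weight_0_zero (c : nat -> C) (g : C -> C) :
  qexp c g -> S_modular 0 g -> forall n, c (S n) = 0%C.
Proof.
intros Hg Hm.
assert (Hstep : forall K, 0 <= K -> (forall z, in_H z -> Cmod (g z) <= K) ->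
   forall z, in_H z -> Cmod (g z) <= K * (3 / 5)).
{ intros K HK0 HK.
  (* At y = 1/(4 pi n) the squared coefficient is at most e K^2 <= 3 K^2 <= (7/4 K)^2. On Im z >=
     1/2 one has |q| <= exp(-pi) <= 1/4, so the geometric sum is at most 1/3, and 7/12 <= 3/5. *)
  assert (Hc : forall n, Cmod (c (S n)) <= 7 / 4 * K).
  { intros n; set (P := 4 * PI * INR (S n)).
    assert (HP : 0 < P).
    { apply Rmult_lt_0_compat; [pose proof PI_RGT_0; lra|apply lt_0_INR; lia]. }
    pose proof (qexp_coeff_le c g (/ P) K n Hg (Rinv_0_lt_compat _ HP)
      ltac:(intros x; apply HK; unfold in_H; simpl; apply Rinv_0_lt_compat, HP)) as H.
    fold P in H; rewrite Rinv_r in H by lra.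
    pose proof exp_le_3; pose proof (Cmod_ge_0 (c (S n))); pose proof (exp_pos 1); nra. }
  apply upper_half_plane_reduction.
  - intros z Hz.
    apply (Clim_Cmod_le (psum c z)); [apply Hg; unfold in_H; lra|].
    intros N; set (r := exp (- PI)).
    assert (Hr : 0 < r <= / 4).
    { split; [apply exp_pos|]; unfold r; rewrite exp_Ropp.
      pose proof (exp_ineq1_le PI); pose proof PI2_3_2.
      apply Rinv_le_contravar; unfold PI2 in *; lra. }
    eapply Rle_trans; [apply (Cmod_csum_le _ (fun i => 7 / 4 * K * r ^ S i))|].
    + intros i _; rewrite Cmod_mult, Cmod_q_pow.
      apply Rmult_le_compat; try apply Cmod_ge_0; [left; apply exp_pos|apply Hc|].
      unfold r; rewrite exp_INR; apply exp_le.
      assert (0 < PI * INR (S i))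
        by (apply Rmult_lt_0_compat; [apply PI_RGT_0|apply lt_0_INR; lia]).
      nra.
    + rewrite (rsum_scal (7 / 4 * K) (fun i => r ^ S i)).
      assert (rsum (fun i => r ^ S i) N <= / 3); [|nra].
      eapply Rle_trans; [apply rsum_geom_le; lra|].
      apply Rle_div_l; lra.
  - intros z m Hz; rewrite (qexp_periodic c g z m Hg Hz); auto.
  - intros z Hz; rewrite (Hm z Hz); simpl; rewrite Cmult_1_l; auto. }
destruct (modular_growth c g 0 Hg Hm) as [K [HK0 HK]].
assert (HKn : forall n z, in_H z -> Cmod (g z) <= K * (3 / 5) ^ n).
{ induction n as [|n IH].
  - intros z Hz; specialize (HK z Hz).
    replace (- (0 / 2)) with 0 in HK by field.
    rewrite Rpower_O in HK by exact Hz; simpl; lra.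
  - intros z Hz; simpl.
    replace (K * (3 / 5 * (3 / 5) ^ n)) with (K * (3 / 5) ^ n * (3 / 5)) by field.
    apply Hstep; [|exact IH|exact Hz].
    apply Rmult_le_pos; [exact HK0|apply pow_le; lra]. }
apply (qexp_zero c g Hg); intros z Hz; apply Cmod_eq_0.
apply Rle_antisym; [|apply Cmod_ge_0]; apply Rnot_lt_le; intros Hlt.
destruct (pow_small (3 / 5) (Cmod (g z)) K) as [N HN]; [lra|exact Hlt|].
specialize (HN N (le_n N)); specialize (HKn N z Hz); lra.
Qed.

Lemma modular_weight_nonpos_zero (c : nat -> C) (g : C -> C) (w : Z) :
  qexp c g -> S_modular w g -> (w <= 0)%Z -> forall n, c (S n) = 0%C.
Proof.
intros Hg Hm Hw; destruct (Z.eq_dec w 0) as [->|Hw0].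
- exact (modular_weight_0_zero c g Hg Hm).
- exact (modular_weight_neg_zero c g w Hg Hm ltac:(lia)).
Qed.

(** * Complex derivatives and Bol's identity *)

(* Differentiability with a quadratic error term, which makes the product and
   chain rules free of any limit argument. *)
Definition Cder (g : C -> C) (z l : C) : Prop :=
  exists K d, 0 <= K /\ 0 < d /\ forall h, Cmod h < d ->
    Cmod (g (z + h)%C - g z - h * l) <= K * Cmod h ^ 2.

Lemma in_H_near (z h : C) : Cmod h < Im z -> in_H (z + h)%C.
Proof.
intros Hh; pose proof (Rmax_Cmod h) as H1.
pose proof (Rmax_r (Rabs (fst h)) (Rabs (snd h))) as H2.
pose proof (Rle_abs (- snd h)) as H3; rewrite Rabs_Ropp in H3.
unfold in_H; destruct z, h; simpl in *; lra.
Qed.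

Lemma Cder_ext (g1 g2 : C -> C) (z l : C) :
  in_H z -> (forall x, in_H x -> g1 x = g2 x) -> Cder g1 z l -> Cder g2 z l.
Proof.
intros Hz E [K [d [HK [Hd H]]]].
exists K, (Rmin d (Im z)); split; [exact HK|]; split; [apply Rmin_glb_lt; assumption|].
intros h Hh; apply Rmin_Rgt in Hh; destruct Hh as [Hh1 Hh2].
rewrite <- !E; [apply H, Hh1|exact Hz|apply in_H_near, Hh2].
Qed.

Lemma Cder_const (a z : C) : Cder (fun _ => a) z 0.
Proof.
exists 0, 1; split; [lra|split; [lra|]]; intros h _.
replace (a - a - h * 0)%C with (RtoC 0) by ring; rewrite Cmod_0; lra.
Qed.

Lemma Cder_id (z : C) : Cder (fun x => x) z 1.
Proof.
exists 0, 1; split; [lra|split; [lra|]]; intros h _.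
replace (z + h - z - h * 1)%C with (RtoC 0) by ring; rewrite Cmod_0; lra.
Qed.

Lemma Cder_plus (g1 g2 : C -> C) (z l1 l2 : C) :
  Cder g1 z l1 -> Cder g2 z l2 -> Cder (fun x => g1 x + g2 x)%C z (l1 + l2).
Proof.
intros [K1 [d1 [HK1 [Hd1 H1]]]] [K2 [d2 [HK2 [Hd2 H2]]]].
exists (K1 + K2), (Rmin d1 d2); split; [lra|split; [apply Rmin_glb_lt; assumption|]].
intros h Hh; apply Rmin_Rgt in Hh; destruct Hh as [Hh1 Hh2].
specialize (H1 h Hh1); specialize (H2 h Hh2).
replace (g1 (z + h)%C + g2 (z + h)%C - (g1 z + g2 z) - h * (l1 + l2))%C with
  ((g1 (z + h)%C - g1 z - h * l1) + (g2 (z + h)%C - g2 z - h * l2))%C by ring.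
eapply Rle_trans; [apply Cmod_triangle|]; lra.
Qed.

Lemma Cder_Lipschitz (g : C -> C) (z l : C) :
  Cder g z l -> exists K d, 0 <= K /\ 0 < d <= 1 /\
    forall h, Cmod h < d -> Cmod (g (z + h)%C - g z) <= K * Cmod h.
Proof.
intros [K [d [HK [Hd H]]]].
exists (K + Cmod l), (Rmin d 1).
pose proof (Cmod_ge_0 l) as Hl.
split; [lra|split; [split; [apply Rmin_glb_lt; lra|apply Rmin_r]|]].
intros h Hh; specialize (H h (Rlt_le_trans _ _ _ Hh (Rmin_l _ _))).
pose proof (Rlt_le_trans _ _ _ Hh (Rmin_r _ _)) as Hh1.
pose proof (Cmod_ge_0 h) as Hh0.
replace (g (z + h)%C - g z)%C with ((g (z + h)%C - g z - h * l) + h * l)%C by ring.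
assert (K * Cmod h ^ 2 <= K * Cmod h) by (apply Rmult_le_compat_l; nra).
eapply Rle_trans; [apply Cmod_triangle|]; rewrite Cmod_mult.
set (t := Cmod (g (z + h)%C - g z - h * l)) in *; nra.
Qed.

Lemma Cder_mult (g1 g2 : C -> C) (z l1 l2 : C) :
  Cder g1 z l1 -> Cder g2 z l2 ->
  Cder (fun x => g1 x * g2 x)%C z (l1 * g2 z + g1 z * l2).
Proof.
intros D1 D2.
destruct (Cder_Lipschitz _ _ _ D1) as [L1 [e1 [HL1 [He1 H1']]]].
destruct (Cder_Lipschitz _ _ _ D2) as [L2 [e2 [HL2 [He2 H2']]]].
destruct D1 as [K1 [d1 [HK1 [Hd1 H1]]]], D2 as [K2 [d2 [HK2 [Hd2 H2]]]].
pose proof (Cmod_ge_0 (g1 z)) as G1; pose proof (Cmod_ge_0 (g2 z)) as G2.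
exists (K1 * Cmod (g2 z) + Cmod (g1 z) * K2 + L1 * L2),
  (Rmin (Rmin d1 d2) (Rmin e1 e2)).
split; [nra|split; [repeat apply Rmin_glb_lt; lra|]].
intros h Hh.
apply Rmin_Rgt in Hh; rewrite !Rmin_Rgt in Hh; destruct Hh as [[A1 A2] [A3 A4]].
specialize (H1 h A1); specialize (H2 h A2).
specialize (H1' h A3); specialize (H2' h A4).
replace (g1 (z + h)%C * g2 (z + h)%C - g1 z * g2 z - h * (l1 * g2 z + g1 z * l2))%C with
  ((g1 (z + h)%C - g1 z - h * l1) * g2 z + g1 z * (g2 (z + h)%C - g2 z - h * l2)
   + (g1 (z + h)%C - g1 z) * (g2 (z + h)%C - g2 z))%C by ring.
eapply Rle_trans; [apply Cmod_triangle|].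
eapply Rle_trans; [apply Rplus_le_compat_r, Cmod_triangle|].
rewrite !Cmod_mult.
pose proof (Cmod_ge_0 h) as Hh0.
set (r1 := Cmod (g1 (z + h)%C - g1 z - h * l1)) in *.
set (r2 := Cmod (g2 (z + h)%C - g2 z - h * l2)) in *.
assert (Cmod (g1 (z + h)%C - g1 z) * Cmod (g2 (z + h)%C - g2 z) <= L1 * Cmod h * (L2 * Cmod h))
  by (apply Rmult_le_compat; try apply Cmod_ge_0; assumption).
nra.
Qed.

Lemma Cder_scal (a : C) (g : C -> C) (z l : C) :
  Cder g z l -> Cder (fun x => a * g x)%C z (a * l).
Proof.
intros H; pose proof (Cder_mult _ _ _ _ _ (Cder_const a z) H) as H'.
replace (a * l)%C with (0 * g z + a * l)%C by ring; exact H'.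
Qed.

Lemma Cder_comp (g f : C -> C) (z l m : C) :
  Cder f z m -> Cder g (f z) l -> Cder (fun x => g (f x)) z (l * m).
Proof.
intros Df Dg.
destruct (Cder_Lipschitz _ _ _ Df) as [L [e [HL [He H']]]].
destruct Df as [K1 [d1 [HK1 [Hd1 H1]]]], Dg as [K2 [d2 [HK2 [Hd2 H2]]]].
pose proof (Cmod_ge_0 l) as Gl.
exists (K2 * L ^ 2 + K1 * Cmod l), (Rmin (Rmin d1 e) (d2 / (L + 1))).
split; [nra|split].
{ repeat apply Rmin_glb_lt; try lra; apply Rdiv_lt_0_compat; lra. }
intros h Hh; apply Rmin_Rgt in Hh; rewrite !Rmin_Rgt in Hh; destruct Hh as [[A1 A2] A3].
specialize (H1 h A1); specialize (H' h A2).
pose proof (Cmod_ge_0 h) as Hh0.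
set (k := (f (z + h)%C - f z)%C) in *.
assert (Hk : Cmod k < d2).
{ apply Rlt_div_r in A3; [nra|lra]. }
specialize (H2 k Hk).
replace (f (z + h)%C) with (f z + k)%C by (unfold k; ring).
replace (g (f z + k)%C - g (f z) - h * (l * m))%C with
  ((g (f z + k)%C - g (f z) - k * l) + (k - h * m) * l)%C by ring.
eapply Rle_trans; [apply Cmod_triangle|]; rewrite Cmod_mult.
pose proof (Cmod_ge_0 k) as Hk0.
assert (Cmod k ^ 2 <= (L * Cmod h) ^ 2) by (apply pow_incr; lra).
replace (f z + k - f z)%C with k by ring.
rewrite Rpow_mult_distr in *.
assert (Cmod (k - h * m) * Cmod l <= K1 * Cmod h ^ 2 * Cmod l)
  by (apply Rmult_le_compat_r; assumption).
nra.
Qed.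

Lemma Cder_inv (z : C) : z <> 0%C -> Cder (fun x => / x)%C z (- / (z * z)).
Proof.
intros Hz; assert (Hm : 0 < Cmod z) by (apply Cmod_gt_0, Hz).
exists (2 / Cmod z ^ 3), (Cmod z / 2).
split; [apply Rmult_le_pos; [lra|left; apply Rinv_0_lt_compat, pow_lt, Hm]|].
split; [lra|]; intros h Hh.
assert (Hzh : Cmod z / 2 < Cmod (z + h)%C).
{ assert (Cmod z <= Cmod (z + h)%C + Cmod h).
  { replace z with ((z + h)%C - h)%C at 1 by ring; apply Cmod_triangle_minus. }
  lra. }
assert (Hzh0 : (z + h)%C <> 0%C) by (apply Cmod_gt_0; lra).
replace (/ (z + h)%C - / z - h * - / (z * z))%C with (h * h / (z * z * (z + h)%C))%C
  by (field; split; assumption).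
rewrite Cmod_div by (repeat apply Cmult_neq_0; assumption).
rewrite !Cmod_mult.
unfold Rdiv; rewrite (Rmult_comm (2 * _)).
replace (Cmod h ^ 2) with (Cmod h * Cmod h) by ring.
apply Rmult_le_compat_l; [apply Rmult_le_pos; apply Cmod_ge_0|].
replace (2 * / Cmod z ^ 3) with (/ (Cmod z * Cmod z * (Cmod z / 2))) by (field; lra).
apply Rinv_le_contravar.
- repeat apply Rmult_lt_0_compat; lra.
- apply Rmult_le_compat_l; [nra|lra].
Qed.

Lemma Cder_pow (z : C) (n : nat) :
  Cder (fun x => x ^ S n)%C z (INR (S n) * z ^ n).
Proof.
induction n as [|n IH].
- replace (INR 1 * z ^ 0)%C with (1 * 1 + z * 0)%C by (simpl; ring).
  apply (Cder_mult (fun x => x) (fun _ => RtoC 1)); [apply Cder_id|apply Cder_const].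
- replace (INR (S (S n)) * z ^ S n)%C with (1 * z ^ S n + z * (INR (S n) * z ^ n))%C.
  + apply (Cder_mult (fun x => x) (fun x => x ^ S n)%C); [apply Cder_id|exact IH].
  + rewrite (S_INR (S n)), RtoC_plus, !Cpow_S; ring.
Qed.

(** * Second-order bounds for the complex exponential *)

Lemma exp_minus_1_bound (a : R) : Rabs (exp a - 1) <= Rabs a * exp (Rabs a).
Proof.
pose proof (exp_ineq1_le a) as H1; pose proof (exp_ineq1_le (- a)) as H2.
pose proof (exp_pos a) as H3.
assert (E : exp a * exp (- a) = 1) by (rewrite <- exp_plus, Rplus_opp_r; apply exp_0).
destruct (Rle_lt_dec 0 a) as [Ha|Ha].
- rewrite !Rabs_pos_eq by lra; nra.
- rewrite (Rabs_left a), Rabs_left1 by (try lra; nra).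
  pose proof (exp_ineq1_le (- a)); nra.
Qed.

Lemma exp_taylor_bound (a : R) : Rabs (exp a - 1 - a) <= a ^ 2 * exp (Rabs a).
Proof.
pose proof (exp_ineq1_le a) as H1; pose proof (exp_ineq1_le (- a)) as H2.
pose proof (exp_pos a) as H3.
assert (E : exp a * exp (- a) = 1) by (rewrite <- exp_plus, Rplus_opp_r; apply exp_0).
pose proof (exp_minus_1_bound a) as H4.
rewrite (Rabs_pos_eq (exp a - 1 - a)) by lra.
assert (H5 : exp a - 1 - a <= a * (exp a - 1)) by nra.
assert (H6 : a * (exp a - 1) <= Rabs a * Rabs (exp a - 1))
  by (rewrite <- Rabs_mult; apply Rle_abs).
pose proof (Rabs_pos a) as H7; pose proof (exp_pos (Rabs a)) as H8.
replace (a ^ 2) with (Rabs a * Rabs a)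
  by (rewrite <- Rabs_mult, Rabs_pos_eq by nra; ring).
nra.
Qed.

Lemma Rabs_sin_le (x : R) : Rabs (sin x) <= Rabs x.
Proof.
assert (H : forall t, 0 <= t -> Rabs (sin t) <= t).
{ intros t Ht; destruct (Req_dec t 0) as [E|E]; [subst; rewrite sin_0, Rabs_R0; lra|].
  assert (Hlt : sin t < t) by (apply sin_lt_x; lra).
  apply Rabs_le; split; [|lra].
  destruct (Rle_lt_dec t 1) as [H1|H1].
  - pose proof PI2_3_2; unfold PI2 in *.
    assert (0 <= sin t) by (apply sin_ge_0; lra). lra.
  - pose proof (SIN_bound t); lra. }
destruct (Rle_lt_dec 0 x) as [Hx|Hx].
- rewrite (Rabs_pos_eq x) by lra; auto.
- rewrite (Rabs_left x), <- Rabs_Ropp, <- sin_neg by lra; apply H; lra.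
Qed.

Lemma one_minus_cos_bound (x : R) : 0 <= 1 - cos x <= x ^ 2 / 2 /\ 1 - cos x <= Rabs x.
Proof.
assert (E : 1 - cos x = 2 * (Rabs (sin (x / 2)) * Rabs (sin (x / 2)))).
{ rewrite <- Rabs_mult, Rabs_pos_eq by nra.
  replace x with (2 * (x / 2)) at 1 by field; rewrite cos_2a_sin; ring. }
pose proof (Rabs_sin_le (x / 2)) as H1; pose proof (Rabs_pos (sin (x / 2))) as H0.
assert (H2 : Rabs (sin (x / 2)) <= 1) by (apply Rabs_le, SIN_bound).
assert (H3 : Rabs (x / 2) = Rabs x / 2)
  by (unfold Rdiv; rewrite Rabs_mult, (Rabs_pos_eq (/ 2)); lra).
assert (H4 : Rabs x * Rabs x = x ^ 2) by (rewrite <- Rabs_mult, Rabs_pos_eq by nra; ring).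
rewrite H3 in H1; rewrite E; repeat split; nra.
Qed.

Lemma sin_taylor_bound (b : R) : Rabs (sin b - b) <= b ^ 2.
Proof.
destruct (MVT_gen (fun x => sin x - x) 0 b (fun x => cos x - 1)) as [x [Hx E]].
- intros x _; auto_derive; [trivial|ring].
- intros x _; apply continuity_pt_minus; [apply continuity_sin|apply derivable_continuous_pt, derivable_pt_id].
- rewrite sin_0 in E; replace (sin b - b) with ((cos x - 1) * (b - 0)) by lra.
  rewrite Rminus_0_r, Rabs_mult, Rabs_minus_sym.
  destruct (one_minus_cos_bound x) as [[H1 _] H2].
  rewrite (Rabs_pos_eq (1 - cos x)) by exact H1.
  assert (Hxb : Rabs x <= Rabs b).
  { unfold Rmin, Rmax in Hx; destruct (Rle_dec 0 b);
      [rewrite !Rabs_pos_eq by lra|rewrite !Rabs_left1 by lra]; lra. }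
  pose proof (Rabs_pos b).
  replace (b ^ 2) with (Rabs b * Rabs b) by (rewrite <- Rabs_mult, Rabs_pos_eq by nra; ring).
  nra.
Qed.

Lemma Cmod_le_Rabs (w : C) : Cmod w <= Rabs (Re w) + Rabs (Im w).
Proof.
destruct w as [x y]; unfold Cmod; simpl.
pose proof (Rabs_pos x); pose proof (Rabs_pos y).
rewrite <- (sqrt_square (Rabs x + Rabs y)) by lra.
apply sqrt_le_1_alt.
pose proof (Rsqr_abs x) as E1; pose proof (Rsqr_abs y) as E2; unfold Rsqr in *; nra.
Qed.

Lemma Cexp_taylor_bound (w : C) :
  Cmod (Cexp w - 1 - w) <= 2 * Cmod w ^ 2 * exp (Cmod w).
Proof.
assert (Hre : exp (Rabs (Re w)) <= exp (Cmod w)) by apply exp_le, re_le_Cmod.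
rewrite Cmod_sqr.
eapply Rle_trans; [apply Cmod_le_Rabs|].
destruct w as [a b]; simpl Re in *; simpl Im in *.
set (M := exp (Cmod (a, b))) in *.
assert (HM : 1 <= M).
{ unfold M; rewrite <- exp_0; apply exp_le, Cmod_ge_0. }
assert (H1 : Rabs (Re (Cexp (a, b) - 1 - (a, b))%C) <= M * (a ^ 2 + b ^ 2 / 2)).
{ simpl; replace (_ + - a) with ((exp a - 1 - a) + - (exp a * (1 - cos b))) by ring.
  eapply Rle_trans; [apply Rabs_triang|]; rewrite Rabs_Ropp, Rabs_mult.
  pose proof (exp_taylor_bound a) as H1.
  destruct (one_minus_cos_bound b) as [[H2 H3] _].
  rewrite (Rabs_pos_eq (1 - cos b)), (Rabs_pos_eq (exp a)) by (try lra; left; apply exp_pos).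
  assert (H4 : exp a <= M) by (eapply Rle_trans; [apply exp_le, Rle_abs|exact Hre]).
  pose proof (exp_pos a); pose proof (pow2_ge_0 a); nra. }
assert (H2 : Rabs (Im (Cexp (a, b) - 1 - (a, b))%C) <= M * (Rabs a * Rabs b + b ^ 2)).
{ simpl; replace (_ + - b) with ((exp a - 1) * sin b + (sin b - b)) by ring.
  eapply Rle_trans; [apply Rabs_triang|]; rewrite Rabs_mult.
  pose proof (exp_minus_1_bound a) as H2; pose proof (Rabs_sin_le b) as H3.
  pose proof (sin_taylor_bound b) as H4.
  assert (H5 : Rabs (exp a - 1) * Rabs (sin b) <= Rabs a * exp (Rabs a) * Rabs b)
    by (apply Rmult_le_compat; try apply Rabs_pos; assumption).
  assert (H6 : 0 <= Rabs a * Rabs b) by (apply Rmult_le_pos; apply Rabs_pos).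
  pose proof (pow2_ge_0 b); nra. }
assert (H3 : Rabs a * Rabs b <= a ^ 2 / 2 + b ^ 2 / 2).
{ pose proof (pow2_ge_0 (Rabs a - Rabs b)) as H3.
  pose proof (Rsqr_abs a) as E1; pose proof (Rsqr_abs b) as E2; unfold Rsqr in *; nra. }
pose proof (pow2_ge_0 a); pose proof (pow2_ge_0 b).
assert (H4 : M * (a ^ 2 + b ^ 2 / 2 + (Rabs a * Rabs b + b ^ 2)) <= M * (2 * (a ^ 2 + b ^ 2)))
  by (apply Rmult_le_compat_l; lra).
rewrite Rmult_plus_distr_l in H4; rewrite (Rmult_comm (2 * _)).
eapply Rle_trans; [apply Rplus_le_compat; [exact H1|exact H2]|exact H4].
Qed.

(** * Termwise differentiation in z *)

Definition dcoef (c : nat -> C) (n : nat) : C := (2 * PI * Ci * INR n * c n)%C.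

Lemma INR_le_exp (x : R) (n : nat) : 0 < x -> INR n <= / x * exp (INR n * x).
Proof.
intros Hx; pose proof (exp_ineq1_le (INR n * x)).
apply Rmult_le_reg_l with x; [exact Hx|].
rewrite <- Rmult_assoc, Rinv_r by lra; lra.
Qed.

Lemma tame_dcoef (c : nat -> C) : tame c -> tame (dcoef c).
Proof.
intros H y Hy; destruct (H (y / 2)) as [B [HB0 HB]]; [lra|].
pose proof PI_RGT_0.
assert (Hx : 0 < PI * y) by (apply Rmult_lt_0_compat; lra).
exists (2 * PI * / (PI * y) * B); split.
{ apply Rmult_le_pos; [|exact HB0].
  apply Rmult_le_pos; [lra|left; apply Rinv_0_lt_compat, Hx]. }
intros n; unfold dcoef; rewrite !Cmod_mult, Cmod_Ci, !Cmod_R.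
rewrite (Rabs_pos_eq 2), (Rabs_pos_eq PI), (Rabs_pos_eq (INR (S n))) by (try lra; apply pos_INR).
pose proof (INR_le_exp (PI * y) (S n) Hx) as H1.
specialize (HB n).
assert (E : exp (2 * PI * INR (S n) * y) =
  exp (INR (S n) * (PI * y)) * exp (2 * PI * INR (S n) * (y / 2)))
  by (rewrite <- exp_plus; f_equal; field).
rewrite E, Rmult_1_r.
replace (2 * PI * / (PI * y) * B * (exp (INR (S n) * (PI * y)) * exp (2 * PI * INR (S n) * (y / 2))))
  with (2 * PI * (/ (PI * y) * exp (INR (S n) * (PI * y))) * (B * exp (2 * PI * INR (S n) * (y / 2)))) by ring.
apply Rmult_le_compat.
- apply Rmult_le_pos; [lra|apply pos_INR].
- apply Cmod_ge_0.
- apply Rmult_le_compat_l; [lra|exact H1].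
- exact HB.
Qed.

(** Each term contributes c(n) q^n (exp w - 1 - w) with w = 2 pi i n h, which is O(|h|^2) with a
    constant summable over n. *)
Lemma qsum_Cder (c : nat -> C) (z : C) :
  tame c -> in_H z -> Cder (qsum c) z (qsum (dcoef c) z).
Proof.
intros Hc Hz; set (y := Im z); unfold in_H in Hz; fold y in Hz.
pose proof PI_RGT_0 as HPI.
(* Exponents in units of pi n y: the coefficient costs 1/4, the factor n^2 costs 1/4 (through [x]),
   exp |w| with |h| < y/4 costs 1/2. Added to the -2 of q^n they give -1, the rate of [r]. *)
destruct (Hc (y / 8)) as [B [HB0 HB]]; [lra|].
set (x := PI * y / 8).
assert (Hx : 0 < x) by (unfold x; nra).
set (r := exp (- (PI * y))).
assert (Hr : 0 < r < 1) by (apply exp_neg_lt_1; nra).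
set (K := B * (8 * PI ^ 2 * / (x * x))).
assert (HK : 0 <= K).
{ apply Rmult_le_pos; [exact HB0|].
  apply Rmult_le_pos; [nra|left; apply Rinv_0_lt_compat; nra]. }
exists (K * (r / (1 - r))), (y / 4).
split; [apply Rmult_le_pos; [exact HK|left; apply Rdiv_lt_0_compat; lra]|].
split; [lra|]; intros h Hh.
assert (Hzh : in_H (z + h)%C) by (apply in_H_near; fold y; lra).
pose proof (Cmod_ge_0 h) as Hh0.
assert (HL : Clim (fun N => psum c (z + h)%C N + - (1) * psum c z N +
    (- h) * psum (dcoef c) z N)%C
  (qsum c (z + h)%C + - (1) * qsum c z + (- h) * qsum (dcoef c) z)%C).
{ apply Clim_plus; [apply Clim_plus; [|apply Clim_scal]|apply Clim_scal];
    apply qexp_qsum; try assumption; apply tame_dcoef, Hc. }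
replace (qsum c (z + h)%C - qsum c z - h * qsum (dcoef c) z)%C with
  (qsum c (z + h)%C + - (1) * qsum c z + (- h) * qsum (dcoef c) z)%C by ring.
apply (Clim_Cmod_le _ _ _ HL); intros N; unfold psum.
rewrite <- !csum_scal, <- !csum_plus.
eapply Rle_trans; [apply (Cmod_csum_le _ (fun i => K * Cmod h ^ 2 * r ^ S i))|].
- intros i _; set (n := S i).
  assert (Hn : 0 < INR n) by (apply lt_0_INR; unfold n; lia).
  set (w := (INR n * (2 * PI * Ci * h))%C).
  replace (c n * q (z + h)%C ^ n + - (1) * (c n * q z ^ n) + - h * (dcoef c n * q z ^ n))%C
    with (c n * q z ^ n * (Cexp w - 1 - w))%C
    by (rewrite q_pow_plus; fold w; unfold dcoef, w; ring).
  rewrite !Cmod_mult, Cmod_q_pow; fold y.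
  assert (Hw : Cmod w = 2 * PI * INR n * Cmod h).
  { unfold w; rewrite !Cmod_mult, Cmod_Ci, !Cmod_R, !Rabs_pos_eq by lra; ring. }
  pose proof (Cexp_taylor_bound w) as HT; rewrite Hw in HT.
  assert (HT2 : Cmod (Cexp w - 1 - w) <=
    8 * PI ^ 2 * Cmod h ^ 2 * (/ (x * x) * exp (INR n * (2 * x))) * exp (2 * PI * INR n * (y / 4))).
  { eapply Rle_trans; [exact HT|].
    apply Rmult_le_compat.
    - rewrite Rpow_mult_distr; apply Rmult_le_pos; [lra|apply Rmult_le_pos; apply pow2_ge_0].
    - left; apply exp_pos.
    - replace (2 * (2 * PI * INR n * Cmod h) ^ 2) with
        (8 * PI ^ 2 * Cmod h ^ 2 * (INR n * INR n)) by ring.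
      apply Rmult_le_compat_l.
      + pose proof (pow2_ge_0 PI); pose proof (pow2_ge_0 (Cmod h)); nra.
      + pose proof (INR_le_exp x n Hx) as H1.
        replace (/ (x * x) * exp (INR n * (2 * x))) with
          ((/ x * exp (INR n * x)) * (/ x * exp (INR n * x))).
        * apply Rmult_le_compat; lra.
        * replace (INR n * (2 * x)) with (INR n * x + INR n * x) by ring.
          rewrite exp_plus; field; lra.
    - apply exp_le; apply Rmult_le_compat_l; [nra|lra]. }
  assert (Hcn : Cmod (c n) <= B * exp (2 * PI * INR n * (y / 8))) by apply HB.
  eapply Rle_trans.
  + apply Rmult_le_compat; [|apply Cmod_ge_0| |exact HT2].
    * apply Rmult_le_pos; [apply Cmod_ge_0|left; apply exp_pos].
    * apply Rmult_le_compat_r; [left; apply exp_pos|exact Hcn].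
  + unfold r; rewrite exp_INR.
    replace (B * exp (2 * PI * INR n * (y / 8)) * exp (- (2 * PI * INR n * y)) *
      (8 * PI ^ 2 * Cmod h ^ 2 * (/ (x * x) * exp (INR n * (2 * x))) * exp (2 * PI * INR n * (y / 4))))
      with (K * Cmod h ^ 2 * (exp (2 * PI * INR n * (y / 8)) * exp (- (2 * PI * INR n * y)) *
        exp (INR n * (2 * x)) * exp (2 * PI * INR n * (y / 4)))) by (unfold K; ring).
    apply Rmult_le_compat_l; [apply Rmult_le_pos; [exact HK|apply pow2_ge_0]|].
    rewrite <- !exp_plus; apply exp_le.
    assert (0 < PI * INR n * y) by (apply Rmult_lt_0_compat; [apply Rmult_lt_0_compat|]; assumption).
    unfold x; nra.
- rewrite (rsum_scal (K * Cmod h ^ 2) (fun i => r ^ S i)).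
  pose proof (rsum_geom_le r N Hr) as Hg.
  replace (K * (r / (1 - r)) * Cmod h ^ 2) with (K * Cmod h ^ 2 * (r / (1 - r))) by ring.
  apply Rmult_le_compat_l; [apply Rmult_le_pos; [exact HK|apply pow2_ge_0]|exact Hg].
Qed.

(** Iterated differentiation as a relation: values off the half-plane are arbitrary, so an r-th
    derivative is determined only on it. *)
Inductive nder : nat -> (C -> C) -> (C -> C) -> Prop :=
| nder_0 G G' : (forall z, in_H z -> G z = G' z) -> nder 0 G G'
| nder_S r G G1 G' : (forall z, in_H z -> Cder G z (G1 z)) -> nder r G1 G' ->
    nder (S r) G G'.

Lemma nder_ext_r (r : nat) (G G1 G2 : C -> C) :
  nder r G G1 -> (forall z, in_H z -> G1 z = G2 z) -> nder r G G2.
Proof.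
intros H; revert G2; induction H as [G G' E|r G G1 G' D H IH]; intros G2 E2.
- apply nder_0; intros z Hz; rewrite E, E2; auto.
- apply nder_S with G1; auto.
Qed.

Lemma nder_ext_l (r : nat) (G G1 G2 : C -> C) :
  nder r G G1 -> (forall z, in_H z -> G z = G2 z) -> nder r G2 G1.
Proof.
intros H; destruct H as [G G' E|r G G1 G' D H]; intros E2.
- apply nder_0; intros z Hz; rewrite <- E2; auto.
- apply nder_S with G1; [|exact H].
  intros z Hz; apply Cder_ext with G; auto.
Qed.

Lemma nder_plus (r : nat) (G1 G2 G1' G2' : C -> C) :
  nder r G1 G1' -> nder r G2 G2' ->
  nder r (fun z => G1 z + G2 z)%C (fun z => G1' z + G2' z)%C.
Proof.
intros H1; revert G2 G2'; induction H1 as [G G' E|r G H G' D H1 IH];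
  intros G2 G2' H2; inversion H2 as [? ? E2|? ? H2a ? D2 H2']; subst.
- apply nder_0; intros z Hz; rewrite E, E2; auto.
- apply nder_S with (fun z => H z + H2a z)%C; [|auto].
  intros z Hz; apply Cder_plus; auto.
Qed.

Lemma nder_scal (a : C) (r : nat) (G G' : C -> C) :
  nder r G G' -> nder r (fun z => a * G z)%C (fun z => a * G' z)%C.
Proof.
intros H; induction H as [G G' E|r G G1 G' D H IH].
- apply nder_0; intros z Hz; rewrite E; auto.
- apply nder_S with (fun z => a * G1 z)%C; [|exact IH].
  intros z Hz; apply Cder_scal; auto.
Qed.

(** Leibniz rule for the factor z, of which only the first derivative survives. *)
Lemma nder_mult_id (r : nat) (G Gr G' : C -> C) :
  nder r G Gr -> (forall z, in_H z -> Cder Gr z (G' z)) ->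
  nder (S r) (fun z => z * G z)%C (fun z => z * G' z + INR (S r) * Gr z)%C.
Proof.
intros H; revert G'; induction H as [G Gr E|r G G1 Gr D H IH]; intros G' D'.
- apply nder_S with (fun z => 1 * G z + z * G' z)%C.
  + intros z Hz; apply (Cder_mult (fun x => x)); [apply Cder_id|].
    apply Cder_ext with Gr; [exact Hz|intros; symmetry; auto|auto].
  + apply nder_0; intros z Hz; rewrite E by exact Hz; simpl; ring.
- apply nder_S with (fun z => 1 * G z + z * G1 z)%C.
  + intros z Hz; apply (Cder_mult (fun x => x)); [apply Cder_id|auto].
  + apply nder_ext_r with (fun z => 1 * Gr z + (z * G' z + INR (S r) * Gr z))%C.
    * apply nder_plus; [apply nder_scal|apply IH, D'].
      apply nder_S with G1; assumption.
    * intros z _; rewrite (S_INR (S r)), RtoC_plus; ring.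
Qed.

Lemma Cder_neg_inv (z : C) : z <> 0%C -> Cder (fun x => -1 / x)%C z (/ (z * z)).
Proof.
intros Hz; replace (/ (z * z))%C with (-1 * - / (z * z))%C by ring.
apply (Cder_scal (-1) (fun x => / x)%C), Cder_inv, Hz.
Qed.

Lemma Cder_inv_pow (z : C) (m : nat) :
  z <> 0%C -> Cder (fun x => / x ^ S m)%C z (- (INR (S m)) / z ^ S (S m)).
Proof.
intros Hz.
replace (- (INR (S m)) / z ^ S (S m))%C with
  (- / (z ^ S m * z ^ S m) * (INR (S m) * z ^ m))%C.
- apply (Cder_comp (fun x => / x)%C (fun x => x ^ S m)%C); [apply Cder_pow|].
  apply Cder_inv, Cpow_nz, Hz.
- rewrite !Cpow_S; field; repeat split; try exact Hz; apply Cpow_nz, Hz.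
Qed.

(** The (n+1)-st derivative carries weight -n to weight n+2. In the induction z^(n+1) D(-1/z) is z
    times the case n; by Leibniz an extra term (n+2) z^(-n-2) D^(n+1)(-1/z) appears, and
    differentiating z^(-n-2) cancels it. *)
Lemma bol_identity (D : nat -> C -> C) (n : nat) :
  (forall j z, in_H z -> Cder (D j) z (D (S j) z)) ->
  nder (S n) (fun z => z ^ n * D O (-1 / z))%C (fun z => / z ^ (n + 2) * D (S n) (-1 / z))%C.
Proof.
intros HD.
assert (HS : forall j z, in_H z ->
  Cder (fun x => D j (-1 / x))%C z (D (S j) (-1 / z)%C * / (z * z))%C).
{ intros j z Hz; apply (Cder_comp (D j) (fun x => -1 / x)%C).
  - apply Cder_neg_inv, in_H_neq_0, Hz.
  - apply HD, in_H_neg_inv, Hz. }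
induction n as [|n IH].
- apply nder_S with (fun z => D 1%nat (-1 / z) * / (z * z))%C.
  + intros z Hz; apply Cder_ext with (fun x => D O (-1 / x)%C);
      [exact Hz|intros; simpl; ring|apply HS, Hz].
  + apply nder_0; intros z Hz; simpl; rewrite Cmult_1_r; ring.
- pose (G' := fun z : C => (- (INR (S (S n))) / z ^ S (S (S n)) * D (S n) (-1 / z)
     + / z ^ (n + 2) * (D (S (S n)) (-1 / z) * / (z * z)))%C).
  assert (DG : forall z, in_H z ->
    Cder (fun z => / z ^ (n + 2) * D (S n) (-1 / z))%C z (G' z)).
  { intros z Hz; unfold G'; replace (n + 2)%nat with (S (S n)) by lia.
    apply (Cder_mult (fun z => / z ^ S (S n))%C (fun z => D (S n) (-1 / z)%C)).
    - apply Cder_inv_pow, in_H_neq_0, Hz.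
    - apply HS, Hz. }
  pose proof (nder_mult_id _ _ _ _ IH DG) as H.
  eapply nder_ext_l; [eapply nder_ext_r; [exact H|]|].
  + intros z Hz; pose proof (in_H_neq_0 z Hz) as Hz0; unfold G'; cbv beta.
    replace (n + 2)%nat with (S (S n)) by lia.
    replace (S n + 2)%nat with (S (S (S n))) by lia.
    rewrite !Cpow_S; field; split; [apply Cpow_nz|]; exact Hz0.
  + intros z Hz; cbv beta; rewrite Cpow_S; ring.
Qed.

(** * Vanishing derivatives and polynomials *)

Lemma derive_zero_const (g : R -> R) :
  (forall t, 0 <= t <= 1 -> exists K d, 0 < d /\
     forall h, Rabs h < d -> Rabs (g (t + h) - g t) <= K * h ^ 2) ->
  g 0 = g 1.
Proof.
intros H; apply (eq_is_derive (V := R_NormedModule) g 0 1); [|lra].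
intros t Ht; apply is_derive_Reals; intros e He.
destruct (H t Ht) as [K [d [Hd HK]]].
assert (Hd' : 0 < Rmin d (e / (Rabs K + 1))).
{ pose proof (Rabs_pos K); apply Rmin_glb_lt; [exact Hd|apply Rdiv_lt_0_compat; lra]. }
exists (mkposreal _ Hd'); simpl; intros h Hh Hlt.
pose proof (Rmin_l d (e / (Rabs K + 1))); pose proof (Rmin_r d (e / (Rabs K + 1))).
specialize (HK h ltac:(lra)).
change (@zero R_NormedModule) with 0; rewrite Rminus_0_r.
unfold Rdiv; rewrite Rabs_mult, Rabs_inv.
assert (Hh0 : 0 < Rabs h) by (apply Rabs_pos_lt, Hh).
apply Rmult_lt_reg_r with (Rabs h); [exact Hh0|].
rewrite Rmult_assoc, Rinv_l, Rmult_1_r by lra.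
pose proof (Rabs_pos K); pose proof (Rle_abs K).
assert (E : h ^ 2 = Rabs h * Rabs h) by (rewrite <- Rabs_mult, Rabs_pos_eq by nra; ring).
rewrite E in HK.
assert (H5 : Rabs h * (Rabs K + 1) < e) by (apply Rlt_div_r; lra).
nra.
Qed.

(** The half-plane is convex: along the segment from z0 to z1 the real and imaginary parts are real
    functions with zero derivative. *)
Lemma Cder_zero_const (G : C -> C) (z0 z1 : C) :
  (forall z, in_H z -> Cder G z 0) -> in_H z0 -> in_H z1 -> G z0 = G z1.
Proof.
intros H H0 H1.
pose (p := fun t : R => (z0 + t * (z1 - z0))%C).
assert (Hp : forall t, 0 <= t <= 1 -> exists K d, 0 < d /\
  forall h, Rabs h < d -> Cmod (G (p (t + h)) - G (p t)) <= K * h ^ 2).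
{ intros t Ht.
  assert (Hz : in_H (p t)).
  { unfold p, in_H in *; destruct z0, z1; simpl in *; nra. }
  destruct (H _ Hz) as [K [d [HK [Hd HKd]]]].
  pose proof (Cmod_ge_0 (z1 - z0)) as Hm.
  exists (K * Cmod (z1 - z0) ^ 2), (d / (Cmod (z1 - z0) + 1)); split.
  { apply Rdiv_lt_0_compat; lra. }
  intros h Hh.
  assert (Hd' : Cmod (h * (z1 - z0)) < d).
  { rewrite Cmod_mult, Cmod_R.
    apply Rlt_div_r in Hh; [|lra].
    pose proof (Rabs_pos h); nra. }
  specialize (HKd _ Hd').
  replace (p (t + h)) with (p t + h * (z1 - z0))%C
    by (unfold p; rewrite RtoC_plus; ring).
  replace (G (p t + h * (z1 - z0))%C - G (p t) - h * (z1 - z0) * 0)%C with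
    (G (p t + h * (z1 - z0))%C - G (p t))%C in HKd by ring.
  rewrite Cmod_mult, Cmod_R, Rpow_mult_distr in HKd.
  replace (h ^ 2) with (Rabs h ^ 2) by apply pow2_abs.
  eapply Rle_trans; [exact HKd|right; ring]. }
assert (E : p 0 = z0 /\ p 1 = z1) by (unfold p; split; ring).
destruct E as [E0 E1]; rewrite <- E0, <- E1.
apply injective_projections.
- apply (derive_zero_const (fun t => fst (G (p t)))); intros t Ht.
  destruct (Hp t Ht) as [K [d [Hd HK]]]; exists K, d; split; [exact Hd|].
  intros h Hh; eapply Rle_trans; [|apply HK, Hh].
  eapply Rle_trans; [|apply Rmax_Cmod]; apply Rmax_l.
- apply (derive_zero_const (fun t => snd (G (p t)))); intros t Ht.
  destruct (Hp t Ht) as [K [d [Hd HK]]]; exists K, d; split; [exact Hd|].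
  intros h Hh; eapply Rle_trans; [|apply HK, Hh].
  eapply Rle_trans; [|apply Rmax_Cmod]; apply Rmax_r.
Qed.

Lemma Cder_csum (u u' : nat -> C -> C) (z : C) (n : nat) :
  (forall i, (i < n)%nat -> Cder (u i) z (u' i z)) ->
  Cder (fun x => csum (fun i => u i x) n) z (csum (fun i => u' i z) n).
Proof.
induction n as [|n IH]; intros H; simpl; [apply Cder_const|].
apply Cder_plus; auto.
Qed.

Lemma nder_zero_polynomial (n : nat) (G : C -> C) :
  nder (S n) G (fun _ => 0%C) ->
  exists c, forall z, in_H z -> G z = csum (fun i => c i * z ^ i)%C (S n).
Proof.
revert G; induction n as [|n IH]; intros G H;
  inversion H as [|? ? G1 ? D H1]; subst.
- inversion H1 as [? ? E|]; subst.
  exists (fun _ => G Ci); intros z Hz; simpl.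
  rewrite (Cder_zero_const G z Ci).
  + ring.
  + intros x Hx; rewrite <- (E x Hx); apply D, Hx.
  + exact Hz.
  + unfold in_H; simpl; lra.
- destruct (IH _ H1) as [d Hd].
  (* A primitive of the polynomial that the induction gives for [G1]; G - Q is then constant, equal
     to its value at i. *)
  pose (Q := fun z => csum (fun i => d i / INR (S i) * z ^ S i)%C (S n)).
  assert (DQ : forall z, in_H z -> Cder (fun x => G x + - (1) * Q x)%C z 0).
  { intros z Hz.
    replace (RtoC 0) with (G1 z + - (1) * csum (fun i => d i * z ^ i)%C (S n))%C
      by (rewrite Hd by exact Hz; ring).
    apply Cder_plus; [apply D, Hz|apply Cder_scal].
    apply (Cder_csum (fun i x => d i / INR (S i) * x ^ S i)%C (fun i x => d i * x ^ i)%C).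
    intros i _.
    replace (d i * z ^ i)%C with (d i / INR (S i) * (INR (S i) * z ^ i))%C
      by (field; apply RtoC_inj_neq, not_0_INR; lia).
    apply Cder_scal, Cder_pow. }
  exists (fun i => match i with O => G Ci + - (1) * Q Ci | S j => d j / INR (S j) end)%C.
  intros z Hz; rewrite csum_S_l.
  change (csum _ (S n)) with (Q z).
  pose proof (Cder_zero_const _ z Ci DQ Hz ltac:(unfold in_H; simpl; lra)) as E.
  cbv beta in E; simpl (z ^ 0)%C; rewrite <- E; ring.
Qed.

(** * The Eichler integral and its period polynomial *)

Definition dcoefs (j : nat) (c : nat -> C) : nat -> C := Nat.iter j dcoef c.

Lemma dcoefs_eq (j : nat) (c : nat -> C) (n : nat) :
  dcoefs j c n = ((2 * PI * Ci) ^ j * INR n ^ j * c n)%C.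
Proof.
induction j as [|j IH]; [simpl; ring|].
change (dcoefs (S j) c n) with (dcoef (dcoefs j c) n).
unfold dcoef; rewrite IH, !Cpow_S; ring.
Qed.

Lemma tame_dcoefs (j : nat) (c : nat -> C) : tame c -> tame (dcoefs j c).
Proof. intros H; induction j as [|j IH]; [exact H|apply tame_dcoef, IH]. Qed.

(* The coefficients of the Eichler integral of [sum_n c(n) q^n], weight n+2. *)
Definition ecoef (n : nat) (c : nat -> C) (m : nat) : C := (c m / INR m ^ S n)%C.

Lemma tame_ecoef (n : nat) (c : nat -> C) : tame c -> tame (ecoef n c).
Proof.
intros H y Hy; destruct (H y Hy) as [B [HB0 HB]]; exists B; split; [exact HB0|].
intros m; eapply Rle_trans; [|apply HB]; unfold ecoef.
assert (H1 : 1 <= INR (S m)) by (apply (le_INR 1); lia).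
rewrite Cmod_div by (apply Cpow_nz, RtoC_inj_neq; lra).
rewrite Cmod_pow, Cmod_RtoC_pos by lra.
pose proof (pow_R1_Rle _ (S n) H1) as H2; pose proof (Cmod_ge_0 (c (S m))) as H3.
apply Rle_div_l; [lra|nra].
Qed.

Lemma psum_ext (c d : nat -> C) (z : C) (N : nat) :
  (forall n, c (S n) = d (S n)) -> psum c z N = psum d z N.
Proof. intros H; apply csum_ext; intros i _; rewrite H; reflexivity. Qed.

(** The (n+1)-st derivative of the Eichler integral is (2 pi i)^(n+1) f. By Bol's identity and the
    modularity of f, the weight -n defect of the integral has zero (n+1)-st derivative. *)
Lemma period_polynomial (c : nat -> C) (f : C -> C) (n : nat) :
  qexp c f -> S_modular (Z.of_nat n + 2) f ->
  exists P : nat -> C, forall z, in_H z ->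
    (z ^ n * qsum (ecoef n c) (-1 / z) - qsum (ecoef n c) z)%C =
    csum (fun i => P i * z ^ i)%C (S n).
Proof.
intros Hf Hm.
pose proof (qexp_tame _ _ Hf) as Hc.
pose proof (tame_ecoef n c Hc) as Hb; set (b := ecoef n c) in *.
pose (D := fun j => qsum (dcoefs j b)).
assert (HD : forall j z, in_H z -> Cder (D j) z (D (S j) z)).
{ intros j z Hz; apply qsum_Cder; [apply tame_dcoefs, Hb|exact Hz]. }
assert (HDf : forall z, in_H z -> D (S n) z = ((2 * PI * Ci) ^ S n * f z)%C).
{ intros z Hz; apply (Clim_unique (psum (dcoefs (S n) b) z)).
  - apply qexp_qsum; [apply tame_dcoefs, Hb|exact Hz].
  - apply (Clim_ext (fun N => (2 * PI * Ci) ^ S n * psum c z N)%C).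
    + intros N; unfold psum; rewrite <- csum_scal; apply csum_ext; intros i _.
      rewrite dcoefs_eq; unfold b, ecoef; field.
      apply Cpow_nz, RtoC_inj_neq, not_0_INR; lia.
    + apply Clim_scal, Hf, Hz. }
assert (Hself : nder (S n) (D O) (D (S n))).
{ assert (Hj : forall m j, nder m (D j) (D (m + j)%nat)).
  { induction m as [|m IH]; intros j; [apply nder_0; reflexivity|].
    apply nder_S with (D (S j)); [apply HD|].
    replace (S m + j)%nat with (m + S j)%nat by lia; apply IH. }
  specialize (Hj (S n) O); rewrite Nat.add_0_r in Hj; exact Hj. }
pose proof (nder_plus _ _ _ _ _ (bol_identity D n HD) (nder_scal (- (1)) _ _ _ Hself)) as H.
destruct (nder_zero_polynomial n (fun z => z ^ n * D O (-1 / z) + - (1) * D O z)%C) as [P HP].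
- eapply nder_ext_r; [exact H|].
  intros z Hz; pose proof (in_H_neq_0 z Hz) as Hz0; cbv beta.
  rewrite !HDf by (try apply in_H_neg_inv; exact Hz).
  rewrite (Hm z Hz).
  replace (CpowZ z (Z.of_nat n + 2)) with (z ^ (n + 2))%C.
  + field; apply Cpow_nz, Hz0.
  + replace (Z.of_nat n + 2)%Z with (Z.pos (Pos.of_nat (n + 2))) by lia.
    simpl; rewrite Nat2Pos.id by lia; reflexivity.
- exists P; intros z Hz; rewrite <- (HP z Hz); unfold D, dcoefs; simpl Nat.iter; ring.
Qed.

(** * Hecke operators on q-expansions *)

Definition nprime (p : nat) : Prop := prime (Z.of_nat p).

Lemma nprime_ge_2 (p : nat) : nprime p -> (2 <= p)%nat.
Proof. intros H; apply prime_ge_2 in H; lia. Qed.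

Lemma qexp_same (c d : nat -> C) (g h : C -> C) :
  qexp c g -> qexp d h -> (forall n, c (S n) = d (S n)) ->
  forall z, in_H z -> g z = h z.
Proof.
intros Hg Hh E z Hz; apply (Clim_unique (psum c z)); [apply Hg, Hz|].
apply (Clim_ext (psum d z)); [|apply Hh, Hz].
intros N; apply psum_ext; intros n; rewrite E; reflexivity.
Qed.

Lemma qexp_plus (c d : nat -> C) (g h : C -> C) :
  qexp c g -> qexp d h -> qexp (fun n => c n + d n)%C (fun z => g z + h z)%C.
Proof.
intros Hg Hh z Hz; apply (Clim_ext (fun N => psum c z N + psum d z N)%C).
- intros N; unfold psum; rewrite <- csum_plus; apply csum_ext; intros; ring.
- apply Clim_plus; auto.
Qed.

Lemma qexp_scal (a : C) (c : nat -> C) (g : C -> C) :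
  qexp c g -> qexp (fun n => a * c n)%C (fun z => a * g z)%C.
Proof.
intros Hg z Hz; apply (Clim_ext (fun N => a * psum c z N)%C).
- intros N; unfold psum; rewrite <- csum_scal; apply csum_ext; intros; ring.
- apply Clim_scal; auto.
Qed.

Lemma Im_scal_real (x : R) (z : C) : Im (x * z)%C = x * Im z.
Proof. destruct z; simpl; ring. Qed.

(** The coefficients of g(pz) when g has coefficients c. *)
Definition dilate (p : nat) (c : nat -> C) (m : nat) : C :=
  if (m mod p =? 0)%nat then c (m / p)%nat else 0%C.

Lemma psum_dilate (p : nat) (c : nat -> C) (z : C) (N : nat) :
  (1 <= p)%nat -> psum (dilate p c) z N = psum c (INR p * z) (N / p).
Proof.
intros Hp; induction N as [|N IH]; [rewrite Nat.Div0.div_0_l; reflexivity|].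
unfold psum in *; rewrite csum_S, IH; unfold dilate.
pose proof (Nat.div_mod_eq N p) as E1; pose proof (Nat.mod_upper_bound N p ltac:(lia)) as B1.
pose proof (Nat.div_mod_eq (S N) p) as E2.
pose proof (Nat.mod_upper_bound (S N) p ltac:(lia)) as B2.
destruct (Nat.eqb_spec (S N mod p) 0) as [E|E].
- assert (Hd : (S N / p = S (N / p))%nat) by nia.
  rewrite Hd, csum_S; f_equal; f_equal.
  rewrite <- Hd, !q_pow; f_equal.
  rewrite E2 at 1; rewrite E, Nat.add_0_r, mult_INR, RtoC_mult; ring.
- assert (Hd : (S N / p = N / p)%nat) by nia.
  rewrite Hd; ring.
Qed.

Lemma qexp_dilate (p : nat) (c : nat -> C) (g : C -> C) :
  (1 <= p)%nat -> qexp c g -> qexp (dilate p c) (fun z => g (INR p * z)%C).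
Proof.
intros Hp Hg z Hz.
apply (Clim_ext (fun N => psum c (INR p * z) (N / p))).
- intros N; symmetry; apply psum_dilate, Hp.
- apply (Clim_subseq (psum c (INR p * z))).
  + intros M; exists (p * M)%nat; intros n Hn.
    apply Nat.div_le_lower_bound; lia.
  + apply Hg; unfold in_H in *; rewrite Im_scal_real.
    apply Rmult_lt_0_compat; [apply lt_0_INR; lia|exact Hz].
Qed.

Lemma Im_shift_div (z : C) (b p : nat) :
  (1 <= p)%nat -> Im ((z + INR b) / INR p)%C = / INR p * Im z.
Proof.
intros Hp; replace ((z + INR b) / INR p)%C with (RtoC (/ INR p) * (z + RtoC (INR b)))%C.
- rewrite Im_scal_real, Im_plus_real; reflexivity.
- rewrite RtoC_inv by (apply not_0_INR; lia); unfold Cdiv; ring.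
Qed.

Lemma in_H_shift_div (z : C) (b p : nat) :
  (1 <= p)%nat -> in_H z -> in_H ((z + INR b) / INR p)%C.
Proof.
unfold in_H; intros Hp Hz; rewrite Im_shift_div by exact Hp.
apply Rmult_lt_0_compat; [apply Rinv_0_lt_compat, lt_0_INR; lia|exact Hz].
Qed.

Lemma csum_q_shift_div (z : C) (p M r : nat) :
  (0 < r < p)%nat ->
  csum (fun b => q ((z + INR b) / INR p) ^ (p * M + r))%C p = 0%C.
Proof.
intros Hr; assert (Hp0 : RtoC (INR p) <> 0%C) by (apply RtoC_inj_neq, not_0_INR; lia).
rewrite (csum_ext _ (fun b => q (z / INR p) ^ (p * M + r) *
   Cexp (2 * PI * Ci * (INR r * INR b / INR p)))%C).
- rewrite csum_scal, csum_additive_character by exact Hr; ring.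
- intros b _.
  replace ((z + INR b) / INR p)%C with (z / INR p + INR b / INR p)%C by (field; exact Hp0).
  rewrite q_pow_plus; f_equal.
  transitivity (Cexp (2 * PI * Ci * INR (M * b)) *
     Cexp (2 * PI * Ci * (INR r * INR b / INR p)))%C.
  + rewrite <- Cexp_plus; f_equal.
    rewrite plus_INR, !mult_INR, RtoC_plus, !RtoC_mult; field; exact Hp0.
  + rewrite Cexp_2PI_nat; ring.
Qed.

(** Cutting at pM splits the exponents into M blocks of length p; in each block only the last
    exponent is a multiple of p, and the sum over b kills the others. *)
Lemma psum_U (p : nat) (c : nat -> C) (z : C) (M : nat) :
  (1 <= p)%nat ->
  csum (fun b => psum c ((z + INR b) / INR p) (p * M)) p =
  psum (fun m => INR p * c (p * m)%nat)%C z M.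
Proof.
intros Hp; assert (Hp0 : RtoC (INR p) <> 0%C) by (apply RtoC_inj_neq, not_0_INR; lia).
induction M as [|M IH].
- rewrite Nat.mul_0_r; unfold psum; simpl; apply csum_zero.
- replace (p * S M)%nat with (p * M + p)%nat by lia.
  unfold psum in *.
  rewrite (csum_ext _ (fun b => csum (fun i => c (S i) * q ((z + INR b) / INR p) ^ S i) (p * M)
     + csum (fun i => c (S (p * M + i)) * q ((z + INR b) / INR p) ^ S (p * M + i)) p)%C)
    by (intros b _; apply csum_shift).
  rewrite csum_plus, IH, csum_S; f_equal.
  rewrite csum_exchange.
  rewrite (csum_single _ (p - 1) p).
  + replace (S (p * M + (p - 1))) with (p * S M)%nat by lia.
    rewrite csum_scal.
    rewrite (csum_ext _ (fun _ => q z ^ S M)%C).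
    * rewrite csum_const; ring.
    * intros b _; rewrite !q_pow.
      rewrite <- (Cmult_1_r (Cexp (INR (S M) * _))), <- (Cexp_2PI_nat (S M * b)), <- Cexp_plus.
      f_equal; rewrite !mult_INR, !RtoC_mult; field; exact Hp0.
  + lia.
  + intros i Hi Hi'; rewrite csum_scal.
    replace (S (p * M + i)) with (p * M + S i)%nat by lia.
    rewrite csum_q_shift_div by lia; ring.
Qed.

Lemma qexp_U (p : nat) (c : nat -> C) (g : C -> C) :
  (1 <= p)%nat -> qexp c g ->
  qexp (fun m => INR p * c (p * m)%nat)%C
       (fun z => csum (fun b => g ((z + INR b) / INR p)%C) p).
Proof.
intros Hp Hg z Hz.
apply (Clim_ext (fun M => csum (fun b => psum c ((z + INR b) / INR p) (p * M)) p)).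
- intros M; apply psum_U, Hp.
- apply (Clim_csum (fun b M => psum c ((z + INR b) / INR p) (p * M))).
  intros b _; apply (Clim_subseq (psum c ((z + INR b) / INR p)) _ (fun M => p * M)%nat).
  + intros M; exists M; intros n Hn; nia.
  + apply Hg, in_H_shift_div; assumption.
Qed.

Lemma nprime_divides (p d : nat) :
  nprime p -> Nat.divide d p -> d = 1%nat \/ d = p.
Proof.
intros Hp [m E]; pose proof (nprime_ge_2 p Hp).
assert (Hd : (Z.of_nat d | Z.of_nat p)%Z) by (exists (Z.of_nat m); lia).
destruct (prime_divisors _ Hp _ Hd) as [H1|[H1|[H1|H1]]]; lia.
Qed.

Lemma divisors_prime (p : nat) : nprime p -> divisors p = 1%nat :: p :: nil.
Proof.
intros Hp; pose proof (nprime_ge_2 p Hp) as H2; unfold divisors.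
assert (Es : seq 1 p = 1%nat :: seq 2 (p - 2) ++ p :: nil).
{ replace (seq 1 p) with (seq 1 (1 + (p - 2) + 1)) by (f_equal; lia).
  rewrite !seq_app; simpl; repeat f_equal; lia. }
rewrite Es; cbn [filter]; rewrite Nat.mod_1_r, filter_app; cbn [filter app Nat.eqb].
replace (filter _ (seq 2 (p - 2))) with (@nil nat).
- rewrite Nat.Div0.mod_same; reflexivity.
- symmetry; destruct (filter _ (seq 2 (p - 2))) as [|x l] eqn:E; [reflexivity|].
  assert (Hx : In x (filter (fun d => (p mod d =? 0)%nat) (seq 2 (p - 2))))
    by (rewrite E; left; reflexivity).
  apply filter_In in Hx; destruct Hx as [Hx1 Hx2].
  apply in_seq in Hx1; apply Nat.eqb_eq in Hx2.
  apply Nat.Lcm0.mod_divide in Hx2.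
  destruct (nprime_divides p x Hp Hx2); lia.
Qed.

Lemma Csum_seq_from (g : nat -> C) (m n : nat) :
  Csum g (seq m n) = csum (fun i => g (m + i)%nat) n.
Proof.
unfold Csum; revert m; induction n as [|n IH]; intros m; [reflexivity|].
rewrite csum_S_l; simpl; rewrite IH, Nat.add_0_r; f_equal.
apply csum_ext; intros i _; f_equal; lia.
Qed.

Lemma Csum_seq (g : nat -> C) (n : nat) : Csum g (seq 0 n) = csum g n.
Proof. apply Csum_seq_from. Qed.

Lemma hecke_prime_eq (k : Z) (p : nat) (f : C -> C) (z : C) :
  nprime p ->
  hecke k p f z = (RtoC (powerRZ (INR p) (k - 1)) * f (INR p * z) +
    RtoC (/ INR p) * csum (fun b => f ((z + INR b) / INR p)%C) p)%C.
Proof.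
intros Hp; pose proof (nprime_ge_2 p Hp) as H2.
assert (Hp0 : INR p <> 0) by (apply not_0_INR; lia).
assert (E : powerRZ (INR p) (k - 1) * powerRZ (INR p) (- k) = / INR p).
{ rewrite <- powerRZ_add by exact Hp0; replace (k - 1 + - k)%Z with (-1)%Z by lia.
  simpl; rewrite Rmult_1_r; reflexivity. }
unfold hecke; rewrite divisors_prime by exact Hp.
unfold Csum at 1; cbn [fold_right map]; rewrite !Csum_seq.
rewrite Nat.div_1_r, Nat.div_same by lia.
rewrite <- E, RtoC_mult.
assert (E1 : powerRZ (INR 1) (- k) = 1) by (simpl; apply powerRZ_R1).
rewrite E1; simpl (csum _ 1).
replace ((INR p * z + 0) / 1)%C with (INR p * z)%C by field.
rewrite (csum_ext (fun b => f ((INR 1 * z + INR b) / INR p)%C)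
  (fun b => f ((z + INR b) / INR p)%C)).
- ring.
- intros b _; f_equal; simpl (INR 1); unfold Cdiv; ring.
Qed.

Lemma hecke_coefficients (k : Z) (c : nat -> C) (f : C -> C) (p : nat) (lam : C) :
  nprime p -> qexp c f -> (forall z, in_H z -> hecke k p f z = (lam * f z)%C) ->
  forall m, (1 <= m)%nat ->
  (lam * c m)%C = (RtoC (powerRZ (INR p) (k - 1)) * dilate p c m + c (p * m)%nat)%C.
Proof.
intros Hp Hf He m Hm; pose proof (nprime_ge_2 p Hp) as H2.
assert (Hp0 : INR p <> 0) by (apply not_0_INR; lia).
destruct m as [|m]; [lia|].
pose proof (qexp_plus _ _ _ _
  (qexp_scal (powerRZ (INR p) (k - 1)) _ _ (qexp_dilate p c f ltac:(lia) Hf))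
  (qexp_scal (/ INR p)%R _ _ (qexp_U p c f ltac:(lia) Hf))) as H.
assert (H' : qexp (fun n => powerRZ (INR p) (k - 1) * dilate p c n +
   (/ INR p)%R * (INR p * c (p * n)%nat))%C (fun z => lam * f z)%C).
{ intros z Hz; rewrite <- He, hecke_prime_eq by assumption; exact (H z Hz). }
pose proof (qexp_unique _ _ _ (qexp_scal lam _ _ Hf) H' m) as E; cbv beta in E.
rewrite E; f_equal; rewrite RtoC_inv by exact Hp0; field; apply RtoC_inj_neq, Hp0.
Qed.

(** Dividing the m-th coefficient by m^(n+1) turns the weight n+2 Hecke relation into a rescaled
    weight -n relation with the same eigenvalue, which is c(p) because c(1) = 1. *)
Lemma eichler_hecke (n : nat) (c : nat -> C) (f : C -> C) (p : nat) :
  nprime p -> qexp c f -> c 1%nat = 1%C ->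
  (exists lam, forall z, in_H z -> hecke (Z.of_nat n + 2) p f z = (lam * f z)%C) ->
  forall z, in_H z ->
  (c p * qsum (ecoef n c) z = qsum (ecoef n c) (INR p * z) +
    INR p ^ n * csum (fun b => qsum (ecoef n c) ((z + INR b) / INR p)%C) p)%C.
Proof.
intros Hp Hf H1 [lam He]; pose proof (nprime_ge_2 p Hp) as H2.
assert (Hp0 : RtoC (INR p) <> 0%C) by (apply RtoC_inj_neq, not_0_INR; lia).
pose proof (hecke_coefficients _ c f p lam Hp Hf He) as Hc.
replace (Z.of_nat n + 2 - 1)%Z with (Z.of_nat (S n)) in Hc by lia.
rewrite <- pow_powerRZ in Hc.
assert (Hlam : lam = c p).
{ specialize (Hc 1%nat (le_n 1)); rewrite H1, Nat.mul_1_r in Hc.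
  unfold dilate in Hc; rewrite Nat.mod_small in Hc by lia; simpl in Hc.
  replace lam with (lam * 1)%C by ring; rewrite Hc; ring. }
subst lam.
pose proof (qexp_qsum _ (tame_ecoef n c (qexp_tame _ _ Hf))) as HF.
apply (qexp_same (fun m => c p * ecoef n c m)%C
  (fun m => dilate p (ecoef n c) m + INR p ^ n * (INR p * ecoef n c (p * m)))%C).
- apply qexp_scal, HF.
- apply qexp_plus; [apply qexp_dilate; [lia|exact HF]|].
  apply qexp_scal, qexp_U; [lia|exact HF].
- intros m; set (m' := S m).
  assert (Hm0 : RtoC (INR m') <> 0%C) by (apply RtoC_inj_neq, not_0_INR; unfold m'; lia).
  unfold ecoef at 1 3.
  replace (c p * (c m' / INR m' ^ S n))%C with (c p * c m' / INR m' ^ S n)%C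
    by (unfold Cdiv; ring).
  rewrite (Hc m') by (unfold m'; lia).
  rewrite RtoC_pow, mult_INR, RtoC_mult, Cpow_mult_l.
  unfold dilate; destruct (Nat.eqb_spec (m' mod p) 0) as [E|E].
  + assert (Ed : m' = (p * (m' / p))%nat) by (pose proof (Nat.div_mod_eq m' p); lia).
    unfold ecoef.
    assert (Em : RtoC (INR m') = (INR p * INR (m' / p))%C)
      by (rewrite <- RtoC_mult, <- mult_INR; f_equal; f_equal; exact Ed).
    assert (Hd0 : RtoC (INR (m' / p)) <> 0%C).
    { apply RtoC_inj_neq, not_0_INR; intros E0; unfold m' in *; nia. }
    rewrite Em, Cpow_mult_l, !Cpow_S; field.
    repeat split; try apply Cpow_nz; assumption.
  + rewrite !Cpow_S; field; repeat split; try apply Cpow_nz; assumption.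
Qed.

(** * Rationality of the action of Hecke operators on periods *)

Definition rational (x : R) : Prop := exists a b : Z, b <> 0%Z /\ x = IZR a / IZR b.

Lemma rational_IZR (a : Z) : rational (IZR a).
Proof. exists a, 1%Z; split; [lia|field]. Qed.

Lemma rational_INR (n : nat) : rational (INR n).
Proof. rewrite INR_IZR_INZ; apply rational_IZR. Qed.

Lemma rational_plus (x y : R) : rational x -> rational y -> rational (x + y).
Proof.
intros [a [b [Hb E]]] [a' [b' [Hb' E']]].
exists (a * b' + a' * b)%Z, (b * b')%Z; split; [lia|].
apply not_0_IZR in Hb, Hb'; subst.
rewrite plus_IZR, !mult_IZR; field; auto.
Qed.

Lemma rational_mult (x y : R) : rational x -> rational y -> rational (x * y).
Proof.
intros [a [b [Hb E]]] [a' [b' [Hb' E']]].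
exists (a * a')%Z, (b * b')%Z; split; [lia|].
apply not_0_IZR in Hb, Hb'; subst.
rewrite !mult_IZR; field; auto.
Qed.

Lemma rational_opp (x : R) : rational x -> rational (- x).
Proof.
intros H; replace (- x) with (-1 * x) by ring.
apply rational_mult; [apply rational_IZR|exact H].
Qed.

Lemma rational_inv (x : R) : rational x -> rational (/ x).
Proof.
intros [a [b [Hb E]]]; destruct (Z.eq_dec a 0) as [Ha|Ha].
- exists 0%Z, 1%Z; split; [lia|]; subst.
  replace (0 / IZR b) with 0 by (unfold Rdiv; ring); rewrite Rinv_0; field.
- exists b, a; split; [exact Ha|]; apply not_0_IZR in Ha, Hb; subst; field; auto.
Qed.

Lemma rational_rsum (u : nat -> R) (n : nat) :
  (forall i, (i < n)%nat -> rational (u i)) -> rational (rsum u n).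
Proof.
induction n as [|n IH]; intros H; simpl; [apply rational_IZR|].
apply rational_plus; auto.
Qed.

Definition Qspan (P : nat -> C) (n : nat) (x : C) : Prop :=
  exists r : nat -> R, (forall i, rational (r i)) /\ x = csum (fun i => r i * P i)%C n.

Lemma Qspan_0 (P : nat -> C) (n : nat) : Qspan P n 0.
Proof.
exists (fun _ => 0); split; [intros; apply rational_IZR|].
rewrite (csum_ext _ (fun _ => 0%C)); [rewrite csum_zero; reflexivity|intros; ring].
Qed.

Lemma Qspan_plus (P : nat -> C) (n : nat) (x y : C) :
  Qspan P n x -> Qspan P n y -> Qspan P n (x + y).
Proof.
intros [r [Hr E]] [s [Hs E']]; exists (fun i => r i + s i); split.
- intros i; apply rational_plus; auto.
- subst; rewrite <- csum_plus; apply csum_ext; intros; rewrite RtoC_plus; ring.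
Qed.

Lemma Qspan_scal (P : nat -> C) (n : nat) (a : R) (x : C) :
  rational a -> Qspan P n x -> Qspan P n (a * x).
Proof.
intros Ha [r [Hr E]]; exists (fun i => a * r i); split.
- intros i; apply rational_mult; auto.
- subst; rewrite <- csum_scal; apply csum_ext; intros; rewrite RtoC_mult; ring.
Qed.

Lemma Qspan_gen (P : nat -> C) (n i : nat) : (i < n)%nat -> Qspan P n (P i).
Proof.
intros Hi; exists (fun j => if Nat.eqb j i then 1 else 0); split.
- intros j; destruct (Nat.eqb j i); apply rational_IZR.
- rewrite (csum_single _ i n Hi).
  + rewrite Nat.eqb_refl; ring.
  + intros j _ Hj; apply Nat.eqb_neq in Hj; rewrite Hj; ring.
Qed.

Lemma Qspan_csum (P u : nat -> C) (n m : nat) :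
  (forall i, (i < m)%nat -> Qspan P n (u i)) -> Qspan P n (csum u m).
Proof.
induction m as [|m IH]; intros H; simpl; [apply Qspan_0|].
apply Qspan_plus; auto.
Qed.

(** * Polynomials with coefficients in a Q-span, and the period cocycle *)

Definition polyQ (P : nat -> C) (n : nat) (G : C -> C) : Prop :=
  exists c : nat -> C, (forall i, Qspan P (S n) (c i)) /\
  forall z, in_H z -> G z = csum (fun i => c i * z ^ i)%C (S n).

Lemma polyQ_ext (P : nat -> C) (n : nat) (G H : C -> C) :
  polyQ P n G -> (forall z, in_H z -> H z = G z) -> polyQ P n H.
Proof.
intros [c [Hc E]] E'; exists c; split; [exact Hc|].
intros z Hz; rewrite E' by exact Hz; apply E, Hz.
Qed.

Lemma polyQ_0 (P : nat -> C) (n : nat) : polyQ P n (fun _ => 0%C).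
Proof.
exists (fun _ => 0%C); split; [intros; apply Qspan_0|].
intros z _; rewrite (csum_ext _ (fun _ => 0%C)); [rewrite csum_zero; reflexivity|].
intros; ring.
Qed.

Lemma polyQ_plus (P : nat -> C) (n : nat) (G H : C -> C) :
  polyQ P n G -> polyQ P n H -> polyQ P n (fun z => G z + H z)%C.
Proof.
intros [c [Hc E]] [d [Hd E']]; exists (fun i => c i + d i)%C; split.
- intros; apply Qspan_plus; auto.
- intros z Hz; rewrite E, E', <- csum_plus by exact Hz; apply csum_ext; intros; ring.
Qed.

Lemma polyQ_csum (P : nat -> C) (n m : nat) (G : nat -> C -> C) :
  (forall i, (i < m)%nat -> polyQ P n (G i)) ->
  polyQ P n (fun z => csum (fun i => G i z) m).
Proof.
induction m as [|m IH]; intros H; simpl; [apply polyQ_0|].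
apply polyQ_plus; auto.
Qed.

Definition polyZ (n : nat) (G : C -> C) : Prop :=
  exists m : nat -> Z, forall z, G z = csum (fun i => IZR (m i) * z ^ i)%C (S n).

Lemma polyZ_affine (n : nat) (G : C -> C) (a b : Z) :
  polyZ n G -> polyZ (S n) (fun z => (IZR a * z + IZR b) * G z)%C.
Proof.
intros [m E].
exists (fun i => ((match i with O => 0 | S j => a * m j end) +
  (if (i <=? n)%nat then b * m i else 0))%Z).
intros z.
rewrite (csum_ext _ (fun i => IZR (match i with O => 0%Z | S j => (a * m j)%Z end) * z ^ i +
   IZR (if (i <=? n)%nat then (b * m i)%Z else 0%Z) * z ^ i)%C)
  by (intros i _; rewrite plus_IZR, RtoC_plus; ring).
rewrite csum_plus, csum_S_l.
rewrite (csum_S (fun i => IZR (if (i <=? n)%nat then (b * m i)%Z else 0%Z) * z ^ i)%C (S n)).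
rewrite (proj2 (Nat.leb_gt (S n) n)) by lia.
rewrite E, Cmult_plus_distr_r.
rewrite <- (Cplus_0_r (csum (fun i => IZR (if (i <=? n)%nat then _ else _) * _)%C _ + _)%C).
replace (RtoC 0) with (0 * z ^ 0)%C at 1 by ring.
rewrite (csum_ext (fun i => IZR (a * m i) * z ^ S i)%C (fun i => IZR a * z * (IZR (m i) * z ^ i))%C).
- rewrite csum_scal.
  rewrite (csum_ext (fun i => IZR (if (i <=? n)%nat then (b * m i)%Z else 0%Z) * z ^ i)%C
    (fun i => IZR b * (IZR (m i) * z ^ i))%C).
  + rewrite csum_scal; ring.
  + intros i Hi; rewrite (proj2 (Nat.leb_le i n)) by lia.
    rewrite mult_IZR, RtoC_mult; ring.
- intros i _; rewrite mult_IZR, RtoC_mult, Cpow_S; ring.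
Qed.

Lemma polyZ_affine_pow (a b c d : Z) (i j : nat) :
  polyZ (i + j) (fun z => (IZR a * z + IZR b) ^ i * (IZR c * z + IZR d) ^ j)%C.
Proof.
assert (E : forall n G H, polyZ n G -> (forall z, H z = G z) -> polyZ n H).
{ intros n G H [m Hm] E; exists m; intros z; rewrite E; apply Hm. }
induction i as [|i IH].
- induction j as [|j IH].
  + exists (fun _ => 1%Z); intros z; simpl; ring.
  + apply (E _ _ _ (polyZ_affine _ _ c d IH)); intros z; rewrite Cpow_S; simpl; ring.
- apply (E _ _ _ (polyZ_affine _ _ a b IH)); intros z; rewrite Cpow_S; ring.
Qed.

(** The weight -n action without a power of the determinant, so that integer matrices act on
    polynomials of degree at most n by integer coefficients. *)
Definition slash (n : nat) (a b c d : Z) (G : C -> C) (z : C) : C :=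
  ((IZR c * z + IZR d) ^ n * G ((IZR a * z + IZR b) / (IZR c * z + IZR d)))%C.

Lemma denominator_neq_0 (a b c d : Z) (z : C) :
  (0 < a * d - b * c)%Z -> in_H z -> (IZR c * z + IZR d)%C <> 0%C.
Proof.
intros Hdet Hz E; unfold in_H in Hz.
assert (E1 : IZR c * Im z = 0)
  by (apply (f_equal Im) in E; destruct z; simpl in *; lra).
apply Rmult_integral in E1; destruct E1 as [E1|E1]; [|lra].
apply eq_IZR in E1; subst c.
assert (E2 : IZR d = 0) by (apply (f_equal Re) in E; destruct z; simpl in *; lra).
apply eq_IZR in E2; lia.
Qed.

Lemma in_H_mobius (a b c d : Z) (z : C) :
  (0 < a * d - b * c)%Z -> in_H z ->
  in_H ((IZR a * z + IZR b) / (IZR c * z + IZR d))%C.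
Proof.
intros Hdet Hz; pose proof (denominator_neq_0 a b c d z Hdet Hz) as H0.
set (w := (IZR c * z + IZR d)%C) in *.
assert (Hw : 0 < Cmod w ^ 2) by (apply pow_lt, Cmod_gt_0, H0).
assert (E : Im ((IZR a * z + IZR b) / w)%C * Cmod w ^ 2 = IZR (a * d - b * c) * Im z).
{ rewrite minus_IZR, !mult_IZR, Cmod_sqr in *; unfold w in *; destruct z as [x y]; simpl in *.
  field; lra. }
unfold in_H in *; apply IZR_lt in Hdet; simpl in Hdet.
apply Rmult_lt_reg_r with (Cmod w ^ 2); [exact Hw|]; rewrite E, Rmult_0_l.
apply Rmult_lt_0_compat; assumption.
Qed.

(** The monomial z^i becomes (az+b)^i (cz+d)^(n-i), a polynomial with integer coefficients. *)
Lemma polyQ_slash (P : nat -> C) (n : nat) (a b c d : Z) (G : C -> C) :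
  (0 < a * d - b * c)%Z -> polyQ P n G -> polyQ P n (slash n a b c d G).
Proof.
intros Hdet [e [He E]].
apply (polyQ_ext P n (fun z => csum (fun i =>
  e i * ((IZR a * z + IZR b) ^ i * (IZR c * z + IZR d) ^ (n - i)))%C (S n))).
- apply (polyQ_csum P n (S n) (fun i z =>
    e i * ((IZR a * z + IZR b) ^ i * (IZR c * z + IZR d) ^ (n - i)))%C).
  intros i Hi; destruct (polyZ_affine_pow a b c d i (n - i)) as [m Hm].
  replace (i + (n - i))%nat with n in Hm by lia.
  exists (fun j => (e i * IZR (m j))%C); split.
  + intros j; rewrite Cmult_comm; apply Qspan_scal; [apply rational_IZR|apply He].
  + intros z _; cbv beta; rewrite Hm, <- csum_scal; apply csum_ext; intros; ring.
- intros z Hz; unfold slash.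
  rewrite E by (apply in_H_mobius; assumption).
  rewrite <- csum_scal; apply csum_ext; intros i Hi.
  pose proof (denominator_neq_0 a b c d z Hdet Hz) as H0.
  replace n with (n - i + i)%nat at 1 by lia.
  rewrite Cpow_add_r; unfold Cdiv; rewrite Cpow_mult_l, Cpow_inv by exact H0.
  field; apply Cpow_nz, H0.
Qed.

Lemma Cpow_neg_even (z : C) (n : nat) : Nat.Even n -> ((- z) ^ n = z ^ n)%C.
Proof.
intros [m Hm]; subst; rewrite !Cpow_mult_r; f_equal; simpl; ring.
Qed.

Definition polyP (P : nat -> C) (n : nat) (z : C) : C :=
  csum (fun i => P i * z ^ i)%C (S n).

(** What the cocycle argument uses of the Eichler integral: its values under the two generators of
    SL(2,Z). Evenness of n makes -I act trivially. *)
Definition eichler_period (n : nat) (F : C -> C) (P : nat -> C) : Prop :=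
  Nat.Even n /\ (forall z m, in_H z -> F (z + IZR m)%C = F z) /\
  forall z, in_H z -> (z ^ n * F (-1 / z) - F z)%C = polyP P n z.

Lemma polyQ_period (P : nat -> C) (n : nat) : polyQ P n (polyP P n).
Proof.
exists (fun i => if (i <? S n)%nat then P i else 0%C); split.
- intros i; destruct (Nat.ltb_spec i (S n)); [apply Qspan_gen; lia|apply Qspan_0].
- intros z _; apply csum_ext; intros i Hi.
  rewrite (proj2 (Nat.ltb_lt i (S n))) by exact Hi; reflexivity.
Qed.

(* Euclid's algorithm on the bottom row (c, d). *)
Lemma cocycle_polyQ (n : nat) (F : C -> C) (P : nat -> C) (a b c d : Z) :
  eichler_period n F P ->
  (a * d - b * c = 1)%Z -> polyQ P n (fun z => slash n a b c d F z - F z)%C.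
Proof.
intros [n_even [F_periodic F_period]].
assert (H : forall N a b c d, (Z.abs_nat c <= N)%nat -> (a * d - b * c = 1)%Z ->
  polyQ P n (fun z => slash n a b c d F z - F z)%C).
{ clear a b c d; induction N as [|N IH]; intros a b c d Hc Hdet.
  - assert (c = 0%Z) by lia; subst c.
    assert (Had : (a = 1 /\ d = 1 \/ a = -1 /\ d = -1)%Z).
    { assert (Ha : (a * d = 1)%Z) by lia.
      apply Z.eq_mul_1 in Ha as Ha'; destruct Ha'; subst; lia. }
    apply (polyQ_ext P n (fun _ => 0%C)); [apply polyQ_0|].
    intros z Hz; unfold slash; destruct Had as [[-> ->]|[-> ->]].
    + replace ((1 * z + IZR b) / (0 * z + 1))%C with (z + IZR b)%C by field.
      rewrite F_periodic by exact Hz.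
      replace (0 * z + 1)%C with (RtoC 1) by ring; rewrite Cpow_1_l; ring.
    + replace ((-1 * z + IZR b) / (0 * z + -1))%C with (z + IZR (- b))%C
        by (rewrite opp_IZR, RtoC_opp; field; intros E; apply RtoC_inj in E; lra).
      rewrite F_periodic by exact Hz.
      replace (0 * z + -1)%C with (- (1))%C by ring.
      rewrite Cpow_neg_even, Cpow_1_l by exact n_even; ring.
  - destruct (Z.eq_dec c 0) as [Hc0|Hc0]; [apply IH; lia|].
    set (u := (d / c)%Z); set (r := (d mod c)%Z).
    assert (Hd : d = (c * u + r)%Z) by (apply Z.div_mod, Hc0).
    assert (Hr : (Z.abs r < Z.abs c)%Z).
    { unfold r; destruct (Z_lt_le_dec 0 c) as [Hp|Hp].
      - pose proof (Z.mod_pos_bound d c Hp); lia.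
      - pose proof (Z.mod_neg_bound d c ltac:(lia)); lia. }
    (* This matrix times (0, -1; 1, u) is -(a, b; c, d), and the sign is harmless for even n. Its
       lower left entry is the remainder r, with |r| < |c|. The cocycle relation adds the period
       polynomial translated by u. *)
    pose proof (IH (b - u * a)%Z (- a)%Z r (- c)%Z ltac:(lia) ltac:(nia)) as Hv.
    set (v := fun z => (slash n (b - u * a) (- a) r (- c) F z - F z)%C) in Hv.
    apply (polyQ_ext P n (fun z => slash n 1 u 0 1 (polyP P n) z + slash n 0 (-1) 1 u v z)%C).
    { apply polyQ_plus; apply polyQ_slash; try lia; [apply polyQ_period|exact Hv]. }
    intros z Hz.
    assert (Hz1 : in_H (z + IZR u)%C) by (unfold in_H; rewrite Im_plus_real; exact Hz).
    pose proof (in_H_neq_0 _ Hz1) as Hz10.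
    pose proof (denominator_neq_0 a b c d z ltac:(lia) Hz) as Hden.
    unfold slash at 2.
    replace ((1 * z + IZR u) / (0 * z + 1))%C with (z + IZR u)%C by field.
    replace (0 * z + 1)%C with (RtoC 1) by ring; rewrite Cpow_1_l, Cmult_1_l.
    rewrite <- F_period by exact Hz1.
    unfold slash at 2.
    replace ((0 * z + -1) / (1 * z + IZR u))%C with (-1 / (z + IZR u))%C.
    2:{ replace (0 * z + -1)%C with (RtoC (-1)) by ring.
        replace (1 * z + IZR u)%C with (z + IZR u)%C by ring; reflexivity. }
    replace (1 * z + IZR u)%C with (z + IZR u)%C by ring.
    unfold v; rewrite F_periodic by exact Hz.
    assert (Hcd : (IZR c * z + IZR d)%C = (IZR c * (z + IZR u) + IZR r)%C)
      by (rewrite Hd at 1; rewrite plus_IZR, mult_IZR, RtoC_plus, RtoC_mult; ring).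
    assert (Hs : slash n a b c d F z =
      ((z + IZR u) ^ n * slash n (b - u * a) (- a) r (- c) F (-1 / (z + IZR u)))%C).
    { unfold slash.
      assert (E : (IZR r * (-1 / (z + IZR u)) + IZR (- c))%C =
        (- (IZR c * z + IZR d) / (z + IZR u))%C)
        by (rewrite Hcd, opp_IZR, RtoC_opp; field; exact Hz10).
      rewrite E.
      replace ((IZR (b - u * a) * (-1 / (z + IZR u)) + IZR (- a)) /
        (- (IZR c * z + IZR d) / (z + IZR u)))%C with
        ((IZR a * z + IZR b) / (IZR c * z + IZR d))%C.
      - rewrite Cmult_assoc, <- Cpow_mult_l.
        replace ((z + IZR u) * (- (IZR c * z + IZR d) / (z + IZR u)))%C with
          (- (IZR c * z + IZR d))%C by (field; exact Hz10).
        rewrite Cpow_neg_even by exact n_even; reflexivity.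
      - rewrite minus_IZR, opp_IZR, mult_IZR, RtoC_minus, RtoC_opp, RtoC_mult.
        field; repeat split; try assumption. }
    rewrite Hs; ring. }
intros Hdet; apply (H (Z.abs_nat c)); [lia|exact Hdet].
Qed.

(** * Hecke operators and the period polynomial *)

Lemma Csum_Permutation (g : nat -> C) (l l' : list nat) :
  Permutation l l' -> Csum g l = Csum g l'.
Proof.
unfold Csum; intros H; induction H; simpl; try congruence; ring.
Qed.

Lemma neg_inverse_mod (p b : nat) :
  nprime p -> (0 < b < p)%nat ->
  exists b' : nat, (0 < b' < p)%nat /\ Nat.divide p (b * b' + 1).
Proof.
intros Hp Hb.
pose proof (rel_prime_le_prime (Z.of_nat b) _ Hp ltac:(lia)) as Hr.
apply rel_prime_bezout in Hr; destruct Hr as [u v E].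
set (x := ((- u) mod Z.of_nat p)%Z).
assert (Hx : (0 <= x < Z.of_nat p)%Z) by (apply Z.mod_pos_bound; lia).
assert (Hd : (Z.of_nat p | Z.of_nat b * x + 1)%Z).
{ exists (v - Z.of_nat b * (- u / Z.of_nat p))%Z; unfold x.
  rewrite Z.mod_eq by lia; nia. }
exists (Z.to_nat x); split.
- assert (x <> 0%Z); [|lia].
  intros E0; rewrite E0, Z.mul_0_r in Hd; apply Z.divide_1_r_nonneg in Hd; lia.
- destruct Hd as [y Hy]; exists (Z.to_nat y).
  assert (0 <= y)%Z by nia.
  apply Nat2Z.inj; rewrite Nat2Z.inj_add, !Nat2Z.inj_mul, !Z2Nat.id by lia; exact Hy.
Qed.

(** b -> -1/b permutes the nonzero residues mod p; this is how z -> -1/z matches the points (z+b)/p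
    with each other. *)
Lemma csum_reindex_neg_inverse (g : nat -> C) (p : nat) (s : nat -> nat) :
  nprime p ->
  (forall b, (0 < b < p)%nat -> (0 < s b < p)%nat /\ Nat.divide p (b * s b + 1)) ->
  csum (fun i => g (s (S i))) (p - 1) = csum (fun i => g (S i)) (p - 1).
Proof.
intros Hp Hs.
change (csum (fun i => g (S i)) (p - 1)) with (csum (fun i => g (1 + i)%nat) (p - 1)).
rewrite <- Csum_seq_from.
change (csum (fun i => g (s (S i))) (p - 1)) with
  (csum (fun i => (fun j => g (s j)) (1 + i)%nat) (p - 1)).
rewrite <- Csum_seq_from.
transitivity (Csum g (map s (seq 1 (p - 1)))).
{ unfold Csum; rewrite map_map; reflexivity. }
apply Csum_Permutation, NoDup_Permutation_bis.
- apply NoDup_map_NoDup_ForallPairs; [|apply seq_NoDup].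
  intros x y Hx Hy Exy; apply in_seq in Hx, Hy.
  destruct (Hs x ltac:(lia)) as [Bx [u Dx]], (Hs y ltac:(lia)) as [By [v Dy]].
  rewrite Exy in Bx, Dx.
  assert (Hd : (Z.of_nat p | (Z.of_nat x - Z.of_nat y) * Z.of_nat (s y))%Z)
    by (exists (Z.of_nat u - Z.of_nat v)%Z; nia).
  destruct (prime_mult _ Hp _ _ Hd) as [Hd'|Hd'].
  + destruct Hd' as [w Hw]; assert (w = 0 \/ w <= -1 \/ 1 <= w)%Z as [Ew|[Ew|Ew]] by lia; nia.
  + apply Z.divide_pos_le in Hd'; lia.
- rewrite length_map; lia.
- intros y Hy; apply in_map_iff in Hy; destruct Hy as [x [E Hx]]; subst.
  apply in_seq in Hx; apply in_seq; destruct (Hs x ltac:(lia)); lia.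
Qed.

Lemma polynomial_zero (e : nat -> C) (n : nat) :
  (forall z, in_H z -> polyP e n z = 0%C) -> forall i, (i < S n)%nat -> e i = 0%C.
Proof.
unfold polyP; induction n as [|n IH]; intros H i Hi.
- specialize (H Ci ltac:(unfold in_H; simpl; lra)); simpl in H.
  replace i with O by lia; rewrite <- H; ring.
- assert (Htop : e (S n) = 0%C).
  { apply Cmod_eq_0, Rle_antisym; [|apply Cmod_ge_0]; apply Rnot_lt_le; intros Hlt.
    set (M := rsum (fun i => Cmod (e i)) (S n)).
    assert (HM : 0 <= M) by (apply rsum_nonneg; intros; apply Cmod_ge_0).
    set (a := Cmod (e (S n))) in *.
    (* At z = iT the leading term has modulus a T^(n+1) = (M + a) T^n, more than the M T^n that the
       lower terms can reach. *)
    set (T := M / a + 1).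
    assert (HT : 1 <= T).
    { unfold T; assert (0 <= M / a); [|lra].
      apply Rmult_le_pos; [exact HM|left; apply Rinv_0_lt_compat, Hlt]. }
    specialize (H (T * Ci)%C ltac:(unfold in_H; simpl; lra)).
    rewrite csum_S in H.
    assert (Hm : Cmod (T * Ci) = T) by (rewrite Cmod_mult, Cmod_Ci, Cmod_RtoC_pos; lra).
    assert (E : Cmod (e (S n) * (T * Ci) ^ S n) <= M * T ^ n).
    { replace (e (S n) * (T * Ci) ^ S n)%C with
        (- csum (fun i => e i * (T * Ci) ^ i) (S n))%C.
      - rewrite Cmod_opp; unfold M; rewrite Rmult_comm, <- rsum_scal.
        apply Cmod_csum_le; intros j Hj.
        rewrite Cmod_mult, Cmod_pow, Hm, Rmult_comm.
        apply Rmult_le_compat_r; [apply Cmod_ge_0|apply Rle_pow; [exact HT|lia]].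
      - rewrite <- (Cplus_0_l (- _)%C), <- H; ring. }
    rewrite Cmod_mult, Cmod_pow, Hm in E; fold a in E; simpl in E.
    assert (HTn : 0 < T ^ n) by (apply pow_lt; lra).
    assert (a * T <= M).
    { apply Rmult_le_reg_r with (T ^ n); [exact HTn|lra]. }
    unfold T in *; replace (a * (M / a + 1)) with (M + a) in * by (field; lra); lra. }
  destruct (Nat.eq_dec i (S n)) as [->|Hne]; [exact Htop|].
  apply IH; [|lia]; intros z Hz; rewrite <- (H z Hz), (csum_S _ (S n)), Htop; ring.
Qed.

(** Apply the weight -n defect under z -> -1/z to the Hecke relation. Up to SL(2,Z) on the left,
    this substitution permutes the p+1 terms: pz and z/p are exchanged, and b goes with -1/b mod p.
    Each mismatch is a cocycle value slashed by an integer matrix. *)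
Lemma hecke_polyQ (n p : nat) (F : C -> C) (P : nat -> C) (lam : C) :
  eichler_period n F P -> nprime p ->
  (forall z, in_H z -> (lam * F z = F (INR p * z) +
     INR p ^ n * csum (fun b => F ((z + INR b) / INR p)%C) p)%C) ->
  polyQ P n (fun z => lam * polyP P n z)%C.
Proof.
intros HFP Hp HT; pose proof (nprime_ge_2 p Hp) as H2.
assert (Hp0 : RtoC (INR p) <> 0%C) by (apply RtoC_inj_neq, not_0_INR; lia).
assert (Hs : exists s : nat -> nat, forall b, (0 < b < p)%nat ->
   (0 < s b < p)%nat /\ Nat.divide p (b * s b + 1)).
{ exists (fun b => epsilon (inhabits O)
    (fun b' => (0 < b' < p)%nat /\ Nat.divide p (b * b' + 1))).
  intros b Hb; apply epsilon_spec, neg_inverse_mod; assumption. }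
destruct Hs as [s Hs].
set (e := fun b => ((b * s b + 1) / p)%nat).
assert (He : forall b, (0 < b < p)%nat -> (p * e b = b * s b + 1)%nat).
{ intros b Hb; destruct (Hs b Hb) as [_ [x Hx]]; unfold e; rewrite Hx, Nat.div_mul; lia. }
set (zn := Z.of_nat).
(* The determinant is p e(b) - b s(b) = 1, and this matrix sends (z + s(b))/p to (-1/z + b)/p. *)
set (v := fun b z => (slash n (zn b) (- zn (e b)) (zn p) (- zn (s b)) F z - F z)%C).
assert (Hv : forall b, (0 < b < p)%nat -> polyQ P n (v b)).
{ intros b Hb; apply cocycle_polyQ; [exact HFP|]; specialize (He b Hb); unfold zn; nia. }
destruct HFP as [n_even [F_periodic F_period]].
apply (polyQ_ext P n (fun z => slash n 1 0 0 (zn p) (polyP P n) z +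
   slash n (zn p) 0 0 1 (polyP P n) z +
   csum (fun i => slash n 1 (zn (s (S i))) 0 (zn p) (v (S i)) z) (p - 1))%C).
{ apply polyQ_plus; [apply polyQ_plus|].
  - apply polyQ_slash; [unfold zn; lia|apply polyQ_period].
  - apply polyQ_slash; [unfold zn; lia|apply polyQ_period].
  - apply (polyQ_csum P n (p - 1) (fun i => slash n 1 (zn (s (S i))) 0 (zn p) (v (S i)))).
    intros i Hi; apply polyQ_slash; [unfold zn; lia|apply Hv; lia]. }
intros z Hz; pose proof (in_H_neq_0 z Hz) as Hz0.
assert (Ezp : forall x, RtoC (IZR (zn x)) = RtoC (INR x))
  by (intros x; unfold zn; rewrite INR_IZR_INZ; reflexivity).
assert (Hzdp : in_H (z / INR p)%C).
{ pose proof (in_H_shift_div z 0 p ltac:(lia) Hz) as H.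
  simpl (INR 0) in H; rewrite Cplus_0_r in H; exact H. }
assert (Hpz : in_H (INR p * z)%C).
{ unfold in_H in *; rewrite Im_scal_real; apply Rmult_lt_0_compat; [apply lt_0_INR; lia|exact Hz]. }
assert (E1 : slash n 1 0 0 (zn p) (polyP P n) z =
  (z ^ n * F (INR p * (-1 / z)) - INR p ^ n * F (z / INR p))%C).
{ unfold slash; rewrite Ezp.
  replace ((1 * z + 0) / (0 * z + INR p))%C with (z / INR p)%C
    by (unfold Cdiv; f_equal; [ring|f_equal; ring]).
  replace (0 * z + INR p)%C with (RtoC (INR p)) by ring.
  rewrite <- F_period by exact Hzdp.
  replace (-1 / (z / INR p))%C with (INR p * (-1 / z))%C by (field; split; assumption).
  replace ((z / INR p) ^ n)%C with (z ^ n / INR p ^ n)%C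
    by (unfold Cdiv; rewrite Cpow_mult_l, Cpow_inv by exact Hp0; reflexivity).
  field; apply Cpow_nz, Hp0. }
assert (E2 : slash n (zn p) 0 0 1 (polyP P n) z =
  (z ^ n * INR p ^ n * F ((-1 / z + INR 0) / INR p) - F (INR p * z))%C).
{ unfold slash; rewrite Ezp.
  replace ((INR p * z + 0) / (0 * z + 1))%C with (INR p * z)%C by field.
  replace (0 * z + 1)%C with (RtoC 1) by ring.
  rewrite Cpow_1_l, <- F_period by exact Hpz.
  simpl (INR 0); rewrite Cplus_0_r.
  replace (-1 / z / INR p)%C with (-1 / (INR p * z))%C by (field; split; assumption).
  rewrite Cpow_mult_l; ring. }
assert (E3 : forall b, (0 < b < p)%nat ->
  slash n 1 (zn (s b)) 0 (zn p) (v b) z =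
  (z ^ n * INR p ^ n * F ((-1 / z + INR b) / INR p)
   - INR p ^ n * F ((z + INR (s b)) / INR p))%C).
{ intros b Hb; unfold slash at 1; rewrite !Ezp.
  replace ((1 * z + INR (s b)) / (0 * z + INR p))%C with ((z + INR (s b)) / INR p)%C
    by (unfold Cdiv; f_equal; [ring|f_equal; ring]).
  replace (0 * z + INR p)%C with (RtoC (INR p)) by ring.
  unfold v, slash; rewrite !opp_IZR, !RtoC_opp, !Ezp.
  replace (INR p * ((z + INR (s b)) / INR p) + - INR (s b))%C with z by (field; exact Hp0).
  replace (INR b * ((z + INR (s b)) / INR p) + - INR (e b))%C with
    ((INR b * z - 1) / INR p)%C.
  - replace ((INR b * z - 1) / INR p / z)%C with ((-1 / z + INR b) / INR p)%C
      by (field; split; assumption).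
    ring.
  - assert (Ee : (INR p * INR (e b))%C = (INR b * INR (s b) + 1)%C).
    { rewrite <- !RtoC_mult, <- mult_INR, (He b Hb), plus_INR, mult_INR, RtoC_plus; reflexivity. }
    replace (RtoC (INR (e b))) with ((INR b * INR (s b) + 1) / INR p)%C
      by (rewrite <- Ee; field; exact Hp0).
    field; exact Hp0. }
rewrite (csum_ext _ (fun i => z ^ n * INR p ^ n * F ((-1 / z + INR (S i)) / INR p)
   + (- INR p ^ n) * F ((z + INR (s (S i))) / INR p))%C)
  by (intros i Hi; rewrite E3 by lia; ring).
rewrite csum_plus, !csum_scal.
rewrite (csum_reindex_neg_inverse (fun b => F ((z + INR b) / INR p)%C) p s Hp Hs).
rewrite E1, E2, <- F_period by exact Hz.
pose proof (HT z Hz) as A1; pose proof (HT _ (in_H_neg_inv z Hz)) as A2.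
assert (Hsplit : forall g, csum g p = (g O + csum (fun i => g (S i)) (p - 1))%C)
  by (intros g; rewrite <- csum_S_l; f_equal; lia).
rewrite Hsplit in A1, A2; simpl (INR 0) in *; rewrite !Cplus_0_r in *.
replace (lam * (z ^ n * F (-1 / z) - F z))%C with
  (z ^ n * (lam * F (-1 / z)) - lam * F z)%C by ring.
rewrite A1, A2; ring.
Qed.

Lemma hecke_Qspan (n p : nat) (F : C -> C) (P : nat -> C) (lam : C) :
  eichler_period n F P -> nprime p ->
  (forall z, in_H z -> (lam * F z = F (INR p * z) +
     INR p ^ n * csum (fun b => F ((z + INR b) / INR p)%C) p)%C) ->
  forall i, (i < S n)%nat -> Qspan P (S n) (lam * P i).
Proof.
intros HFP Hp HT i Hi.
destruct (hecke_polyQ n p F P lam HFP Hp HT) as [d [Hd E]].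
assert (E0 : (lam * P i + - (1) * d i)%C = 0%C).
{ apply (polynomial_zero (fun i => lam * P i + - (1) * d i)%C n); [|exact Hi].
  intros z Hz; unfold polyP.
  rewrite (csum_ext _ (fun i => lam * (P i * z ^ i) + - (1) * (d i * z ^ i))%C)
    by (intros; ring).
  rewrite csum_plus, !csum_scal, <- (E z Hz); unfold polyP; ring. }
replace (lam * P i)%C with (d i); [apply Hd|].
replace (lam * P i)%C with (lam * P i + - (1) * d i + d i)%C by ring.
rewrite E0; ring.
Qed.

(** * Linear independence of square roots of primes *)

(** The field Q(sqrt p : p in l), built by adjoining one root at a time. *)
Fixpoint multiquad (l : list nat) (x : R) : Prop :=
  match l with
  | nil => rational x
  | p :: l' => exists a b, multiquad l' a /\ multiquad l' b /\
      x = a + b * sqrt (INR p)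
  end.

Lemma multiquad_rational (l : list nat) (x : R) :
  rational x -> multiquad l x.
Proof.
induction l as [|p l IH]; intros H; [exact H|].
exists x, 0; repeat split; [auto| |ring].
clear IH H; induction l as [|p' l IH]; [apply (rational_IZR 0)|].
exists 0, 0; repeat split; auto; ring.
Qed.

Lemma multiquad_plus (l : list nat) (x y : R) :
  multiquad l x -> multiquad l y -> multiquad l (x + y).
Proof.
revert x y; induction l as [|p l IH]; intros x y; [apply rational_plus|].
intros [a [b [Ha [Hb E]]]] [a' [b' [Ha' [Hb' E']]]].
exists (a + a'), (b + b'); repeat split; auto; subst; ring.
Qed.

Lemma multiquad_mult (l : list nat) (x y : R) :
  multiquad l x -> multiquad l y -> multiquad l (x * y).
Proof.
revert x y; induction l as [|p l IH]; intros x y; [apply rational_mult|].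
intros [a [b [Ha [Hb E]]]] [a' [b' [Ha' [Hb' E']]]].
assert (Es : sqrt (INR p) * sqrt (INR p) = INR p) by (apply sqrt_sqrt, pos_INR).
exists (a * a' + b * b' * INR p), (a * b' + a' * b); repeat split.
- apply multiquad_plus; auto.
  apply IH; auto; apply multiquad_rational, rational_INR.
- apply multiquad_plus; auto.
- subst; transitivity (a * a' + b * b' * (sqrt (INR p) * sqrt (INR p)) +
    (a * b' + a' * b) * sqrt (INR p)); [ring|rewrite Es; reflexivity].
Qed.

Lemma multiquad_opp (l : list nat) (x : R) :
  multiquad l x -> multiquad l (- x).
Proof.
intros H; replace (- x) with (-1 * x) by ring.
apply multiquad_mult; [apply multiquad_rational, rational_IZR|exact H].
Qed.

Lemma multiquad_cons (p : nat) (l : list nat) (x : R) :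
  multiquad l x -> multiquad (p :: l) x.
Proof.
intros H; exists x, 0; repeat split; [exact H| |ring].
apply multiquad_rational, (rational_IZR 0).
Qed.

Lemma multiquad_inv (l : list nat) (x : R) :
  multiquad l x -> multiquad l (/ x).
Proof.
revert x; induction l as [|p l IH]; intros x; [apply rational_inv|].
intros [a [b [Ha [Hb E]]]].
set (s := sqrt (INR p)) in *.
assert (Es : s * s = INR p) by (apply sqrt_sqrt, pos_INR).
assert (Hr : forall y, rational y -> multiquad l y) by (apply multiquad_rational).
destruct (Req_dec (a * a - b * b * INR p) 0) as [E0|E0].
(* The norm can vanish when the root already lies in the smaller field; then x = 0 or x = 2a, which
   is inverted there. Otherwise the conjugate over the norm is the inverse. *)
- assert (Hf : (a + b * s) * (a - b * s) = 0) by (rewrite <- E0, <- Es; ring).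
  apply Rmult_integral in Hf; destruct Hf as [Hf|Hf].
  + replace x with 0 by lra; rewrite Rinv_0.
    apply multiquad_rational, (rational_IZR 0).
  + replace x with (2 * a) by lra; apply multiquad_cons, IH.
    apply multiquad_mult; [apply Hr, (rational_IZR 2)|exact Ha].
- set (d := a * a - b * b * INR p) in *.
  assert (Hd : multiquad l (/ d)).
  { apply IH; unfold d, Rminus; apply multiquad_plus.
    - apply multiquad_mult; assumption.
    - apply multiquad_opp, multiquad_mult; [apply multiquad_mult; assumption|].
      apply Hr, rational_INR. }
  exists (a * / d), (- b * / d); repeat split.
  + apply multiquad_mult; assumption.
  + apply multiquad_mult; [apply multiquad_opp|]; assumption.
  + assert (Hp : x * (a - b * s) = d) by (subst x; unfold d; rewrite <- Es; ring).
    assert (Hx : x <> 0) by (intros Ex; rewrite Ex in Hp; lra).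
    apply Rmult_eq_reg_l with x; [|exact Hx].
    rewrite Rinv_r by exact Hx.
    fold s; transitivity (x * (a - b * s) * / d); [|ring].
    rewrite Hp; symmetry; apply Rinv_r, E0.
Qed.

Lemma multiquad_sqrt (l : list nat) (p : nat) :
  In p l -> multiquad l (sqrt (INR p)).
Proof.
induction l as [|p' l IH]; intros H; [destruct H|].
destruct H as [->|H]; [|apply multiquad_cons, IH, H].
exists 0, 1; repeat split; try ring; apply multiquad_rational, rational_IZR.
Qed.

(** Infinite descent on |b| in a^2 = p m b^2: p divides a, and then b since it does not divide m. *)
Lemma sqrt_irrational (p m : nat) :
  nprime p -> ~ Nat.divide p m -> ~ rational (sqrt (INR (p * m))).
Proof.
intros Hp Hm [a [b [Hb E]]].
assert (Es : (a * a = Z.of_nat (p * m) * (b * b))%Z).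
{ apply eq_IZR; rewrite !mult_IZR, <- INR_IZR_INZ.
  rewrite <- (sqrt_sqrt (INR (p * m))) by apply pos_INR.
  rewrite E; field; apply not_0_IZR, Hb. }
assert (Hpm : ~ (Z.of_nat p | Z.of_nat m)%Z).
{ intros [x Hx]; apply Hm; exists (Z.to_nat x).
  pose proof (nprime_ge_2 p Hp); assert (0 <= x)%Z by nia.
  apply Nat2Z.inj; rewrite Nat2Z.inj_mul, Z2Nat.id by lia; exact Hx. }
rewrite Nat2Z.inj_mul in Es.
assert (Hdesc : forall N a b : Z, (0 <= N)%Z -> (Z.abs b <= N)%Z -> b <> 0%Z ->
   (a * a <> Z.of_nat p * Z.of_nat m * (b * b))%Z).
{ clear a b Hb E Es; intros N a b HN; revert a b; pattern N; apply natlike_ind; [| |exact HN].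
  - intros a b H1 H2; lia.
  - intros x Hx IH a b Hbx Hb E.
    pose proof (nprime_ge_2 p Hp).
    assert (Ha : (Z.of_nat p | a)%Z).
    { assert (H1 : (Z.of_nat p | a * a)%Z) by (exists (Z.of_nat m * (b * b))%Z; lia).
      destruct (prime_mult _ Hp _ _ H1); assumption. }
    destruct Ha as [a' Ea].
    assert (E' : (Z.of_nat m * (b * b) = Z.of_nat p * (a' * a'))%Z) by nia.
    assert (Hb' : (Z.of_nat p | b)%Z).
    { assert (H1 : (Z.of_nat p | Z.of_nat m * (b * b))%Z) by (exists (a' * a')%Z; lia).
      destruct (prime_mult _ Hp _ _ H1) as [H2|H2]; [contradiction|].
      destruct (prime_mult _ Hp _ _ H2); assumption. }
    destruct Hb' as [b' Eb].
    apply (IH a' b'); [nia|nia|].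
    subst; nia. }
apply (Hdesc (Z.abs b) a b); lia.
Qed.

Definition nprod (T : list nat) : nat := fold_right Nat.mul 1%nat T.

Lemma nprime_divides_nprod (p : nat) (T : list nat) :
  nprime p -> (forall r, In r T -> nprime r) -> Nat.divide p (nprod T) -> In p T.
Proof.
intros Hp; induction T as [|r T IH]; intros HT Hd.
- simpl in Hd; apply Nat.divide_1_r in Hd; pose proof (nprime_ge_2 p Hp); lia.
- simpl in Hd; destruct Hd as [x Hx].
  assert (Hd : (Z.of_nat p | Z.of_nat r * Z.of_nat (nprod T))%Z)
    by (exists (Z.of_nat x); lia).
  destruct (prime_mult _ Hp _ _ Hd) as [[y Hy]|[y Hy]].
  + left; assert (Hd' : Nat.divide p r).
    { exists (Z.to_nat y); pose proof (nprime_ge_2 p Hp).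
      pose proof (nprime_ge_2 r (HT r (or_introl eq_refl))); nia. }
    pose proof (nprime_ge_2 p Hp).
    destruct (nprime_divides r p (HT r (or_introl eq_refl)) Hd'); lia.
  + right; apply IH; [intros; apply HT; right; assumption|].
    exists (Z.to_nat y); pose proof (nprime_ge_2 p Hp); nia.
Qed.

(** Products of primes make the induction close. Write sqrt T = a + b sqrt p: if b = 0, sqrt T lies
    in the smaller field; if a = 0, sqrt(pT) does; otherwise squaring puts sqrt p itself there. *)
Lemma sqrt_not_multiquad (l T : list nat) :
  NoDup (l ++ T) -> (forall r, In r (l ++ T) -> nprime r) -> T <> nil ->
  ~ multiquad l (sqrt (INR (nprod T))).
Proof.
revert T; induction l as [|p l IH]; intros T HN HP HT H.
- destruct T as [|r T]; [contradiction|].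
  inversion HN as [|? ? Hr HN']; subst.
  revert H; apply sqrt_irrational; [apply HP; left; reflexivity|].
  intros Hd; apply Hr, nprime_divides_nprod; [apply HP; left; reflexivity| |exact Hd].
  intros; apply HP; right; assumption.
- destruct H as [a [b [Ha [Hb E]]]].
  simpl in HN; inversion HN as [|? ? Hp HN']; subst.
  assert (HP' : forall r, In r (l ++ T) -> nprime r)
    by (intros; apply HP; right; assumption).
  assert (HNp : forall T', NoDup (l ++ T') -> ~ In p (l ++ T') -> NoDup (l ++ p :: T'))
    by (intros T' H1 H2; apply NoDup_Add with (a := p) (l := l ++ T'); [apply Add_app|split; assumption]).
  set (s := sqrt (INR p)) in *; set (t := sqrt (INR (nprod T))) in *.
  assert (Es : s * s = INR p) by (apply sqrt_sqrt, pos_INR).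
  assert (Et : t * t = INR (nprod T)) by (apply sqrt_sqrt, pos_INR).
  destruct (Req_dec b 0) as [Eb|Eb].
  { apply (IH T HN' HP' HT); fold t; replace t with a; [exact Ha|rewrite E, Eb; ring]. }
  destruct (Req_dec a 0) as [Ea|Ea].
  { apply (IH (p :: T)).
    - apply HNp; assumption.
    - intros r Hr; apply HP; apply in_app_or in Hr; simpl in *.
      destruct Hr as [Hr|[Hr|Hr]]; auto; right; apply in_or_app; auto.
    - discriminate.
    - change (nprod (p :: T)) with (p * nprod T)%nat.
      rewrite mult_INR, sqrt_mult by apply pos_INR; fold s t.
      rewrite E, Ea.
      replace (s * (0 + b * s)) with (b * (s * s)) by ring; rewrite Es.
      apply multiquad_mult; [exact Hb|apply multiquad_rational, rational_INR]. }
  apply (IH (p :: nil)).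
  + apply HNp; rewrite app_nil_r.
    * apply NoDup_app_remove_r in HN'; exact HN'.
    * intros Hi; apply Hp, in_or_app; left; exact Hi.
  + intros r Hr; apply in_app_or in Hr; destruct Hr as [Hr|[Hr|[]]].
    * apply HP'; apply in_or_app; left; exact Hr.
    * subst; apply HP; left; reflexivity.
  + discriminate.
  + change (nprod (p :: nil)) with (p * 1)%nat; rewrite Nat.mul_1_r; fold s.
    replace s with ((INR (nprod T) + - (a * a + b * b * INR p)) * / (2 * a * b)).
    * apply multiquad_mult.
      -- apply multiquad_plus; [apply multiquad_rational, rational_INR|].
         apply multiquad_opp, multiquad_plus; apply multiquad_mult; auto.
         ++ apply multiquad_mult; auto.
         ++ apply multiquad_rational, rational_INR.
      -- apply multiquad_inv, multiquad_mult; auto.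
         apply multiquad_mult; auto.
         apply multiquad_rational, (rational_IZR 2).
    * rewrite <- Et, E, <- Es; field; auto.
Qed.

(** A nonzero last coefficient would express the last root in the field generated by the others. *)
Lemma sqrt_primes_independent (pr : nat -> nat) (c : nat -> R) (n : nat) :
  (forall i, (i < n)%nat -> nprime (pr i)) ->
  (forall i j, (i < n)%nat -> (j < n)%nat -> pr i = pr j -> i = j) ->
  (forall i, rational (c i)) ->
  rsum (fun i => c i * sqrt (INR (pr i))) n = 0 ->
  forall i, (i < n)%nat -> c i = 0.
Proof.
induction n as [|n IH]; intros HP Hinj Hc E i Hi; [lia|].
simpl in E.
assert (Hn : c n = 0).
{ apply NNPP; intros Hcn.
  set (l := map pr (seq 0 n)).
  assert (El : l ++ pr n :: nil = map pr (seq 0 (S n)))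
    by (unfold l; rewrite seq_S, map_app; reflexivity).
  apply (sqrt_not_multiquad l (pr n :: nil)).
  - rewrite El; apply NoDup_map_NoDup_ForallPairs; [|apply seq_NoDup].
    intros x y Hx Hy; apply in_seq in Hx, Hy; apply Hinj; lia.
  - rewrite El; intros r Hr; apply in_map_iff in Hr; destruct Hr as [x [<- Hx]].
    apply in_seq in Hx; apply HP; lia.
  - discriminate.
  - change (nprod (pr n :: nil)) with (pr n * 1)%nat; rewrite Nat.mul_1_r.
    replace (sqrt (INR (pr n))) with
      (- rsum (fun i => c i * sqrt (INR (pr i))) n * / c n).
    + apply multiquad_mult; [apply multiquad_opp|].
      * assert (Hs : forall m, (m <= n)%nat ->
          multiquad l (rsum (fun i => c i * sqrt (INR (pr i))) m)).
        { induction m as [|m IHm]; intros Hm; simpl.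
          - apply multiquad_rational, (rational_IZR 0).
          - apply multiquad_plus; [apply IHm; lia|].
            apply multiquad_mult; [apply multiquad_rational, Hc|].
            apply multiquad_sqrt, in_map, in_seq; lia. }
        apply Hs; lia.
      * apply multiquad_rational, rational_inv, Hc.
    + apply Rmult_eq_reg_r with (c n); [|exact Hcn].
      rewrite Rmult_assoc, Rinv_l by exact Hcn; lra. }
destruct (Nat.eq_dec i n) as [->|Hne]; [exact Hn|].
apply IH; try lia.
- intros; apply HP; lia.
- intros; apply Hinj; try lia; assumption.
- exact Hc.
- rewrite Hn in E; lra.
Qed.

(** * Rational linear dependence *)

Definition skip (i0 i : nat) : nat := if (i <? i0)%nat then i else S i.

Lemma rsum_skip (u : nat -> R) (i0 n : nat) :
  (i0 <= n)%nat -> rsum u (S n) = u i0 + rsum (fun i => u (skip i0 i)) n.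
Proof.
induction n as [|n IH]; intros Hi.
- replace i0 with O by lia; simpl; ring.
- change (rsum u (S (S n))) with (rsum u (S n) + u (S n)).
  destruct (Nat.eq_dec i0 (S n)) as [->|Hne].
  + rewrite (rsum_ext (fun i => u (skip (S n) i)) u (S n)).
    * ring.
    * intros i Hi'; unfold skip; rewrite (proj2 (Nat.ltb_lt i (S n))) by exact Hi'; reflexivity.
  + rewrite IH by lia.
    change (rsum (fun i => u (skip i0 i)) (S n)) with
      (rsum (fun i => u (skip i0 i)) n + u (skip i0 n)).
    unfold skip at 3; rewrite (proj2 (Nat.ltb_ge n i0)) by lia; ring.
Qed.

(** Gaussian elimination on D+1 rows and D columns: clear the last column with a pivot row i0, take
    a dependence of the remaining rows, and let [t] restore the coefficient of the pivot row. If the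
    last column is zero, the last row gets coefficient 0. *)
Lemma rational_dependence (D : nat) (m : nat -> nat -> R) :
  (forall i j, rational (m i j)) ->
  exists c : nat -> R, (forall i, rational (c i)) /\
    (exists i, (i <= D)%nat /\ c i <> 0) /\
    forall j, (j < D)%nat -> rsum (fun i => c i * m i j) (S D) = 0.
Proof.
revert m; induction D as [|D IH]; intros m Hm.
- exists (fun _ => 1); split; [intros; apply rational_IZR|split].
  + exists O; split; [lia|lra].
  + intros j Hj; lia.
- destruct (classic (exists i0, (i0 <= S D)%nat /\ m i0 D <> 0)) as [[i0 [Hi0 Hp]]|Hall].
  + pose (m' := fun i j => m (skip i0 i) j + - (m (skip i0 i) D * / m i0 D * m i0 j)).
    destruct (IH m') as [c' [Hc' [[i1 [Hi1 Hne]] Hz]]].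
    { intros i j; apply rational_plus; [apply Hm|].
      apply rational_opp, rational_mult; [apply rational_mult|apply Hm].
      - apply Hm.
      - apply rational_inv, Hm. }
    set (t := rsum (fun i => c' i * (m (skip i0 i) D * / m i0 D)) (S D)).
    pose (c := fun i => if (i <? i0)%nat then c' i else
       if (i =? i0)%nat then - t else c' (i - 1)%nat).
    assert (Ei0 : c i0 = - t).
    { unfold c; rewrite Nat.ltb_irrefl, Nat.eqb_refl; reflexivity. }
    assert (Esk : forall i, c (skip i0 i) = c' i).
    { intros i; unfold c, skip; destruct (Nat.ltb_spec i i0) as [H|H].
      - rewrite (proj2 (Nat.ltb_lt i i0)) by exact H; reflexivity.
      - rewrite (proj2 (Nat.ltb_ge (S i) i0)) by lia.
        rewrite (proj2 (Nat.eqb_neq (S i) i0)) by lia; f_equal; lia. }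
    exists c; split; [|split].
    * intros i; unfold c; destruct (i <? i0)%nat; [apply Hc'|].
      destruct (i =? i0)%nat; [|apply Hc'].
      apply rational_opp, rational_rsum; intros j _.
      repeat apply rational_mult; try apply Hc'; try apply Hm; apply rational_inv, Hm.
    * exists (skip i0 i1); split; [unfold skip; destruct (i1 <? i0)%nat; lia|].
      rewrite Esk; exact Hne.
    * intros j Hj; rewrite (rsum_skip _ i0) by exact Hi0; rewrite Ei0.
      rewrite (rsum_ext _ (fun i => c' i * m' i j +
         m i0 j * (c' i * (m (skip i0 i) D * / m i0 D))))
        by (intros i _; rewrite Esk; unfold m'; ring).
      rewrite rsum_plus, rsum_scal; fold t.
      assert (E : rsum (fun i => c' i * m' i j) (S D) = 0).
      { destruct (Nat.eq_dec j D) as [->|Hne']; [|apply Hz; lia].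
        rewrite (rsum_ext _ (fun _ => 0)).
        - rewrite rsum_const; ring.
        - intros i _; unfold m'; field; exact Hp. }
      rewrite E; ring.
  + assert (H0 : forall i, (i <= S D)%nat -> m i D = 0).
    { intros i Hi; apply NNPP; intros H; apply Hall; exists i; split; assumption. }
    destruct (IH m Hm) as [c [Hc [[i1 [Hi1 Hne]] Hz]]].
    exists (fun i => if (i <=? D)%nat then c i else 0); split; [|split].
    * intros i; destruct (i <=? D)%nat; [apply Hc|apply (rational_IZR 0)].
    * exists i1; split; [lia|]; rewrite (proj2 (Nat.leb_le i1 D)) by exact Hi1; exact Hne.
    * intros j Hj.
      destruct (Nat.eq_dec j D) as [->|Hne'].
      -- rewrite (rsum_ext _ (fun _ => 0)); [rewrite rsum_const; ring|].
         intros i Hi; rewrite H0 by lia; ring.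
      -- change (rsum ?u (S (S D))) with (rsum u (S D) + u (S D)); cbv beta.
         rewrite (proj2 (Nat.leb_gt (S D) D)) by lia.
         rewrite (rsum_ext _ (fun i => c i * m i j)).
         ++ rewrite Hz by lia; ring.
         ++ intros i Hi; rewrite (proj2 (Nat.leb_le i D)) by lia; reflexivity.
Qed.

Lemma Qspan_dependence (P E : nat -> C) (D : nat) :
  (forall i, (i <= D)%nat -> Qspan P D (E i)) ->
  exists c : nat -> R, (forall i, rational (c i)) /\
    (exists i, (i <= D)%nat /\ c i <> 0) /\
    csum (fun i => c i * E i)%C (S D) = 0%C.
Proof.
intros H.
pose (m := fun i => epsilon (inhabits (fun _ : nat => 0)) (fun r : nat -> R =>
  (forall j, rational (r j)) /\ ((i <= D)%nat -> E i = csum (fun j => r j * P j)%C D))).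
assert (Hm : forall i, (forall j, rational (m i j)) /\
   ((i <= D)%nat -> E i = csum (fun j => m i j * P j)%C D)).
{ intros i; unfold m; apply epsilon_spec.
  destruct (le_lt_dec i D) as [Hi|Hi].
  - destruct (H i Hi) as [r [Hr Er]]; exists r; auto.
  - exists (fun _ => 0); split; [intros; apply (rational_IZR 0)|lia]. }
destruct (rational_dependence D m (fun i => proj1 (Hm i))) as [c [Hc [Hne Hz]]].
exists c; split; [exact Hc|split; [exact Hne|]].
rewrite (csum_ext _ (fun i => csum (fun j => RtoC (c i * m i j) * P j)%C D)).
- rewrite csum_exchange.
  rewrite (csum_ext _ (fun _ => 0%C)); [apply csum_zero|].
  intros j Hj.
  rewrite (csum_ext _ (fun i => P j * RtoC (c i * m i j))%C) by (intros; ring).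
  rewrite csum_scal, csum_RtoC, Hz by exact Hj; ring.
- intros i Hi; rewrite (proj2 (Hm i)) by lia; rewrite <- csum_scal.
  apply csum_ext; intros j _; rewrite RtoC_mult; ring.
Qed.

(* The D+1 vectors c sqrt(p_i) P(i0) would be linearly independent in a Q-space
   of dimension at most D. *)
Lemma stable_sqrt_primes_bounded (P : nat -> C) (D i0 : nat) (c : R) (pr : nat -> nat) :
  (i0 < D)%nat -> P i0 <> 0%C -> c <> 0 ->
  (forall i, (i <= D)%nat -> nprime (pr i)) ->
  (forall i j, (i <= D)%nat -> (j <= D)%nat -> pr i = pr j -> i = j) ->
  ~ (forall i w, (i <= D)%nat -> Qspan P D w -> Qspan P D (RtoC (sqrt (INR (pr i)) * c) * w)).
Proof.
intros Hi0 HP Hc Hpr Hinj H.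
destruct (Qspan_dependence P (fun i => RtoC (sqrt (INR (pr i)) * c) * P i0)%C D)
  as [r [Hr [[i1 [Hi1 Hne]] Hz]]].
{ intros i Hi; apply H; [exact Hi|apply Qspan_gen, Hi0]. }
apply Hne, (sqrt_primes_independent pr r (S D)).
- intros i Hi; apply Hpr; lia.
- intros i j Hi Hj; apply Hinj; lia.
- exact Hr.
- rewrite (csum_ext _ (fun i => (c * P i0) * RtoC (r i * sqrt (INR (pr i))))%C) in Hz
    by (intros i _; rewrite !RtoC_mult; ring).
  rewrite csum_scal, csum_RtoC in Hz.
  apply NNPP; intros E; apply RtoC_inj_neq in E, Hc.
  revert Hz; repeat apply Cmult_neq_0; assumption.
- lia.
Qed.

(** * Hecke multiplicative sequences *)

Definition hecke_seq (A : nat -> R) : Prop :=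
  A 1%nat = 1 /\ forall p m, nprime p -> (1 <= m)%nat ->
  A p * A m = A (p * m)%nat + (if (m mod p =? 0)%nat then A (m / p)%nat else 0).

(** Phrased by prime divisors, so that products reduce to [nprime_mult] and a common prime can be
    chased through sums. *)
Definition cop (a b : nat) : Prop :=
  forall p, nprime p -> Nat.divide p a -> Nat.divide p b -> False.

Lemma nprime_mult (p a b : nat) :
  nprime p -> Nat.divide p (a * b) -> Nat.divide p a \/ Nat.divide p b.
Proof.
intros Hp [x Hx]; pose proof (nprime_ge_2 p Hp).
assert (Hd : (Z.of_nat p | Z.of_nat a * Z.of_nat b)%Z) by (exists (Z.of_nat x); lia).
destruct (prime_mult _ Hp _ _ Hd) as [[y Hy]|[y Hy]]; [left|right];
  exists (Z.to_nat y); nia.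
Qed.

Lemma cop_sym (a b : nat) : cop a b -> cop b a.
Proof. intros H p Hp H1 H2; exact (H p Hp H2 H1). Qed.

Lemma cop_mult_l (a b c : nat) : cop a c -> cop b c -> cop (a * b) c.
Proof.
intros H1 H2 p Hp Hab Hc; destruct (nprime_mult p a b Hp Hab); [apply (H1 p)|apply (H2 p)]; auto.
Qed.

Lemma cop_mult_r (a b c : nat) : cop a b -> cop a c -> cop a (b * c).
Proof. intros H1 H2; apply cop_sym, cop_mult_l; apply cop_sym; assumption. Qed.

Lemma cop_factor_l (a b c : nat) : cop (a * b) c -> cop a c /\ cop b c.
Proof.
intros H; split; intros p Hp H1 H2; apply (H p Hp); auto.
- apply Nat.divide_mul_l, H1.
- apply Nat.divide_mul_r, H1.
Qed.

Lemma nprime_pow_divide (p r e : nat) :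
  nprime p -> nprime r -> Nat.divide r (p ^ e) -> r = p.
Proof.
intros Hp Hr; induction e as [|e IH]; intros H.
- apply Nat.divide_1_r in H; pose proof (nprime_ge_2 r Hr); lia.
- simpl in H; destruct (nprime_mult r _ _ Hr H) as [H1|H1]; [|auto].
  pose proof (nprime_ge_2 r Hr); destruct (nprime_divides p r Hp H1); lia.
Qed.

Lemma cop_pow_l (p e m : nat) : nprime p -> ~ Nat.divide p m -> cop (p ^ e) m.
Proof.
intros Hp Hm r Hr H1 H2; apply Hm.
rewrite <- (nprime_pow_divide p r e Hp Hr H1); exact H2.
Qed.

Lemma prime_factor_exists (n : nat) :
  (2 <= n)%nat -> exists p, nprime p /\ Nat.divide p n.
Proof.
induction n as [n IH] using lt_wf_ind; intros Hn.
destruct (prime_dec (Z.of_nat n)) as [Hp|Hp].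
- exists n; split; [exact Hp|apply Nat.divide_refl].
- destruct (not_prime_divide (Z.of_nat n) ltac:(lia) Hp) as [x [Hx [y Hy]]].
  destruct (IH (Z.to_nat x)) as [p [Hp' [w Hw]]]; [lia|lia|].
  exists p; split; [exact Hp'|]; exists (w * Z.to_nat y)%nat; nia.
Qed.

(** Strip a prime p from m = p m': the Hecke relation at (p, m'n) is A(n) times the one at (p, m'),
    since p does not divide n and smaller cases are known. *)
Lemma hecke_seq_mult (A : nat -> R) (m n : nat) :
  hecke_seq A -> (1 <= m)%nat -> (1 <= n)%nat -> cop m n -> A (m * n)%nat = A m * A n.
Proof.
intros [H1 HA]; revert n; induction m as [m IH] using lt_wf_ind; intros n Hm Hn Hc.
destruct (Nat.eq_dec m 1) as [->|Hm1]; [rewrite Nat.mul_1_l, H1; ring|].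
destruct (prime_factor_exists m) as [p [Hp [m' Em]]]; [lia|].
pose proof (nprime_ge_2 p Hp) as Hp2.
assert (Hpn : ~ Nat.divide p n).
{ intros Hd; apply (Hc p Hp); [exists m'; exact Em|exact Hd]. }
assert (Hm' : (1 <= m')%nat) by (destruct m'; lia).
subst m; destruct (cop_factor_l _ _ _ Hc) as [Hcm _].
pose proof (HA p (m' * n)%nat Hp ltac:(nia)) as E1.
pose proof (HA p m' Hp Hm') as E2.
rewrite (IH m' ltac:(nia) n Hm' Hn Hcm) in E1.
replace (m' * p * n)%nat with (p * (m' * n))%nat by lia.
replace (m' * p)%nat with (p * m')%nat by lia.
destruct (Nat.eqb_spec (m' mod p) 0) as [E|E].
- apply Nat.Lcm0.mod_divide in E; destruct E as [m'' ->].
  rewrite Nat.div_mul in E2 by lia.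
  assert (Er : (m'' * p * n = m'' * n * p)%nat) by lia; rewrite Er in *.
  rewrite Nat.Div0.mod_mul, Nat.div_mul in E1 by lia; cbn [Nat.eqb] in E1.
  rewrite (IH m'' ltac:(nia) n ltac:(destruct m''; lia) Hn) in E1.
  + nra.
  + apply cop_factor_l in Hcm; tauto.
- destruct (Nat.eqb_spec ((m' * n) mod p) 0) as [E'|E'].
  + exfalso; apply Nat.Lcm0.mod_divide in E'.
    destruct (nprime_mult _ _ _ Hp E') as [H|H]; [|contradiction].
    apply E, Nat.Lcm0.mod_divide, H.
  + nra.
Qed.

Lemma hecke_seq_pow (A : nat -> R) (p e : nat) :
  hecke_seq A -> nprime p -> A (p ^ S (S e))%nat = A p * A (p ^ S e)%nat - A (p ^ e)%nat.
Proof.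
intros [H1 HA] Hp; pose proof (nprime_ge_2 p Hp).
assert (Hpe : (1 <= p ^ e)%nat) by (pose proof (Nat.pow_nonzero p e); lia).
rewrite (HA p (p ^ S e)%nat Hp) by (simpl; nia).
replace (p ^ S e)%nat with (p ^ e * p)%nat by (simpl; lia).
rewrite Nat.Div0.mod_mul, Nat.div_mul by lia; simpl Nat.eqb; cbv iota.
replace (p ^ S (S e))%nat with (p * (p ^ e * p))%nat by (simpl; lia); ring.
Qed.

(** A(p^e) is the Chebyshev polynomial U_e at A(p)/2, and this is its addition formula; the
    induction carries two consecutive values of i. *)
Lemma hecke_seq_pow_add (A : nat -> R) (p i j : nat) :
  hecke_seq A -> nprime p ->
  A (p ^ S (S (i + j)))%nat = A (p ^ S i)%nat * A (p ^ S j)%nat - A (p ^ i)%nat * A (p ^ j)%nat.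
Proof.
intros HA Hp.
assert (H : forall i, (forall j, A (p ^ S (S (i + j)))%nat =
    A (p ^ S i)%nat * A (p ^ S j)%nat - A (p ^ i)%nat * A (p ^ j)%nat) /\
  (forall j, A (p ^ S (S (S i + j)))%nat =
    A (p ^ S (S i))%nat * A (p ^ S j)%nat - A (p ^ S i)%nat * A (p ^ j)%nat)).
{ clear i j; assert (E0 : A (p ^ 0)%nat = 1) by apply HA.
  assert (E1 : A (p ^ 1)%nat = A p) by (f_equal; apply Nat.pow_1_r).
  induction i as [|i [IH1 IH2]].
  - split; intros j.
    + change (S (S (0 + j))) with (S (S j)).
      rewrite (hecke_seq_pow A p j HA Hp), E0, E1; ring.
    + change (S (S (1 + j))) with (S (S (S j))).
      rewrite (hecke_seq_pow A p (S j) HA Hp), (hecke_seq_pow A p j HA Hp).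
      rewrite (hecke_seq_pow A p 0 HA Hp), E0, E1; ring.
  - split; [exact IH2|]; intros j.
    change (S (S (S (S i) + j)))%nat with (S (S (S (S (i + j))))).
    rewrite (hecke_seq_pow A p (S (S (i + j))) HA Hp).
    rewrite (hecke_seq_pow A p (S i) HA Hp).
    specialize (IH1 j); specialize (IH2 j).
    change (S (S (S i + j)))%nat with (S (S (S (i + j)))) in IH2.
    rewrite IH1, IH2, (hecke_seq_pow A p i HA Hp); ring. }
apply H.
Qed.

Lemma hecke_seq_pow_double (A : nat -> R) (p e : nat) :
  hecke_seq A -> nprime p ->
  A (p ^ (2 * S e))%nat = A (p ^ S e)%nat ^ 2 - A (p ^ e)%nat ^ 2.
Proof.
intros HA Hp; replace (2 * S e)%nat with (S (S (e + e))) by lia.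
rewrite hecke_seq_pow_add by assumption; ring.
Qed.

(** Two consecutive zeros would propagate down the recurrence to A(1) = 1. *)
Lemma hecke_seq_consecutive (A : nat -> R) (p e : nat) :
  hecke_seq A -> nprime p -> A (p ^ e)%nat <> 0 \/ A (p ^ S e)%nat <> 0.
Proof.
intros HA Hp; induction e as [|e IH].
- left; simpl; rewrite (proj1 HA); lra.
- apply NNPP; intros H; apply not_or_and in H; destruct H as [Ha Hb].
  apply NNPP in Ha, Hb.
  rewrite (hecke_seq_pow A p e HA Hp), Ha in Hb.
  destruct IH as [IH|IH]; [apply IH; lra|contradiction].
Qed.

Lemma prime_power_split (p n : nat) :
  nprime p -> (1 <= n)%nat ->
  exists e m, n = (p ^ e * m)%nat /\ (1 <= m)%nat /\ ~ Nat.divide p m.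
Proof.
intros Hp; pose proof (nprime_ge_2 p Hp).
induction n as [n IH] using lt_wf_ind; intros Hn.
destruct (classic (Nat.divide p n)) as [[x Hx]|Hd].
- destruct (IH x) as [e [m [E [Hm Hm']]]]; [nia|nia|].
  exists (S e), m; repeat split; auto; subst; simpl; lia.
- exists O, n; repeat split; auto; simpl; lia.
Qed.

Lemma multiplicative_induction (H : nat -> Prop) :
  H 1%nat ->
  (forall p e m, nprime p -> (1 <= m)%nat -> ~ Nat.divide p m -> H m ->
     H (p ^ S e * m)%nat) ->
  forall n, (1 <= n)%nat -> H n.
Proof.
intros H1 Hs; induction n as [n IH] using lt_wf_ind; intros Hn.
destruct (Nat.eq_dec n 1) as [->|Hn1]; [exact H1|].
destruct (prime_factor_exists n) as [p [Hp Hd]]; [lia|].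
pose proof (nprime_ge_2 p Hp).
destruct (prime_power_split p n Hp Hn) as [e [m [E [Hm Hm']]]].
destruct e as [|e].
- exfalso; apply Hm'; replace m with n by (simpl in E; lia); exact Hd.
- rewrite E; apply Hs; auto; apply IH; [|exact Hm].
  assert (1 <= p ^ e)%nat by (pose proof (Nat.pow_nonzero p e); lia).
  assert (2 * 1 <= p * p ^ e)%nat by (apply Nat.mul_le_mono; lia).
  rewrite E; cbn [Nat.pow]; nia.
Qed.

(** * Primes with a vanishing even power *)

Definition bad (A : nat -> R) (p : nat) : Prop :=
  nprime p /\ exists e, A (p ^ (2 * e))%nat = 0.

(** The real multiplier ring of the Q-span; it stands in for the ring generated by the Hecke
    eigenvalues. *)
Definition stab (P : nat -> C) (D : nat) (x : R) : Prop :=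
  forall w, Qspan P D w -> Qspan P D (RtoC x * w).

Lemma stab_mult (P : nat -> C) (D : nat) (x y : R) :
  stab P D x -> stab P D y -> stab P D (x * y).
Proof.
intros Hx Hy w Hw; rewrite RtoC_mult, <- Cmult_assoc; apply Hx, Hy, Hw.
Qed.

Lemma stab_rational (P : nat -> C) (D : nat) (x : R) : rational x -> stab P D x.
Proof. intros Hx w Hw; apply Qspan_scal; assumption. Qed.

Lemma stab_plus (P : nat -> C) (D : nat) (x y : R) :
  stab P D x -> stab P D y -> stab P D (x + y).
Proof.
intros Hx Hy w Hw; rewrite RtoC_plus, Cmult_plus_distr_r.
apply Qspan_plus; [apply Hx|apply Hy]; exact Hw.
Qed.

Lemma stab_opp (P : nat -> C) (D : nat) (x : R) : stab P D x -> stab P D (- x).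
Proof.
intros H; replace (- x) with (-1 * x) by ring.
apply stab_mult; [apply stab_rational, rational_IZR|exact H].
Qed.

Lemma stab_of_generators (P : nat -> C) (D : nat) (x : R) :
  (forall i, (i < D)%nat -> Qspan P D (RtoC x * P i)) -> stab P D x.
Proof.
intros H w [r [Hr E]]; subst; rewrite <- csum_scal; apply Qspan_csum.
intros i Hi; replace (x * (r i * P i))%C with (r i * (x * P i))%C by ring.
apply Qspan_scal; auto.
Qed.

(* A(p^(2e+2)) = A(p^(e+1))^2 - A(p^e)^2 vanishes iff A(p^(e+1)) = +-A(p^e); after
   clearing p-powers this puts sqrt p into the fraction field of the Hecke ring. *)
Lemma bad_sqrt_stab (A : nat -> R) (P : nat -> C) (D l p : nat) :
  hecke_seq A -> bad A p -> stab P D (A p * (INR p ^ l * sqrt (INR p))) ->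
  exists u, u <> 0 /\ stab P D u /\ stab P D (sqrt (INR p) * u).
Proof.
intros HA [Hp [e He]] Ha; pose proof (nprime_ge_2 p Hp).
set (t := INR p ^ l * sqrt (INR p)) in *.
assert (Es : sqrt (INR p) * sqrt (INR p) = INR p) by (apply sqrt_sqrt, pos_INR).
assert (Hp0 : 0 < INR p) by (apply lt_0_INR; lia).
assert (Ht : 0 < t).
{ apply Rmult_lt_0_compat; [apply pow_lt, Hp0|apply sqrt_lt_R0, Hp0]. }
assert (Hr : forall m, rational (INR p ^ m)).
{ intros m; rewrite <- pow_INR; apply rational_INR. }
assert (HX : forall e, stab P D (A (p ^ e)%nat * t ^ e) /\ stab P D (A (p ^ S e)%nat * t ^ S e)).
{ clear e He; induction e as [|e [IH1 IH2]].
  - split.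
    + simpl; rewrite (proj1 HA), Rmult_1_r; apply stab_rational, (rational_IZR 1).
    + rewrite Nat.pow_1_r, pow_1; exact Ha.
  - split; [exact IH2|].
    rewrite (hecke_seq_pow A p e HA Hp).
    replace ((A p * A (p ^ S e)%nat - A (p ^ e)%nat) * t ^ S (S e)) with
      (A p * t * (A (p ^ S e)%nat * t ^ S e) + - (INR p ^ (2 * l + 1) * (A (p ^ e)%nat * t ^ e))).
    + apply stab_plus; [apply stab_mult; assumption|].
      apply stab_opp, stab_mult; [apply stab_rational, Hr|exact IH1].
    + replace (INR p ^ (2 * l + 1)) with (t * t).
      * simpl; ring.
      * unfold t; replace (2 * l + 1)%nat with (l + (l + 1))%nat by lia.
        rewrite !pow_add, pow_1.
        transitivity (INR p ^ l * INR p ^ l * (sqrt (INR p) * sqrt (INR p))); [ring|].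
        rewrite Es; ring. }
destruct e as [|e].
{ simpl in He; rewrite (proj1 HA) in He; lra. }
rewrite (hecke_seq_pow_double A p e HA Hp) in He.
assert (Hx0 : A (p ^ e)%nat <> 0).
{ intros E0; destruct (hecke_seq_consecutive A p e HA Hp) as [H1|H1]; [contradiction|].
  apply H1; rewrite E0 in He; nra. }
exists (INR p ^ l * (A (p ^ e)%nat * t ^ e)); split; [|split].
- repeat apply Rmult_integral_contrapositive_currified; auto; apply pow_nonzero; lra.
- apply stab_mult; [apply stab_rational, Hr|apply HX].
- assert (Hpm : A (p ^ S e)%nat = A (p ^ e)%nat \/ A (p ^ S e)%nat = - A (p ^ e)%nat).
  { assert (E : (A (p ^ S e)%nat - A (p ^ e)%nat) * (A (p ^ S e)%nat + A (p ^ e)%nat) = 0)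
      by lra.
    apply Rmult_integral in E; destruct E; [left|right]; lra. }
  replace (sqrt (INR p) * (INR p ^ l * (A (p ^ e)%nat * t ^ e))) with
    (A (p ^ e)%nat * t ^ S e) by (simpl; unfold t at 1; ring).
  destruct Hpm as [E|E].
  + rewrite <- E; apply HX.
  + replace (A (p ^ e)%nat) with (- A (p ^ S e)%nat) by lra.
    replace (- A (p ^ S e)%nat * t ^ S e) with (- (A (p ^ S e)%nat * t ^ S e)) by ring.
    apply stab_opp, HX.
Qed.

Lemma divide_nprod (x : nat) (L : list nat) : In x L -> Nat.divide x (nprod L).
Proof.
induction L as [|r L IH]; intros Hin; [destruct Hin|].
destruct Hin as [->|Hin]; simpl; [apply Nat.divide_mul_l, Nat.divide_refl|].
apply Nat.divide_mul_r, IH, Hin.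
Qed.

Lemma bounded_NoDup_finite (B : nat -> Prop) (D : nat) :
  (forall l, NoDup l -> (forall x, In x l -> B x) -> (length l <= D)%nat) ->
  exists l, (forall x, In x l -> B x) /\ forall x, B x -> In x l.
Proof.
intros H.
assert (Hm : forall m, (exists l, NoDup l /\ (forall x, In x l -> B x) /\ length l = m) \/
  exists l, (forall x, In x l -> B x) /\ forall x, B x -> In x l).
{ induction m as [|m IH].
  - left; exists nil; repeat split; [constructor|intros x []].
  - destruct IH as [[l [H1 [H2 H3]]]|IH]; [|right; exact IH].
    destruct (classic (exists x, B x /\ ~ In x l)) as [[x [Hx Hl]]|Hall].
    + left; exists (x :: l); repeat split.
      * constructor; assumption.
      * intros y [<-|Hy]; auto.
      * simpl; lia.
    + right; exists l; split; [exact H2|].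
      intros x Hx; apply NNPP; intros Hn; apply Hall; exists x; auto. }
destruct (Hm (S D)) as [[l [H1 [H2 H3]]]|Hl]; [|exact Hl].
specialize (H l H1 H2); lia.
Qed.

(** A finite list of bad primes has a common nonzero multiplier c, the product of their [u], with
    every c sqrt p stable; this bounds the list by D. Q is the product of all bad primes. *)
Lemma finitely_many_bad (A : nat -> R) (P : nat -> C) (D i0 l : nat) :
  hecke_seq A -> (i0 < D)%nat -> P i0 <> 0%C ->
  (forall p, nprime p -> stab P D (A p * (INR p ^ l * sqrt (INR p)))) ->
  exists Q, (1 <= Q)%nat /\
    forall p e, nprime p -> ~ Nat.divide p Q -> A (p ^ (2 * e))%nat <> 0.
Proof.
intros HA Hi0 HP Hst.
destruct (bounded_NoDup_finite (bad A) D) as [L [HL1 HL2]].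
{ intros L HN HL; apply Nat.nlt_ge; intros Hlen.
  assert (Hc : exists c, c <> 0 /\ stab P D c /\
     forall p, In p L -> stab P D (sqrt (INR p) * c)).
  { clear HN Hlen; induction L as [|p L IH].
    - exists 1; split; [lra|split; [apply stab_rational, (rational_IZR 1)|intros p []]].
    - destruct IH as [c [Hc [Hs Hl]]]; [intros; apply HL; right; assumption|].
      pose proof (HL p (or_introl eq_refl)) as Hb.
      destruct (bad_sqrt_stab A P D l p HA Hb (Hst p (proj1 Hb))) as [u [Hu [Hu1 Hu2]]].
      exists (u * c); split; [apply Rmult_integral_contrapositive_currified; assumption|].
      split; [apply stab_mult; assumption|].
      intros r [<-|Hr].
      + rewrite <- Rmult_assoc; apply stab_mult; assumption.
      + replace (sqrt (INR r) * (u * c)) with (u * (sqrt (INR r) * c)) by ring.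
        apply stab_mult; auto. }
  destruct Hc as [c [Hc [_ Hl]]].
  apply (stable_sqrt_primes_bounded P D i0 c (fun i => nth i L O) Hi0 HP Hc).
  - intros i Hi; apply HL, nth_In; lia.
  - intros i j Hi Hj E; apply (proj1 (NoDup_nth L O) HN); lia || exact E.
  - intros i w Hi Hw; apply Hl; [apply nth_In; lia|exact Hw]. }
exists (nprod L); split.
- assert (Hne : nprod L <> 0%nat); [|lia].
  clear HL2; induction L as [|p L IH]; [discriminate|].
  pose proof (nprime_ge_2 p (proj1 (HL1 p (or_introl eq_refl)))).
  simpl; assert (nprod L <> 0%nat) by (apply IH; intros; apply HL1; right; assumption); nia.
- intros p e Hp Hd E; apply Hd.
  apply divide_nprod, HL2; split; [exact Hp|exists e; exact E].
Qed.

Lemma square_nonvanishing (A : nat -> R) (Q m : nat) :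
  hecke_seq A -> (forall p e, nprime p -> ~ Nat.divide p Q -> A (p ^ (2 * e))%nat <> 0) ->
  (1 <= m)%nat -> cop m Q -> A (m * m)%nat <> 0.
Proof.
intros HA HQ Hm; revert m Hm.
apply (multiplicative_induction (fun m => cop m Q -> A (m * m)%nat <> 0)).
- intros _; simpl; rewrite (proj1 HA); lra.
- intros p e m Hp Hm Hpm IH Hc; destruct (cop_factor_l _ _ _ Hc) as [Hc1 Hc2].
  pose proof (nprime_ge_2 p Hp).
  replace (p ^ S e * m * (p ^ S e * m))%nat with (p ^ (2 * S e) * (m * m))%nat.
  + rewrite hecke_seq_mult; [|exact HA| | |].
    * apply Rmult_integral_contrapositive_currified; [|apply IH, Hc2].
      apply HQ; [exact Hp|]; intros Hd; apply (Hc1 p Hp); [|exact Hd].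
      simpl; apply Nat.divide_mul_l, Nat.divide_refl.
    * pose proof (Nat.pow_nonzero p (2 * S e)); lia.
    * nia.
    * apply cop_pow_l; [exact Hp|]; intros Hd.
      destruct (nprime_mult _ _ _ Hp Hd); contradiction.
  + replace (2 * S e)%nat with (S e + S e)%nat by lia; rewrite Nat.pow_add_r; ring.
Qed.

(** * A square with negative coefficient *)

Lemma archimed_nat (x : R) : exists n : nat, x < INR n.
Proof.
destruct (archimed x) as [H _]; exists (Z.to_nat (up x)).
destruct (Z_le_gt_dec 0 (up x)) as [Hz|Hz].
- rewrite INR_IZR_INZ, Z2Nat.id by exact Hz; lra.
- assert (IZR (up x) <= 0) by (apply IZR_le; lia).
  pose proof (pos_INR (Z.to_nat (up x))); lra.
Qed.

(** The differences d(e) drop by (2 - s) y(e+1) > 0 at each step. One negative difference drives y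
    below 0; if there is none, y >= 1 and the differences drop by at least 2 - s each time, so one
    becomes negative after all. *)
Lemma positive_recurrence_absurd (y : nat -> R) (s : R) :
  s < 2 -> y O = 1 -> (forall e, 0 < y e) ->
  (forall e, y (S (S e)) = s * y (S e) - y e) -> False.
Proof.
intros Hs H0 Hpos Hrec.
set (d := fun e => y (S e) - y e).
assert (Hd : forall e, d (S e) = d e - (2 - s) * y (S e))
  by (intros e; unfold d; rewrite Hrec; ring).
assert (Hdec : forall e j, d (e + j)%nat <= d e).
{ intros e; induction j as [|j IH]; [rewrite Nat.add_0_r; lra|].
  rewrite Nat.add_succ_r, Hd; pose proof (Hpos (S (e + j))); nra. }
destruct (classic (exists e, d e < 0)) as [[e He]|Hn].
- assert (Hy : forall j, y (e + j)%nat <= y e + INR j * d e).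
  { induction j as [|j IH]; [rewrite Nat.add_0_r; simpl; lra|].
    rewrite Nat.add_succ_r, S_INR; specialize (Hdec e j); unfold d in Hdec at 1; lra. }
  destruct (archimed_nat (y e / - d e)) as [j Hj].
  specialize (Hy j); pose proof (Hpos (e + j)%nat).
  apply Rlt_div_l in Hj; lra.
- assert (Hd0 : forall e, 0 <= d e)
    by (intros e; apply Rnot_lt_le; intros H; apply Hn; exists e; exact H).
  assert (Hy : forall e, 1 <= y e).
  { induction e as [|e IH]; [lra|]; specialize (Hd0 e); unfold d in Hd0; lra. }
  assert (Hde : forall e, d e <= d O - INR e * (2 - s)).
  { induction e as [|e IH]; [simpl; lra|].
    rewrite S_INR, Hd; specialize (Hy (S e)); nra. }
  destruct (archimed_nat (d O / (2 - s))) as [j Hj].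
  specialize (Hde j); specialize (Hd0 j).
  apply Rlt_div_l in Hj; lra.
Qed.

Lemma positive_even_powers_ge_2 (A : nat -> R) (p : nat) :
  hecke_seq A -> nprime p -> (forall e, 0 < A (p ^ (2 * e))%nat) -> 2 <= Rabs (A p).
Proof.
intros HA Hp Hpos; apply Rnot_lt_le; intros Hlt.
(* The even-indexed terms of the recurrence with trace A(p) satisfy one with trace A(p)^2 - 2, which
   is below 2 when |A(p)| < 2. *)
apply (positive_recurrence_absurd (fun e => A (p ^ (2 * e))%nat) (A p ^ 2 - 2)).
- rewrite <- pow2_abs; pose proof (Rabs_pos (A p)); nra.
- apply HA.
- exact Hpos.
- intros e.
  pose proof (hecke_seq_pow A p (2 * e) HA Hp) as E1.
  pose proof (hecke_seq_pow A p (S (2 * e)) HA Hp) as E2.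
  pose proof (hecke_seq_pow A p (S (S (2 * e))) HA Hp) as E3.
  replace (2 * S (S e))%nat with (S (S (S (S (2 * e))))) by lia.
  replace (2 * S e)%nat with (S (S (2 * e))) by lia.
  rewrite E3, E2; nra.
Qed.

Lemma powers_growth (A : nat -> R) (p e : nat) :
  hecke_seq A -> nprime p -> 2 <= Rabs (A p) -> INR (S e) <= Rabs (A (p ^ e)%nat).
Proof.
intros HA Hp H2.
assert (H : INR (S e) <= Rabs (A (p ^ e)%nat) /\
  Rabs (A (p ^ e)%nat) + 1 <= Rabs (A (p ^ S e)%nat)).
{ induction e as [|e [IH1 IH2]].
  - replace (p ^ 0)%nat with 1%nat by reflexivity; rewrite Nat.pow_1_r.
    rewrite (proj1 HA), Rabs_R1; simpl; lra.
  - split; [rewrite S_INR; lra|].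
    rewrite (hecke_seq_pow A p e HA Hp).
    pose proof (Rabs_triang_inv (A p * A (p ^ S e)%nat) (A (p ^ e)%nat)) as H.
    rewrite Rabs_mult in H.
    pose proof (Rabs_pos (A (p ^ S e)%nat)); nra. }
apply H.
Qed.

(** * Divisor counts against the mean square *)

Lemma in_divisors (d m : nat) : (1 <= m)%nat -> In d (divisors m) <-> Nat.divide d m.
Proof.
intros Hm; unfold divisors; rewrite filter_In, in_seq, Nat.eqb_eq, Nat.Lcm0.mod_divide.
split; [tauto|]; intros H; split; [|exact H].
destruct H as [x Hx]; subst; assert (d <> 0%nat /\ x <> 0%nat) by (split; intros ->; lia); nia.
Qed.

Lemma NoDup_divisors (m : nat) : NoDup (divisors m).
Proof. apply NoDup_filter, seq_NoDup. Qed.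

Lemma length_divisors_prime_power (p e m : nat) :
  nprime p -> (1 <= m)%nat -> ~ Nat.divide p m ->
  (length (divisors (p ^ e * m)) <= S e * length (divisors m))%nat.
Proof.
intros Hp Hm Hpm; pose proof (nprime_ge_2 p Hp).
assert (Hpe : forall j, (1 <= p ^ j)%nat) by (intros j; pose proof (Nat.pow_nonzero p j); lia).
replace (S e * length (divisors m))%nat with
  (length (map (fun x => p ^ fst x * snd x)%nat (list_prod (seq 0 (S e)) (divisors m))))
  by (rewrite length_map, length_prod, length_seq; reflexivity).
apply NoDup_incl_length; [apply NoDup_divisors|].
intros d Hd; apply in_divisors in Hd; [|specialize (Hpe e); nia].
assert (Hd1 : (1 <= d)%nat).
{ destruct d; [|lia]; destruct Hd as [x Hx]; specialize (Hpe e); nia. }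
destruct (prime_power_split p d Hp Hd1) as [j [d' [E [Hd' Hpd']]]].
apply in_map_iff; exists (j, d'); split; [symmetry; exact E|].
assert (Hj : (j <= e)%nat).
{ apply Nat.nlt_ge; intros Hlt; apply Hpm.
  destruct Hd as [x Hx].
  replace j with (e + (1 + (j - e - 1)))%nat in E by lia.
  rewrite !Nat.pow_add_r, Nat.pow_1_r in E.
  exists (x * p ^ (j - e - 1) * d')%nat.
  apply (Nat.mul_cancel_l _ _ (p ^ e)); [specialize (Hpe e); lia|].
  rewrite Hx, E; ring. }
apply in_prod; [apply in_seq; lia|].
apply in_divisors; [exact Hm|].
assert (Hc : cop d' (p ^ e)) by (apply cop_sym, cop_pow_l; assumption).
assert (Hg : Nat.gcd d' (p ^ e) = 1%nat).
{ apply NNPP; intros Hg1.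
  assert (Hg0 : Nat.gcd d' (p ^ e) <> 0%nat)
    by (intros E0; apply Nat.gcd_eq_0 in E0; lia).
  destruct (prime_factor_exists (Nat.gcd d' (p ^ e))) as [r [Hr Hrd]]; [lia|].
  apply (Hc r Hr).
  - eapply Nat.divide_trans; [exact Hrd|apply Nat.gcd_divide_l].
  - eapply Nat.divide_trans; [exact Hrd|apply Nat.gcd_divide_r]. }
apply (Nat.gauss d' (p ^ e) m); [|exact Hg].
eapply Nat.divide_trans; [|exact Hd]; rewrite E; apply Nat.divide_factor_r.
Qed.

Lemma divisors_le_hecke_seq (A : nat -> R) (Q n : nat) :
  hecke_seq A -> (forall p, nprime p -> ~ Nat.divide p Q -> 2 <= Rabs (A p)) ->
  (1 <= n)%nat -> cop n Q -> INR (length (divisors n)) <= Rabs (A n).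
Proof.
intros HA HQ Hn; revert n Hn.
apply (multiplicative_induction (fun n => cop n Q -> INR (length (divisors n)) <= Rabs (A n))).
- intros _; rewrite (proj1 HA), Rabs_R1; simpl; lra.
- intros p e m Hp Hm Hpm IH Hc; destruct (cop_factor_l _ _ _ Hc) as [Hc1 Hc2].
  pose proof (nprime_ge_2 p Hp).
  assert (Hpe : (1 <= p ^ S e)%nat) by (pose proof (Nat.pow_nonzero p (S e)); lia).
  rewrite hecke_seq_mult, Rabs_mult by (try apply cop_pow_l; assumption).
  eapply Rle_trans; [apply le_INR, length_divisors_prime_power; assumption|].
  rewrite mult_INR; apply Rmult_le_compat; try apply pos_INR; [|apply IH, Hc2].
  apply powers_growth; try assumption; apply HQ; [exact Hp|].
  intros Hd; apply (Hc1 p Hp); [|exact Hd].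
  simpl; apply Nat.divide_mul_l, Nat.divide_refl.
Qed.

Lemma harmonic_unbounded (B : R) : exists n, B < rsum (fun i => / INR (S i)) n.
Proof.
assert (H : forall j, INR j / 2 <= rsum (fun i => / INR (S i)) (2 ^ j)).
{ induction j as [|j IH].
  - simpl; lra.
  - replace (2 ^ S j)%nat with (2 ^ j + 2 ^ j)%nat by (simpl; lia).
    rewrite rsum_shift, S_INR.
    assert (H1 : / 2 <= rsum (fun i => / INR (S (2 ^ j + i))) (2 ^ j)).
    { assert (Hp : 0 < INR (2 ^ j))
        by (apply lt_0_INR; pose proof (Nat.pow_nonzero 2 j); lia).
      replace (/ 2) with (INR (2 ^ j) * / (INR (2 ^ j) + INR (2 ^ j))) by (field; lra).
      rewrite <- rsum_const; apply rsum_le; intros i Hi.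
      apply Rinv_le_contravar; [apply lt_0_INR; lia|].
      rewrite <- plus_INR; apply le_INR; lia. }
    lra. }
destruct (archimed_nat (2 * B)) as [j Hj]; exists (2 ^ j)%nat.
specialize (H j); lra.
Qed.

Lemma rsum_residue_ge (T b J : nat) :
  (b < T)%nat ->
  INR J <= rsum (fun t => if (t mod T =? b)%nat then 1 else 0) (J * T).
Proof.
intros Hb; induction J as [|J IH]; [simpl; lra|].
replace (S J * T)%nat with (J * T + T)%nat by lia.
rewrite rsum_shift, S_INR; apply Rplus_le_compat; [exact IH|].
assert (H0 : forall t, 0 <= (if (t mod T =? b)%nat then 1 else 0))
  by (intros t; destruct (_ =? _)%nat; lra).
apply Rle_trans with (rsum (fun i => if ((J * T + i) mod T =? b)%nat then 1 else 0) (S b)).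
- simpl; rewrite Nat.add_comm, Nat.Div0.mod_add, Nat.mod_small, Nat.eqb_refl by exact Hb.
  assert (0 <= rsum (fun i => if ((J * T + i) mod T =? b)%nat then 1 else 0) b)
    by (apply rsum_nonneg; intros; apply H0).
  lra.
- apply rsum_mono; [intros; apply H0|lia].
Qed.

Lemma rsum_indicator (f : nat -> bool) (n : nat) :
  rsum (fun i => if f i then 1 else 0) n = INR (length (filter f (seq 0 n))).
Proof.
induction n as [|n IH]; [reflexivity|].
rewrite seq_S, filter_app, length_app, plus_INR, <- IH; simpl.
destruct (f n); simpl; lra.
Qed.

(* If |A(p)| >= 2 for all p not dividing Q, then A(n)^2 >= d(n) for n = 1 mod Q;
   counting pairs (1 + iQ, m) with i < I gives a sum exceeding any multiple of N. *)
Lemma mean_square_absurd (A : nat -> R) (Q l : nat) (K : R) :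
  hecke_seq A -> (1 <= Q)%nat ->
  (forall N, rsum (fun i => A (S i) ^ 2 * INR (S i) ^ (2 * l + 1)) N <= K * INR N ^ (2 * l + 2)) ->
  (forall p, nprime p -> ~ Nat.divide p Q -> 2 <= Rabs (A p)) -> False.
Proof.
intros HA HQ HK H2.
assert (HQ' : 0 < INR Q) by (apply lt_0_INR; lia).
destruct (harmonic_unbounded (K * 2 ^ (2 * l + 2) * INR Q * INR Q)) as [I HI].
set (L := map (fun i => 1 + i * Q)%nat (seq 0 I)).
(* A common multiple of all moduli T(i) = (1 + iQ) Q, so an interval of length M meets each residue
   class mod T(i) the expected number of times. The class t = iQ mod T(i) makes n = M + t + 1 equal
   to 1 + iQ times a number that is 1 mod Q. *)
set (M := (Q * nprod L)%nat).
set (T := fun i => ((1 + i * Q) * Q)%nat).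
assert (HM : forall i, (i < I)%nat -> exists J, M = (J * T i)%nat).
{ intros i Hi; destruct (divide_nprod (1 + i * Q) L) as [J HJ].
  - apply in_map_iff; exists i; split; [reflexivity|apply in_seq; lia].
  - exists J; unfold M, T; rewrite HJ; ring. }
assert (HMp : (1 <= M)%nat).
{ unfold M; assert (Hn : nprod L <> 0%nat); [|nia].
  clear - HQ; unfold L; generalize (seq 0 I); intros S; induction S as [|x S IH]; [discriminate|].
  apply Nat.neq_mul_0; split; [lia|exact IH]. }
assert (HMr : 0 < INR M) by (apply lt_0_INR; lia).
assert (Hpt : forall t, rsum (fun i => if (t mod T i =? i * Q)%nat then 1 else 0) I
   <= A (S (M + t)) ^ 2).
{ intros t; rewrite (rsum_indicator (fun i => (t mod T i =? i * Q)%nat)).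
  set (F := filter _ _).
  assert (HF : forall i, In i F -> (i < I)%nat /\ exists x, t = (T i * x + i * Q)%nat).
  { intros i Hi; apply filter_In in Hi; destruct Hi as [Hi1 Hi2].
    apply in_seq in Hi1; apply Nat.eqb_eq in Hi2; split; [lia|].
    exists (t / T i)%nat; rewrite <- Hi2; apply Nat.div_mod_eq. }
  destruct F as [|i0 F'] eqn:EF; [simpl; pose proof (pow2_ge_0 (A (S (M + t)))); simpl in *; lra|].
  rewrite <- EF in *.
  assert (Hc : cop (S (M + t)) Q).
  { destruct (HF i0 ltac:(rewrite EF; left; reflexivity)) as [Hi0 [x Hx]].
    intros r Hr Hd1 Hd2; destruct Hd2 as [w Hw].
    assert (Hd3 : Nat.divide r (M + t)).
    { exists (w * nprod L + (1 + i0 * Q) * w * x + i0 * w)%nat; unfold M, T in *; nia. }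
    replace (S (M + t)) with (M + t + 1)%nat in Hd1 by lia.
    apply (Nat.divide_add_cancel_r _ _ _ Hd3) in Hd1; apply Nat.divide_1_r in Hd1.
    pose proof (nprime_ge_2 r Hr); lia. }
  pose proof (divisors_le_hecke_seq A Q (S (M + t)) HA H2 ltac:(lia) Hc) as H3.
  (* Distinct i in [F] give distinct divisors 1 + iQ, and |F| <= |F|^2 <= A(n)^2 because |F| >=
     1. *)
  assert (Hlen : (length F <= length (divisors (S (M + t))))%nat).
  { rewrite <- (length_map (fun i => 1 + i * Q)%nat F).
    apply NoDup_incl_length.
    - apply NoDup_map_NoDup_ForallPairs; [|unfold F; apply NoDup_filter, seq_NoDup].
      intros x y _ _ E; nia.
    - intros d Hd; apply in_map_iff in Hd; destruct Hd as [i [<- Hi]].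
      destruct (HF i Hi) as [Hi' [x Hx]]; destruct (HM i Hi') as [J HJ].
      apply in_divisors; [lia|].
      exists (J * Q + Q * x + 1)%nat; unfold T in *; nia. }
  apply le_INR in Hlen.
  assert (H1 : 1 <= INR (length F)) by (rewrite EF; simpl length; rewrite S_INR; pose proof (pos_INR (length F')); lra).
  rewrite <- pow2_abs; nra. }
assert (Hsum : INR M / INR Q * rsum (fun i => / INR (1 + i * Q)) I <=
   rsum (fun t => A (S (M + t)) ^ 2) M).
{ eapply Rle_trans; [|apply rsum_le; intros t _; apply Hpt].
  rewrite rsum_exchange, <- rsum_scal; apply rsum_le; intros i Hi.
  destruct (HM i Hi) as [J HJ].
  pose proof (rsum_residue_ge (T i) (i * Q) J ltac:(unfold T; nia)) as H3.
  rewrite <- HJ in H3; eapply Rle_trans; [|exact H3].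
  assert (Hi0 : 0 < INR (1 + i * Q)) by (apply lt_0_INR; lia).
  rewrite HJ; unfold T; rewrite !mult_INR; right; field; lra. }
assert (Hh : / INR Q * rsum (fun i => / INR (S i)) I <= rsum (fun i => / INR (1 + i * Q)) I).
{ rewrite <- rsum_scal; apply rsum_le; intros i _.
  rewrite <- Rinv_mult, <- mult_INR; apply Rinv_le_contravar; [apply lt_0_INR; lia|].
  apply le_INR; nia. }
pose proof (HK (M + M)%nat) as HKM; rewrite rsum_shift in HKM.
(* Working above M lets the weight n^(2l+1) be replaced by M^(2l+1); the upper end 2M is the source
   of the factor 2^(2l+2). *)
assert (Hlow : INR M ^ (2 * l + 1) * rsum (fun t => A (S (M + t)) ^ 2) M <=
  rsum (fun t => A (S (M + t)) ^ 2 * INR (S (M + t)) ^ (2 * l + 1)) M).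
{ rewrite <- rsum_scal; apply rsum_le; intros t _; rewrite Rmult_comm.
  apply Rmult_le_compat_l; [apply pow2_ge_0|].
  apply pow_incr; split; [lra|apply le_INR; lia]. }
assert (H0 : 0 <= rsum (fun i => A (S i) ^ 2 * INR (S i) ^ (2 * l + 1)) M).
{ apply rsum_nonneg; intros i _; apply Rmult_le_pos; [apply pow2_ge_0|apply pow_le, pos_INR]. }
rewrite plus_INR in HKM.
replace (INR M + INR M) with (2 * INR M) in HKM by ring.
rewrite Rpow_mult_distr in HKM.
replace (2 * l + 2)%nat with (S (2 * l + 1)) in HKM at 2 by lia.
set (h := rsum (fun i => / INR (S i)) I) in *.
assert (HMl : 0 < INR M ^ (2 * l + 1)) by (apply pow_lt, HMr).
assert (Hfin : INR M ^ (2 * l + 1) * (INR M / INR Q * (/ INR Q * h)) <=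
  K * (2 ^ (2 * l + 2) * (INR M * INR M ^ (2 * l + 1)))).
{ eapply Rle_trans; [|eapply Rle_trans; [|exact HKM]].
  - apply Rmult_le_compat_l; [lra|].
    eapply Rle_trans; [|exact Hsum].
    apply Rmult_le_compat_l; [|exact Hh].
    apply Rmult_le_pos; [lra|left; apply Rinv_0_lt_compat, HQ'].
  - lra. }
assert (Hfin2 : h <= K * 2 ^ (2 * l + 2) * INR Q * INR Q).
{ apply Rmult_le_reg_l with (INR M ^ (2 * l + 1) * INR M * / INR Q * / INR Q).
  - repeat apply Rmult_lt_0_compat; try assumption; apply Rinv_0_lt_compat, HQ'.
  - replace (INR M ^ (2 * l + 1) * INR M * / INR Q * / INR Q *
      (K * 2 ^ (2 * l + 2) * INR Q * INR Q)) with
      (K * (2 ^ (2 * l + 2) * (INR M * INR M ^ (2 * l + 1)))) by (field; lra).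
    unfold Rdiv in Hfin; lra. }
lra.
Qed.

Lemma negative_square_exists (A : nat -> R) (Q l : nat) (K : R) :
  hecke_seq A -> (1 <= Q)%nat ->
  (forall p e, nprime p -> ~ Nat.divide p Q -> A (p ^ (2 * e))%nat <> 0) ->
  (forall N, rsum (fun i => A (S i) ^ 2 * INR (S i) ^ (2 * l + 1)) N <= K * INR N ^ (2 * l + 2)) ->
  exists P, (2 <= P)%nat /\ cop P Q /\ A (P * P)%nat < 0.
Proof.
intros HA HQ Hnz HK; apply NNPP; intros Hno.
apply (mean_square_absurd A Q l K HA HQ HK); intros p Hp Hd.
apply (positive_even_powers_ge_2 A p HA Hp); intros [|e].
- simpl; rewrite (proj1 HA); lra.
- pose proof (Hnz p (S e) Hp Hd) as H1.
  apply Rnot_le_lt; intros H2; apply Hno; exists (p ^ S e)%nat; split; [|split].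
  + pose proof (nprime_ge_2 p Hp); pose proof (Nat.pow_nonzero p e); simpl; nia.
  + apply cop_pow_l; assumption.
  + rewrite <- Nat.pow_add_r; replace (S e + S e)%nat with (2 * S e)%nat by lia; lra.
Qed.

(** * Sign changes in short intervals *)

Lemma two_squares_square (m : nat) : (1 <= m)%nat -> two_squares (m * m).
Proof. intros Hm; split; [nia|]; exists m, O; simpl; nia. Qed.

Lemma prime_not_dividing_1 (r : nat) : nprime r -> ~ Nat.divide r 1.
Proof.
intros Hr Hd; apply Nat.divide_1_r in Hd; pose proof (nprime_ge_2 r Hr); lia.
Qed.

Lemma hecke_seq_square_mult (A : nat -> R) (m n : nat) :
  hecke_seq A -> (1 <= m)%nat -> (1 <= n)%nat -> cop m n ->
  A (m * n * (m * n))%nat = A (m * m)%nat * A (n * n)%nat.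
Proof.
intros HA Hm Hn Hc; rewrite <- hecke_seq_mult; [f_equal; lia|exact HA|nia|nia|].
apply cop_mult_l; apply cop_mult_r; exact Hc.
Qed.

(* With u = 0 mod W close to t, the numbers b1 = u+1, b2 = u+c, z = Pu+1 are coprime
   and b1 z, b2 z, P b1 b2 all have squares in the window. The first two give
   A(b1^2) A(b2^2) > 0, the third then determines the sign of A(P^2). *)
Lemma window_sign (A : nat -> R) (Q P : nat) :
  hecke_seq A -> (1 <= Q)%nat ->
  (forall m, (1 <= m)%nat -> cop m Q -> A (m * m)%nat <> 0) ->
  (2 <= P)%nat -> cop P Q ->
  exists kap, 1 <= kap /\ forall t s, kap <= t -> s <> 0 ->
    (forall n, two_squares n ->
       INR P ^ 2 * t ^ 4 <= INR n <= INR P ^ 2 * t ^ 4 + 15 * INR P ^ 2 * kap * t ^ 3 ->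
       0 <= s * A n) ->
    0 <= s * A (P * P)%nat.
Proof.
intros HA HQ Hnz HP HPQ.
set (c := (P * Q + 1)%nat).
(* A common prime of b1 and z divides P b1 - z = P - 1, one of b2 and z divides P b2 - z = P c - 1,
   and one of b1 and b2 divides b2 - b1 = P Q. All three divide W, hence u, while b1 and z are 1 mod
   W. *)
set (W := (P * Q * (P - 1) * (P * c - 1))%nat).
assert (HW : (1 <= W)%nat).
{ assert (Hw : W <> 0%nat); [|lia].
  assert (2 * 1 <= P * c)%nat by (apply Nat.mul_le_mono; unfold c; lia).
  unfold W; repeat (apply Nat.neq_mul_0; split); lia. }
assert (HdP : Nat.divide P W) by (unfold W; do 2 apply Nat.divide_mul_l; apply Nat.divide_factor_l).
assert (HdQ : Nat.divide Q W) by (unfold W; do 2 apply Nat.divide_mul_l; apply Nat.divide_factor_r).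
assert (HdPQ : Nat.divide (P * Q) W) by (unfold W; do 2 apply Nat.divide_mul_l; apply Nat.divide_refl).
assert (Hd1 : Nat.divide (P - 1) W) by (unfold W; apply Nat.divide_mul_l, Nat.divide_factor_r).
assert (Hd2 : Nat.divide (P * c - 1) W) by (unfold W; apply Nat.divide_factor_r).
clearbody W.
assert (HWr : 0 < INR W) by (apply lt_0_INR; lia).
exists (INR W + INR c); split.
{ assert (1 <= INR c) by (apply (le_INR 1); unfold c; nia); lra. }
intros t s Ht Hs H.
assert (Hc1 : 1 <= INR c) by (apply (le_INR 1); unfold c; nia).
assert (Hu : exists v : nat, t <= INR (W * v) <= t + INR W).
{ destruct (archimed (t / INR W)) as [H1 H2].
  assert (Htw : 0 <= t / INR W).
  { apply Rmult_le_pos; [lra|left; apply Rinv_0_lt_compat, HWr]. }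
  assert (Hup : (0 <= up (t / INR W))%Z) by (apply le_IZR; simpl; lra).
  exists (Z.to_nat (up (t / INR W))).
  rewrite mult_INR, (INR_IZR_INZ (Z.to_nat _)), Z2Nat.id by exact Hup.
  assert (Et : t = INR W * (t / INR W)) by (field; lra).
  set (x := t / INR W) in *; set (U := IZR (up x)) in *.
  assert (INR W * x <= INR W * U) by (apply Rmult_le_compat_l; lra).
  assert (INR W * U <= INR W * (x + 1)) by (apply Rmult_le_compat_l; lra).
  lra. }
destruct Hu as [v Hv].
set (u := (W * v)%nat) in *.
set (b1 := (u + 1)%nat); set (b2 := (u + c)%nat); set (z := (P * u + 1)%nat).
assert (Hdiv : forall r, Nat.divide r W -> Nat.divide r u)
  by (intros r Hr; apply Nat.divide_mul_l, Hr).
assert (Hb1W : forall r, nprime r -> Nat.divide r W -> Nat.divide r b1 -> False).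
{ intros r Hr HrW Hrb; apply (prime_not_dividing_1 r Hr).
  apply (Nat.divide_add_cancel_r r u); [apply Hdiv, HrW|exact Hrb]. }
assert (HzW : forall r, nprime r -> Nat.divide r W -> Nat.divide r z -> False).
{ intros r Hr HrW Hrz; apply (prime_not_dividing_1 r Hr).
  apply (Nat.divide_add_cancel_r r (P * u)); [apply Nat.divide_mul_r, Hdiv, HrW|exact Hrz]. }
assert (Hb2PQ : forall r, nprime r -> Nat.divide r (P * Q) -> Nat.divide r b2 -> False).
{ intros r Hr HrPQ Hrb; apply (prime_not_dividing_1 r Hr).
  apply (Nat.divide_add_cancel_r r (u + P * Q)).
  - apply Nat.divide_add_r; [apply Hdiv, (Nat.divide_trans _ _ _ HrPQ HdPQ)|exact HrPQ].
  - replace (u + P * Q + 1)%nat with b2 by (unfold b2, c; lia); exact Hrb. }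
assert (Cb1z : cop b1 z).
{ intros r Hr H1 H2; apply (Hb1W r Hr); [|exact H1].
  eapply Nat.divide_trans; [|exact Hd1].
  apply (Nat.divide_add_cancel_r r z _ H2).
  replace (z + (P - 1))%nat with (P * b1)%nat by (unfold z, b1; nia).
  apply Nat.divide_mul_r, H1. }
assert (Cb2z : cop b2 z).
{ intros r Hr H1 H2; apply (HzW r Hr); [|exact H2].
  eapply Nat.divide_trans; [|exact Hd2].
  apply (Nat.divide_add_cancel_r r z _ H2).
  replace (z + (P * c - 1))%nat with (P * b2)%nat.
  - apply Nat.divide_mul_r, H1.
  - unfold z, b2; assert (1 <= P * c)%nat by (unfold c; nia); nia. }
assert (Cb1b2 : cop b1 b2).
{ intros r Hr H1 H2; apply (Hb1W r Hr); [|exact H1].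
  eapply Nat.divide_trans; [|exact HdPQ].
  apply (Nat.divide_add_cancel_r r b1 _ H1).
  replace (b1 + P * Q)%nat with b2 by (unfold b1, b2, c; lia); exact H2. }
assert (Cb1Q : cop b1 Q).
{ intros r Hr H1 H2; apply (Hb1W r Hr); [|exact H1].
  exact (Nat.divide_trans _ _ _ H2 HdQ). }
assert (CzQ : cop z Q).
{ intros r Hr H1 H2; apply (HzW r Hr); [|exact H1].
  exact (Nat.divide_trans _ _ _ H2 HdQ). }
assert (Cb2Q : cop b2 Q).
{ intros r Hr H1 H2; apply (Hb2PQ r Hr); [apply Nat.divide_mul_r, H2|exact H1]. }
assert (CPb : cop P (b1 * b2)).
{ apply cop_mult_r; intros r Hr H1 H2.
  - apply (Hb1W r Hr); [exact (Nat.divide_trans _ _ _ H1 HdP)|exact H2].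
  - apply (Hb2PQ r Hr); [apply Nat.divide_mul_l, H1|exact H2]. }
assert (Hpos : (1 <= b1)%nat /\ (1 <= b2)%nat /\ (1 <= z)%nat)
  by (unfold b1, b2, z, c; lia).
destruct Hpos as [Pb1 [Pb2 Pz]].
assert (HPr : 2 <= INR P) by (apply (le_INR 2), HP).
set (kap := INR W + INR c) in *.
assert (Hk : 1 <= kap) by (unfold kap; lra).
(* Here t <= u and b2 <= t + kap, so for kap <= t the upper end is at most P(t^2 + 3 kap t).
   Squaring gives 6 kap t^3 + 9 kap^2 t^2 <= 15 kap t^3, the source of the 15. *)
assert (Hwin : forall m, (P * (u * u) <= m)%nat -> (m <= P * (b2 * b2))%nat ->
  0 <= s * A (m * m)%nat).
{ intros m Hm1 Hm2; apply H.
  - apply two_squares_square; assert (1 <= u)%nat; [|nia].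
    apply INR_le; simpl; lra.
  - assert (Hl : INR P * t ^ 2 <= INR m).
    { apply le_INR in Hm1; rewrite !mult_INR in Hm1.
      eapply Rle_trans; [|exact Hm1]; apply Rmult_le_compat_l; [lra|].
      simpl; rewrite Rmult_1_r; apply Rmult_le_compat; lra. }
    assert (Hr : INR m <= INR P * (t ^ 2 + 3 * kap * t)).
    { apply le_INR in Hm2; rewrite !mult_INR in Hm2.
      eapply Rle_trans; [exact Hm2|]; apply Rmult_le_compat_l; [lra|].
      assert (Hb2 : 0 <= INR b2 <= t + kap) by (unfold b2; rewrite plus_INR; unfold kap; lra).
      nra. }
    assert (Ht0 : 0 <= INR P * t ^ 2) by (apply Rmult_le_pos; [lra|apply pow2_ge_0]).
    rewrite mult_INR; split.
    + replace (INR P ^ 2 * t ^ 4) with ((INR P * t ^ 2) * (INR P * t ^ 2)) by ring.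
      apply Rmult_le_compat; assumption.
    + apply Rle_trans with ((INR P * (t ^ 2 + 3 * kap * t)) * (INR P * (t ^ 2 + 3 * kap * t))).
      * apply Rmult_le_compat; lra.
      * assert (E : kap * t ^ 2 * kap <= kap * t ^ 2 * t)
          by (apply Rmult_le_compat_l; [apply Rmult_le_pos; [lra|apply pow2_ge_0]|exact Ht]).
        pose proof (pow2_ge_0 (INR P)); nra. }
assert (Hc' : (1 <= c)%nat) by (unfold c; lia).
pose proof (Hwin (b1 * z)%nat ltac:(unfold b1, z; nia) ltac:(unfold b1, b2, z; nia)) as S1.
pose proof (Hwin (b2 * z)%nat ltac:(unfold b2, z; nia) ltac:(unfold b2, z; nia)) as S2.
pose proof (Hwin (P * (b1 * b2))%nat ltac:(unfold b1, b2; nia) ltac:(unfold b1, b2; nia)) as S3.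
rewrite hecke_seq_square_mult in S1, S2 by assumption.
rewrite hecke_seq_square_mult in S3 by (try assumption; nia).
rewrite (hecke_seq_square_mult A b1 b2) in S3 by assumption.
pose proof (Hnz b1 Pb1 Cb1Q) as N1; pose proof (Hnz b2 Pb2 Cb2Q) as N2.
pose proof (Hnz z Pz CzQ) as N3.
set (x1 := A (b1 * b1)%nat) in *; set (x2 := A (b2 * b2)%nat) in *.
set (x3 := A (z * z)%nat) in *; set (y := A (P * P)%nat) in *.
(* The product of [S1] and [S2] contains the positive square (s x3)^2. *)
assert (H12 : 0 < x1 * x2).
{ assert (Hq : 0 <= (s * (x1 * x3)) * (s * (x2 * x3))) by (apply Rmult_le_pos; assumption).
  replace ((s * (x1 * x3)) * (s * (x2 * x3))) with ((s * x3) ^ 2 * (x1 * x2)) in Hq by ring.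
  assert (Hsq : 0 < (s * x3) ^ 2).
  { apply pow2_gt_0, Rmult_integral_contrapositive_currified; assumption. }
  assert (Hne : x1 * x2 <> 0) by (apply Rmult_integral_contrapositive_currified; assumption).
  destruct (Rtotal_order (x1 * x2) 0) as [Hlt|[Heq|Hgt]]; [nra|contradiction|exact Hgt]. }
apply Rnot_lt_le; intros Hlt; nra.
Qed.

Lemma Rpower_large (d B : R) :
  0 < d -> exists X0, 1 <= X0 /\ forall X, X0 <= X -> B <= Rpower X d.
Proof.
intros Hd; set (B' := Rmax B 1).
assert (HB1 : 1 <= B') by apply Rmax_r.
exists (Rpower B' (/ d)); split.
- rewrite <- (Rpower_O B') by lra; apply Rle_Rpower; [exact HB1|].
  left; apply Rinv_0_lt_compat, Hd.
- intros X HX; apply Rle_trans with B'; [apply Rmax_l|].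
  rewrite <- (Rpower_1 B') by lra.
  replace 1 with (/ d * d) by (field; lra); rewrite <- Rpower_mult.
  apply Rle_Rpower_l; [lra|]; split; [apply exp_pos|exact HX].
Qed.

Lemma window_sign_Rpower (A : nat -> R) (Q P : nat) :
  hecke_seq A -> (1 <= Q)%nat ->
  (forall m, (1 <= m)%nat -> cop m Q -> A (m * m)%nat <> 0) ->
  (2 <= P)%nat -> cop P Q ->
  exists K X0, 0 < K /\ 1 <= X0 /\ forall X s, X0 <= X -> s <> 0 ->
    (forall n, two_squares n -> X <= INR n <= X + K * Rpower X (3 / 4) -> 0 <= s * A n) ->
    0 <= s * A (P * P)%nat.
Proof.
intros HA HQ Hnz HP HPQ.
destruct (window_sign A Q P HA HQ Hnz HP HPQ) as [kap [Hk H]].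
assert (HPr : 2 <= INR P) by (apply (le_INR 2), HP).
set (sp := sqrt (INR P)).
assert (Hsp : 1 <= sp) by (unfold sp; rewrite <- sqrt_1; apply sqrt_le_1_alt; lra).
assert (Esp : sp * sp = INR P) by (apply sqrt_sqrt; lra).
destruct (Rpower_large (1 / 4) (kap * sp)) as [X0 [HX0 HX]]; [lra|].
exists (15 * INR P ^ 2 * kap), X0; split; [|split; [exact HX0|]].
{ repeat apply Rmult_lt_0_compat; try lra; apply pow_lt; lra. }
intros X s HXX Hs Hn.
set (r := Rpower X (1 / 4)).
assert (Er : forall m, r ^ m = Rpower X (INR m / 4)).
{ intros m; unfold r; rewrite <- Rpower_pow by apply exp_pos.
  rewrite Rpower_mult; f_equal; field. }
assert (Hr : 0 < r) by apply exp_pos.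
(* t = X^(1/4) / sqrt P makes the lower end P^2 t^4 of the window equal to X. *)
set (t := r / sp).
assert (E4 : INR P ^ 2 * t ^ 4 = X).
{ rewrite <- Esp; unfold t.
  replace ((sp * sp) ^ 2 * (r / sp) ^ 4) with (r ^ 4) by (field; lra).
  rewrite Er; replace (INR 4 / 4) with 1 by (simpl; field).
  apply Rpower_1; lra. }
assert (Htr : t <= r).
{ unfold t; apply Rmult_le_reg_r with sp; [lra|].
  replace (r / sp * sp) with r by (field; lra); nra. }
assert (Ht : kap <= t).
{ apply Rmult_le_reg_r with sp; [lra|].
  unfold t; replace (r / sp * sp) with r by (field; lra); apply HX, HXX. }
apply (H t s Ht Hs); rewrite E4; intros n Hn1 Hn2; apply (Hn n Hn1).
split; [lra|]; eapply Rle_trans; [apply Hn2|]; apply Rplus_le_compat_l.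
apply Rmult_le_compat_l.
- apply Rmult_le_pos; [apply Rmult_le_pos; [lra|apply pow2_ge_0]|lra].
- replace (3 / 4) with (INR 3 / 4) by (simpl; field); rewrite <- Er.
  apply pow_incr; lra.
Qed.

Lemma short_interval_sign_change (A : nat -> R) (Q P : nat) :
  hecke_seq A -> (1 <= Q)%nat ->
  (forall m, (1 <= m)%nat -> cop m Q -> A (m * m)%nat <> 0) ->
  (2 <= P)%nat -> cop P Q -> A (P * P)%nat < 0 ->
  exists K X0, 0 < K /\ 1 <= X0 /\
    forall X, X0 <= X -> has_sign_change A X (X + K * Rpower X (3 / 4)).
Proof.
intros HA HQ Hnz HP HPQ Hneg.
(* Coprime to both P and Q by construction, so the window argument applies to P, R and P R alike. *)
set (R := (P * Q + 1)%nat).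
assert (HR : (2 <= R)%nat) by (unfold R; nia).
assert (HRc : cop R (P * Q)).
{ intros r Hr H1 H2; apply (prime_not_dividing_1 r Hr).
  apply (Nat.divide_add_cancel_r r (P * Q)); assumption. }
assert (HRQ : cop R Q).
{ intros r Hr H1 H2; apply (HRc r Hr H1), Nat.divide_mul_r, H2. }
assert (HPR : cop P R).
{ intros r Hr H1 H2; apply (HRc r Hr H2), Nat.divide_mul_l, H1. }
assert (HPRQ : cop (P * R) Q) by (apply cop_mult_l; assumption).
destruct (window_sign_Rpower A Q P HA HQ Hnz HP HPQ) as [K1 [X1 [HK1 [HX1 H1]]]].
destruct (window_sign_Rpower A Q R HA HQ Hnz HR HRQ) as [K2 [X2 [HK2 [HX2 H2]]]].
destruct (window_sign_Rpower A Q (P * R) HA HQ Hnz ltac:(nia) HPRQ) as [K3 [X3 [HK3 [HX3 H3]]]].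
exists (K1 + K2 + K3), (X1 + X2 + X3); split; [lra|split; [lra|]].
intros X HX; apply NNPP; intros Hno.
assert (HR34 : 0 < Rpower X (3 / 4)) by apply exp_pos.
set (B := X + (K1 + K2 + K3) * Rpower X (3 / 4)) in *.
(* Without a sign change, one negative term forces all terms to be <= 0 and s = -1 works; otherwise
   s = 1. *)
assert (Hs : exists s, s <> 0 /\ forall n, two_squares n -> X <= INR n <= B -> 0 <= s * A n).
{ destruct (classic (exists m, two_squares m /\ X <= INR m <= B /\ A m < 0)) as [[m [Hm1 [Hm2 Hm3]]]|Hn].
  - exists (-1); split; [lra|]; intros n Hn1 Hn2.
    assert (A n <= 0); [|lra].
    apply Rnot_lt_le; intros Hn3; apply Hno; exists m, n.
    exact (conj Hm1 (conj Hm2 (conj Hn1 (conj Hn2 (conj Hm3 Hn3))))).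
  - exists 1; split; [lra|]; intros n Hn1 Hn2; rewrite Rmult_1_l.
    apply Rnot_lt_le; intros Hn3; apply Hn; exists n; auto. }
destruct Hs as [s [Hs Hall]].
assert (S1 : 0 <= s * A (P * P)%nat).
{ apply (H1 X s ltac:(lra) Hs); intros n Hn1 Hn2; apply Hall; [exact Hn1|unfold B; nra]. }
assert (S2 : 0 <= s * A (R * R)%nat).
{ apply (H2 X s ltac:(lra) Hs); intros n Hn1 Hn2; apply Hall; [exact Hn1|unfold B; nra]. }
assert (S3 : 0 <= s * A (P * R * (P * R))%nat).
{ apply (H3 X s ltac:(lra) Hs); intros n Hn1 Hn2; apply Hall; [exact Hn1|unfold B; nra]. }
rewrite hecke_seq_square_mult in S3 by (assumption || lia).
pose proof (Hnz R ltac:(lia) HRQ) as N2.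
set (x := A (P * P)%nat) in *; set (y := A (R * R)%nat) in *.
assert (Hs0 : s < 0) by nra.
assert (Hy : y < 0).
{ assert (y <= 0) by nra; lra. }
assert (0 < x * y) by nra.
nra.
Qed.

(** * Counting sign changes *)

Lemma sign_changes_cons_le (x : R) (l : list R) :
  (sign_changes l <= sign_changes (x :: l))%nat.
Proof. destruct l as [|y l]; simpl; lia. Qed.

Lemma sign_changes_app (l1 l2 : list R) :
  (sign_changes l1 + sign_changes l2 <= sign_changes (l1 ++ l2))%nat.
Proof.
induction l1 as [|x l1 IH]; [simpl; lia|].
destruct l1 as [|y l1].
- pose proof (sign_changes_cons_le x l2); simpl in *; lia.
- change (sign_changes (x :: y :: l1)) with
    ((if Rlt_dec (x * y) 0 then 1 else 0) + sign_changes (y :: l1))%nat.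
  change (sign_changes ((x :: y :: l1) ++ l2)) with
    ((if Rlt_dec (x * y) 0 then 1 else 0) + sign_changes ((y :: l1) ++ l2))%nat.
  lia.
Qed.

Lemma sign_changes_0 (l : list R) :
  (forall x, In x l -> x <> 0) -> sign_changes l = 0%nat ->
  forall x y, In x l -> In y l -> 0 < x * y.
Proof.
intros Hnz H0; induction l as [|a l IH]; [intros x y []|].
assert (Hl : forall x y, In x l -> In y l -> 0 < x * y).
{ apply IH; [intros; apply Hnz; right; assumption|].
  pose proof (sign_changes_cons_le a l); lia. }
assert (Ha : a <> 0) by (apply Hnz; left; reflexivity).
assert (Haa : 0 < a * a) by nra.
assert (Hal : forall y, In y l -> 0 < a * y).
{ intros y Hy; destruct l as [|b l]; [destruct Hy|].
  assert (Hab : 0 < a * b).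
  { simpl in H0; destruct (Rlt_dec (a * b) 0) as [Hlt|Hlt]; [discriminate|].
    assert (b <> 0) by (apply Hnz; right; left; reflexivity).
    assert (a * b <> 0) by (apply Rmult_integral_contrapositive_currified; assumption).
    lra. }
  pose proof (Hl b y (or_introl eq_refl) Hy) as Hby.
  pose proof (Hl b b (or_introl eq_refl) (or_introl eq_refl)) as Hbb.
  assert (0 < (a * b) * (b * y)) by (apply Rmult_lt_0_compat; assumption).
  nra. }
intros x y [<-|Hx] [<-|Hy]; auto.
rewrite Rmult_comm; auto.
Qed.

(** [T] is upward closed, so it cuts the increasing list into an initial and a final segment. *)
Lemma filter_seq_split (p : nat -> bool) (T : nat -> bool) (m n : nat) :
  (forall i j, (i <= j)%nat -> T i = true -> T j = true) ->
  filter p (seq m n) =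
  filter (fun i => p i && negb (T i))%bool (seq m n) ++
  filter (fun i => p i && T i)%bool (seq m n).
Proof.
intros HT; revert m; induction n as [|n IH]; intros m; [reflexivity|].
simpl; rewrite (IH (S m)).
destruct (p m), (T m) eqn:E; simpl; try reflexivity.
replace (filter (fun i => p i && negb (T i))%bool (seq (S m) n)) with (@nil nat); [reflexivity|].
symmetry; destruct (filter _ (seq (S m) n)) as [|x l] eqn:El; [reflexivity|].
assert (Hx : In x (filter (fun i => p i && negb (T i))%bool (seq (S m) n)))
  by (rewrite El; left; reflexivity).
apply filter_In in Hx; destruct Hx as [Hx1 Hx2]; apply in_seq in Hx1.
rewrite (HT m x ltac:(lia) E), Bool.andb_false_r in Hx2; discriminate.
Qed.

Definition geb (T : R) (n : nat) : bool := if Rle_dec T (INR n) then true else false.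

Lemma geb_true (T : R) (n : nat) : geb T n = true <-> T <= INR n.
Proof. unfold geb; destruct (Rle_dec T (INR n)); split; congruence || tauto || discriminate. Qed.

Lemma geb_mono (T : R) (i j : nat) : (i <= j)%nat -> geb T i = true -> geb T j = true.
Proof. rewrite !geb_true; intros H H1; apply le_INR in H; lra. Qed.

(** The windows have length h and spacing h' > h, so they lie in disjoint consecutive segments of
    the index list. Each segment has at least one sign change, and sign changes are superadditive
    under concatenation. *)
Lemma num_sign_changes_ge (A : nat -> R) (a b h h' : R) (r : nat) :
  0 <= h < h' -> (forall i, (i < r)%nat -> has_sign_change A (a + INR i * h') (a + INR i * h' + h)) ->
  a + INR r * h' <= b -> (r <= num_sign_changes A a b)%nat.
Proof.
intros Hh Hsc Hb.
set (p := fun n => if nonzero_index_dec A a b n then true else false).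
set (L := seq 1 (Z.to_nat (up b))).
set (G := fun T => filter (fun n => p n && geb T n)%bool L).
assert (HG : forall r T, a <= T -> T + INR r * h' <= b ->
  (forall i, (i < r)%nat -> has_sign_change A (T + INR i * h') (T + INR i * h' + h)) ->
  (r <= sign_changes (map A (G T)))%nat).
{ clear r Hsc Hb; induction r as [|r IH]; intros T HT HTb H; [lia|].
  rewrite S_INR in HTb.
  assert (Hr : 0 <= INR r) by apply pos_INR.
  assert (Hnext : (r <= sign_changes (map A (G (T + h')%R)))%nat).
  { apply IH; [lra|lra|]; intros i Hi; specialize (H (S i) ltac:(lia)).
    rewrite S_INR in H.
    replace (T + h' + INR i * h') with (T + (INR i + 1) * h') by ring; exact H. }
  destruct (H O ltac:(lia)) as [m [n [Hm1 [Hm2 [Hn1 [Hn2 [Hm3 Hn3]]]]]]].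
  simpl INR in Hm2, Hn2; rewrite Rmult_0_l, Rplus_0_r in Hm2, Hn2.
  assert (Hseg : forall x, two_squares x -> T <= INR x <= T + h -> A x <> 0 ->
     In x (filter (fun i => (p i && geb T i) && negb (geb (T + h')%R i))%bool L)).
  { intros x Hx1 Hx2 Hx3.
    assert (Hxb : INR x <= b) by nra.
    apply filter_In; split.
    - apply in_seq; split; [apply Hx1|].
      destruct (archimed b) as [Hup _].
      assert (Hlt : INR x < IZR (up b)) by lra.
      rewrite INR_IZR_INZ in Hlt; apply lt_IZR in Hlt; lia.
    - apply andb_true_intro; split; [apply andb_true_intro; split|].
      + unfold p; destruct (nonzero_index_dec A a b x) as [|Hn]; [reflexivity|].
        exfalso; apply Hn; repeat split; try assumption; try lra; apply Hx1.
      + apply geb_true; lra.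
      + unfold geb; destruct (Rle_dec (T + h') (INR x)); [lra|reflexivity]. }
  assert (Hsplit : G T = filter (fun i => (p i && geb T i) && negb (geb (T + h')%R i))%bool L ++ G (T + h')).
  { unfold G, L.
    rewrite (filter_seq_split (fun n => p n && geb T n)%bool (geb (T + h')) _ _ (geb_mono (T + h'))).
    f_equal; apply filter_ext; intros i.
    destruct (p i); [|reflexivity]; simpl.
    destruct (geb (T + h')%R i) eqn:E; [|apply Bool.andb_false_r].
    apply geb_true in E; rewrite (proj2 (geb_true T i)) by lra; reflexivity. }
  rewrite Hsplit, map_app.
  eapply Nat.le_trans; [|apply sign_changes_app].
  set (S := filter _ L) in *.
  assert (H1 : sign_changes (map A S) <> 0%nat); [|lia].
  intros E.
  assert (Hneg : 0 < A m * A n).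
  { apply (sign_changes_0 (map A S)); [|exact E| |].
    - intros x Hx; apply in_map_iff in Hx; destruct Hx as [i [<- Hi]].
      apply filter_In in Hi; destruct Hi as [_ Hi].
      apply andb_prop in Hi; destruct Hi as [Hi _].
      apply andb_prop in Hi; destruct Hi as [Hi _]; unfold p in Hi.
      destruct (nonzero_index_dec A a b i) as [[_ [_ Hne]]|]; [exact Hne|discriminate].
    - apply in_map, Hseg; [exact Hm1|exact Hm2|lra].
    - apply in_map, Hseg; [exact Hn1|exact Hn2|lra]. }
  nra. }
specialize (HG r a (Rle_refl a) Hb Hsc).
replace (num_sign_changes A a b) with (sign_changes (map A (G a))); [exact HG|].
unfold num_sign_changes, nonzero_indices, G; f_equal; f_equal; fold L.
apply filter_ext; intros i; unfold p.
destruct (nonzero_index_dec A a b i) as [[_ [[Hi _] _]]|]; [|reflexivity].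
rewrite (proj2 (geb_true a i)) by exact Hi; reflexivity.
Qed.

Lemma many_sign_changes (A : nat -> R) (K X1 eps : R) :
  0 < K -> 1 <= X1 -> 0 < eps ->
  (forall X, X1 <= X -> has_sign_change A X (X + K * Rpower X (3 / 4))) ->
  exists X0, 1 <= X0 /\ forall X, X0 <= X ->
    Rpower X (1 / 4 - eps) <= INR (num_sign_changes A X (2 * X)).
Proof.
intros HK HX1 He H.
(* Keeps the exponent 1/4 - d nonnegative, so that w >= 1 absorbs the loss from rounding down. *)
set (d := Rmin eps (1 / 4)).
assert (Hd : 0 < d) by (apply Rmin_glb_lt; lra).
assert (Hd4 : d <= 1 / 4) by apply Rmin_r.
assert (Hde : d <= eps) by apply Rmin_l.
set (K' := 2 * K + 1).
destruct (Rpower_large d (2 * K') Hd) as [X2 [HX2 Hbig]].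
exists (X1 + X2); split; [lra|]; intros X HX.
specialize (Hbig X ltac:(lra)).
(* The window length at 2X, which dominates that of every window starting in [X, 2X]. *)
set (h := K * Rpower (2 * X) (3 / 4)).
assert (Hh : 0 < h) by (apply Rmult_lt_0_compat; [exact HK|apply exp_pos]).
set (h' := h + 1).
set (Y := Rpower X (3 / 4)).
assert (HY1 : 1 <= Y).
{ unfold Y; rewrite <- (Rpower_O X) by lra; apply Rle_Rpower; lra. }
assert (Hh' : h' <= K' * Y).
{ assert (H2 : Rpower (2 * X) (3 / 4) <= 2 * Y).
  { rewrite <- Rpower_mult_distr by lra.
    apply Rmult_le_compat_r; [lra|].
    rewrite <- (Rpower_1 2) at 2 by lra; apply Rle_Rpower; lra. }
  unfold h', h, K'; nra. }
assert (EX : X = Y * Rpower X (1 / 4)).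
{ unfold Y; rewrite <- Rpower_plus; replace (3 / 4 + 1 / 4) with 1 by field.
  symmetry; apply Rpower_1; lra. }
set (w := Rpower X (1 / 4 - d)).
assert (Hw1 : 1 <= w).
{ unfold w; rewrite <- (Rpower_O X) at 1 by lra; apply Rle_Rpower; lra. }
assert (E4 : Rpower X (1 / 4) = w * Rpower X d).
{ unfold w; rewrite <- Rpower_plus; f_equal; ring. }
(* With X^d >= 2K' one has (w + 1) K' <= 2 w K' <= X^(1/4), so enough windows fit; the extra 1 is
   lost in passing to the integer [r]. *)
assert (Hq : w + 1 <= X / h').
{ apply Rmult_le_reg_r with h'; [unfold h'; lra|].
  replace (X / h' * h') with X by (field; unfold h'; lra).
  rewrite EX, E4.
  apply Rle_trans with ((w + 1) * (K' * Y)).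
  - apply Rmult_le_compat_l; lra.
  - replace (Y * (w * Rpower X d)) with (w * Rpower X d * Y) by ring.
    rewrite <- Rmult_assoc; apply Rmult_le_compat_r; [lra|].
    apply Rle_trans with (w * (2 * K')); [unfold K'; nra|].
    apply Rmult_le_compat_l; lra. }
destruct (archimed (X / h')) as [U1 U2].
set (r := Z.to_nat (up (X / h') - 1)).
assert (Hup : (1 <= up (X / h'))%Z).
{ assert (0 < up (X / h'))%Z; [apply lt_IZR; simpl; lra|lia]. }
assert (Er : INR r = IZR (up (X / h')) - 1).
{ unfold r; rewrite INR_IZR_INZ, Z2Nat.id by lia; rewrite minus_IZR; reflexivity. }
apply Rle_trans with w.
{ unfold w; apply Rle_Rpower; lra. }
apply Rle_trans with (INR r); [lra|].
assert (Hrh : INR r * h' <= X).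
{ apply Rle_trans with (X / h' * h').
  - apply Rmult_le_compat_r; [unfold h'; lra|lra].
  - right; field; unfold h'; lra. }
apply le_INR, (num_sign_changes_ge A X (2 * X) h h'); [unfold h'; lra| |lra].
intros i Hi.
assert (Hih : 0 <= INR i * h' <= X).
{ split; [apply Rmult_le_pos; [apply pos_INR|unfold h'; lra]|].
  eapply Rle_trans; [|exact Hrh].
  apply Rmult_le_compat_r; [unfold h'; lra|apply le_INR; lia]. }
destruct (H (X + INR i * h') ltac:(lra)) as [m [n [Hm1 [Hm2 [Hn1 [Hn2 Hs]]]]]].
assert (Hlen : K * Rpower (X + INR i * h') (3 / 4) <= h).
{ unfold h; apply Rmult_le_compat_l; [lra|]; apply Rle_Rpower_l; lra. }
exists m, n; split; [exact Hm1|split; [lra|split; [exact Hn1|split; [lra|exact Hs]]]].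
Qed.

(** * Periods, Hecke relations and mean square of an eigenform *)

(** The matrix -I gives f = (-1)^k f. *)
Lemma weight_even (k : Z) (c : nat -> C) (f : C -> C) :
  weakly_modular k f -> qexp c f -> c 1%nat <> 0%C -> Z.Even k.
Proof.
intros Hm Hf H1; destruct (Z.Even_or_Odd k) as [He|Ho]; [exact He|exfalso].
apply H1, (qexp_zero c f Hf); intros z Hz.
pose proof (Hm (-1)%Z 0%Z 0%Z (-1)%Z eq_refl z Hz) as E.
assert (Hn1 : (-1 : C) <> 0%C) by (apply RtoC_inj_neq; lra).
replace ((-1 * z + 0) / (0 * z + -1))%C with z in E
  by (field; intros E0; apply Hn1; rewrite <- E0; ring).
replace (0 * z + -1)%C with (- (1))%C in E by ring.
assert (Hodd : forall m, Nat.Odd m -> ((- (1)) ^ m = - (1))%C).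
{ intros m [j Hj]; subst; rewrite Cpow_add_r, Cpow_mult_r.
  replace ((- (1)) ^ 2)%C with (RtoC 1) by (simpl; ring).
  rewrite Cpow_1_l; simpl; ring. }
assert (Hk : CpowZ (- (1)) k = (- (1))%C).
{ destruct Ho as [j Hj]; destruct k as [|p|p]; [lia| |]; simpl; rewrite Hodd.
  - reflexivity.
  - exists (Z.to_nat j); lia.
  - field; intros E0; apply Hn1; rewrite <- E0; ring.
  - exists (Z.to_nat (- j - 1)); lia. }
rewrite Hk in E.
assert (E2 : (2 * f z)%C = 0%C).
{ replace (2 * f z)%C with (f z - - (1) * f z)%C by ring; rewrite <- E; ring. }
transitivity (/ 2 * (2 * f z))%C; [field; apply RtoC_inj_neq; lra|rewrite E2; ring].
Qed.

Lemma weight_at_least_2 (k : Z) (c : nat -> C) (f : C -> C) :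
  weakly_modular k f -> qexp c f -> c 1%nat <> 0%C ->
  exists l : nat, k = (Z.of_nat (2 * l) + 2)%Z.
Proof.
intros Hm Hf H1; pose proof (weakly_modular_S _ _ Hm) as HS.
destruct (weight_even k c f Hm Hf H1) as [j Hj].
assert (Hk : (0 < k)%Z).
{ apply Z.nle_gt; intros H; apply H1, (modular_weight_nonpos_zero c f k Hf HS H). }
exists (Z.to_nat (j - 1)); lia.
Qed.

(** If the period polynomial were zero, the Eichler integral would be modular of weight -n <= 0 with
    a cuspidal q-expansion, hence zero, contradicting c(1) <> 0. *)
Lemma eichler_period_exists (n : nat) (c : nat -> C) (f : C -> C) :
  Nat.Even n -> S_modular (Z.of_nat n + 2) f -> qexp c f -> c 1%nat <> 0%C ->
  exists P, eichler_period n (qsum (ecoef n c)) P /\ exists i, (i < S n)%nat /\ P i <> 0%C.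
Proof.
intros Hn HS Hf H1.
destruct (period_polynomial c f n Hf HS) as [P HP].
pose proof (qexp_qsum _ (tame_ecoef n c (qexp_tame _ _ Hf))) as HF.
exists P; split.
- split; [exact Hn|split; [|exact HP]].
  intros z m Hz; apply (qexp_periodic _ _ z m HF Hz).
- apply NNPP; intros Hno.
  assert (H0 : forall i, (i < S n)%nat -> P i = 0%C).
  { intros i Hi; apply NNPP; intros H; apply Hno; exists i; auto. }
  assert (HSF : S_modular (- Z.of_nat n) (qsum (ecoef n c))).
  { intros z Hz; pose proof (in_H_neq_0 z Hz) as Hz0.
    assert (E : (z ^ n * qsum (ecoef n c) (-1 / z))%C = qsum (ecoef n c) z).
    { specialize (HP z Hz).
      rewrite (csum_ext _ (fun _ => 0%C)), csum_zero in HP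
        by (intros i Hi; rewrite (H0 i Hi); ring).
      replace (z ^ n * qsum (ecoef n c) (-1 / z))%C with
        (z ^ n * qsum (ecoef n c) (-1 / z) - qsum (ecoef n c) z + qsum (ecoef n c) z)%C by ring.
      rewrite HP; ring. }
    assert (Ek : CpowZ z (- Z.of_nat n) = (/ z ^ n)%C).
    { destruct n as [|n]; [simpl; field; apply RtoC_inj_neq; lra|].
      simpl; rewrite SuccNat2Pos.id_succ; reflexivity. }
    rewrite Ek, <- E; field; apply Cpow_nz, Hz0. }
  pose proof (modular_weight_nonpos_zero _ _ _ HF HSF ltac:(lia) O) as Hz.
  apply H1; unfold ecoef in Hz; simpl (INR 1) in Hz; rewrite Cpow_1_l in Hz.
  replace (c 1%nat) with (c 1%nat / 1)%C by field; exact Hz.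
Qed.

(* The factor n^((k-1)/2) for k = 2l+2. *)
Definition wt (l m : nat) : R := INR m ^ l * sqrt (INR m).

Lemma wt_Rpower (l m : nat) :
  (1 <= m)%nat -> Rpower (INR m) ((IZR (Z.of_nat (2 * l) + 2) - 1) / 2) = wt l m.
Proof.
intros Hm; assert (0 < INR m) by (apply lt_0_INR; lia).
unfold wt; rewrite <- Rpower_sqrt, <- Rpower_pow, <- Rpower_plus by assumption.
f_equal; rewrite plus_IZR, <- INR_IZR_INZ, mult_INR; simpl (INR 2); field.
Qed.

Lemma wt_pos (l m : nat) : (1 <= m)%nat -> 0 < wt l m.
Proof.
intros Hm; assert (0 < INR m) by (apply lt_0_INR; lia).
apply Rmult_lt_0_compat; [apply pow_lt|apply sqrt_lt_R0]; assumption.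
Qed.

Lemma wt_mult (l m n : nat) : wt l (m * n) = wt l m * wt l n.
Proof.
unfold wt; rewrite mult_INR, sqrt_mult, Rpow_mult_distr by apply pos_INR; ring.
Qed.

Lemma wt_sqr (l m : nat) : wt l m * wt l m = INR m ^ (2 * l + 1).
Proof.
unfold wt; replace (2 * l + 1)%nat with (l + l + 1)%nat by lia.
rewrite !pow_add, pow_1.
transitivity (INR m ^ l * INR m ^ l * (sqrt (INR m) * sqrt (INR m))); [ring|].
rewrite sqrt_sqrt by apply pos_INR; reflexivity.
Qed.

(** [wt l p] squared is p^(k-1), so dividing the Hecke relation by [wt l p * wt l m] leaves
    coefficient 1 on A(m/p). *)
Lemma eigenform_hecke_seq (l : nat) (A : nat -> R) (c : nat -> C) (f : C -> C) :
  qexp c f -> A 1%nat = 1 -> (forall m, (1 <= m)%nat -> c m = RtoC (A m * wt l m)) ->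
  (forall p, nprime p -> exists lam, forall z, in_H z ->
     hecke (Z.of_nat (2 * l) + 2) p f z = (lam * f z)%C) ->
  hecke_seq A.
Proof.
intros Hf H1 Hc He; split; [exact H1|]; intros p m Hp Hm.
pose proof (nprime_ge_2 p Hp) as Hp2.
assert (Hw1 : wt l 1 = 1) by (unfold wt; simpl; rewrite pow1, sqrt_1; ring).
destruct (He p Hp) as [lam Hlam].
pose proof (hecke_coefficients _ c f p lam Hp Hf Hlam) as E.
replace (Z.of_nat (2 * l) + 2 - 1)%Z with (Z.of_nat (2 * l + 1)) in E by lia.
rewrite <- pow_powerRZ in E.
assert (El : lam = RtoC (A p * wt l p)).
{ specialize (E 1%nat (le_n 1)); rewrite Nat.mul_1_r, (Hc 1%nat), (Hc p), H1, Hw1 in E by lia.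
  unfold dilate in E; rewrite Nat.mod_small in E by lia; simpl Nat.eqb in E; cbv iota in E.
  rewrite (Rmult_1_r 1), Cmult_1_r in E; rewrite E; ring. }
subst lam; specialize (E m Hm).
rewrite (Hc m Hm), (Hc (p * m)%nat) in E by nia.
pose proof (wt_pos l p ltac:(lia)) as Wp; pose proof (wt_pos l m Hm) as Wm.
unfold dilate in E; rewrite wt_mult in E.
apply Rmult_eq_reg_r with (wt l p * wt l m); [|nra].
destruct (Nat.eqb_spec (m mod p) 0) as [Em|Em].
- assert (Ed : m = (p * (m / p))%nat) by (pose proof (Nat.div_mod_eq m p); lia).
  assert (Hd : (1 <= m / p)%nat) by nia.
  rewrite (Hc (m / p)%nat Hd), <- wt_sqr, <- !RtoC_mult, <- RtoC_plus in E.
  apply RtoC_inj in E.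
  assert (Ew : wt l m = wt l p * wt l (m / p)) by (rewrite <- wt_mult; f_equal; exact Ed).
  rewrite Ew in *; lra.
- rewrite Cmult_0_r, Cplus_0_l, <- RtoC_mult in E; apply RtoC_inj in E; lra.
Qed.

(** Parseval at height y = 1/N: the growth bound there is K N^(l+1), and the weights exp(-4 pi n/N)
    for n <= N are at least exp(-4 pi). *)
Lemma eigenform_mean_square (l : nat) (A : nat -> R) (c : nat -> C) (f : C -> C) :
  qexp c f -> S_modular (Z.of_nat (2 * l) + 2) f ->
  (forall m, (1 <= m)%nat -> c m = RtoC (A m * wt l m)) ->
  exists K, forall N, rsum (fun i => A (S i) ^ 2 * INR (S i) ^ (2 * l + 1)) N <=
    K * INR N ^ (2 * l + 2).
Proof.
intros Hf HS Hc.
destruct (modular_growth c f _ Hf HS) as [K [HK0 HK]].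
exists (K ^ 2 * exp (4 * PI)); intros N.
destruct N as [|N]; [rewrite pow_i by lia; simpl rsum; lra|].
set (M := S N); assert (HM : 0 < INR M) by (apply lt_0_INR; unfold M; lia).
set (s := IZR (Z.of_nat (2 * l) + 2) / 2).
assert (Es : s = INR (l + 1)).
{ unfold s; rewrite plus_IZR, <- INR_IZR_INZ, mult_INR, plus_INR; simpl (INR 2); simpl (INR 1); field. }
assert (HB : rsum (fun i => Cmod (c (S i)) ^ 2 * exp (- (4 * PI * INR (S i) * / INR M))) M <=
  (K * INR M ^ (l + 1)) ^ 2).
{ apply (qexp_parseval c f (/ INR M) _ M Hf); [apply Rinv_0_lt_compat, HM|].
  intros x; eapply Rle_trans; [apply HK; unfold in_H; simpl; apply Rinv_0_lt_compat, HM|].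
  right; f_equal; change (Im (x, / INR M)) with (/ INR M); fold s; rewrite Es, <- Rpower_pow by exact HM.
  unfold Rpower; rewrite ln_Rinv by exact HM; apply f_equal; ring. }
apply Rmult_le_reg_l with (exp (- (4 * PI))); [apply exp_pos|].
rewrite <- rsum_scal.
replace (exp (- (4 * PI)) * (K ^ 2 * exp (4 * PI) * INR M ^ (2 * l + 2))) with
  ((K * INR M ^ (l + 1)) ^ 2).
- eapply Rle_trans; [|exact HB]; apply rsum_le; intros i Hi.
  rewrite (Hc (S i)) by lia.
  rewrite Cmod_R, pow2_abs, Rpow_mult_distr, <- wt_sqr.
  replace (wt l (S i) * wt l (S i)) with (wt l (S i) ^ 2) by ring.
  rewrite Rmult_comm; apply Rmult_le_compat_l.
  + apply Rmult_le_pos; apply pow2_ge_0.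
  + apply exp_le, Ropp_le_contravar.
    assert (Hi1 : INR (S i) * / INR M <= 1).
    { apply Rmult_le_reg_r with (INR M); [exact HM|].
      rewrite Rmult_assoc, Rinv_l, Rmult_1_r, Rmult_1_l by lra; apply le_INR; unfold M in *; lia. }
    pose proof PI_RGT_0; nra.
- transitivity (exp (- (4 * PI)) * exp (4 * PI) * (K ^ 2 * INR M ^ (2 * l + 2))); [|ring].
  rewrite <- exp_plus, Rplus_opp_l, exp_0, Rpow_mult_distr, <- pow_mult.
  replace ((l + 1) * 2)%nat with (2 * l + 2)%nat by lia; ring.
Qed.

Theorem theorem1 (k : Z) (f : C -> C) (A : nat -> R)
  (hcusp : cusp_form k f)
  (heigen : hecke_eigenform k f)
  (hexp : cuspidal_q_expansion f
            (fun n : nat => RtoC (A n * Rpower (INR n) ((IZR k - 1) / 2))))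
  (hnorm : A 1%nat = 1) :
  forall eps : R, 0 < eps ->
  exists X0 : R, forall X : R, X0 <= X ->
    has_sign_change A X (X + Rpower X (3 / 4 + eps)) /\
    Rpower X (1 / 4 - eps) <= INR (num_sign_changes A X (2 * X)).
Proof.
destruct hcusp as [_ [hmod _]]; destruct heigen as [_ heig].
set (c := fun n : nat => RtoC (A n * Rpower (INR n) ((IZR k - 1) / 2))) in hexp.
pose proof (qexp_of_series c f hexp) as Hf.
assert (Hc1 : c 1%nat = 1%C).
{ unfold c; rewrite hnorm; simpl (INR 1); unfold Rpower; rewrite ln_1, Rmult_0_r, exp_0.
  f_equal; ring. }
assert (Hc10 : c 1%nat <> 0%C) by (rewrite Hc1; apply RtoC_inj_neq; lra).
destruct (weight_at_least_2 k c f hmod Hf Hc10) as [l Hk]; subst k.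
pose proof (weakly_modular_S _ _ hmod) as HS.
assert (Hc : forall m, (1 <= m)%nat -> c m = RtoC (A m * wt l m))
  by (intros m Hm; unfold c; rewrite wt_Rpower by exact Hm; reflexivity).
assert (Hhecke : forall p, nprime p -> exists lam, forall z, in_H z ->
  hecke (Z.of_nat (2 * l) + 2) p f z = (lam * f z)%C)
  by (intros p Hp; apply heig; pose proof (nprime_ge_2 p Hp); lia).
pose proof (eigenform_hecke_seq l A c f Hf hnorm Hc Hhecke) as HA.
destruct (eigenform_mean_square l A c f Hf HS Hc) as [K HK].
destruct (eichler_period_exists (2 * l) c f) as [P [HP [i0 [Hi0 Hne]]]];
  [exists l; reflexivity|exact HS|exact Hf|exact Hc10|].
destruct (finitely_many_bad A P (S (2 * l)) i0 l HA Hi0 Hne) as [Q [HQ Hnz]].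
(* A(p) p^l sqrt p is c(p), the Hecke eigenvalue, which maps each period coefficient into the
   Q-span. *)
{ intros p Hp; apply stab_of_generators; intros i Hi.
  pose proof (nprime_ge_2 p Hp) as Hp2.
  change (INR p ^ l * sqrt (INR p)) with (wt l p); rewrite <- Hc by lia.
  apply (hecke_Qspan (2 * l) p (qsum (ecoef (2 * l) c)) P (c p) HP Hp); [|exact Hi].
  apply (eichler_hecke (2 * l) c f p Hp Hf Hc1 (Hhecke p Hp)). }
destruct (negative_square_exists A Q l K HA HQ Hnz HK) as [R0 [HR2 [HRQ HRneg]]].
destruct (short_interval_sign_change A Q R0 HA HQ
  (fun m => square_nonvanishing A Q m HA Hnz) HR2 HRQ HRneg)
  as [B [X1 [HB [HX1 Hshort]]]].
intros eps Heps.
destruct (many_sign_changes A B X1 eps HB HX1 Heps Hshort) as [X2 [HX21 HX2]].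
destruct (Rpower_large eps B Heps) as [X3 [HX3 Hbig]].
exists (X1 + X2 + X3); intros X HX.
split; [|apply HX2; lra].
destruct (Hshort X ltac:(lra)) as [m [n [Hm1 [Hm2 [Hn1 [Hn2 Hs]]]]]].
(* The factor X^eps absorbs the constant B once X is large. *)
assert (Hle : B * Rpower X (3 / 4) <= Rpower X (3 / 4 + eps)).
{ rewrite Rpower_plus, Rmult_comm; apply Rmult_le_compat_l; [left; apply exp_pos|].
  apply Hbig; lra. }
exists m, n; split; [exact Hm1|split; [lra|split; [exact Hn1|split; [lra|exact Hs]]]].
Qed.
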